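(* Let $(R,\mathfrak m)$ be a regular local ring with quotient field $F$ and $\dim R\ge 2$, let $\{(R_i,\mathfrak m_i)\}_{i\ge 0}$ be an infinite sequence of local quadratic transforms with $R_0=R$, let $S=\bigcup_{i\ge 0}R_i$ with maximal ideal $N=\bigcup_i\mathfrak m_i$, and let $T$ be the intersection of all discrete valuation rings with quotient field $F$ that properly contain $S$ (an empty intersection being $F$). Then: (1) $T=S[1/x]$ for any $x\in N$ such that $xS$ is $N$-primary; furthermore $T$ is a localization of $R_i$ for all $i\gg 0$; in particular $T$ is a UFD. (2) $T$ is the intersection of all the rings $R_P$, with $P$ a height $1$ prime ideal of $R$, that contain $S$, together with the (at most $\dim R-1$) order valuation rings $V_i$ that contain $S$. (3) $T$ is a Noetherian regular ring which is the unique minimal proper Noetherian overring of $S$ in $F$ (a field being regarded as a zero-dimensional regular ring).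
   Context: A local quadratic transform of a regular local ring $(A,\mathfrak n)$ is a local ring $A[\mathfrak n/x]_{\mathfrak q}$ with $x\in\mathfrak n\setminus\mathfrak n^2$ and $\mathfrak q$ a prime ideal of $A[\mathfrak n/x]$ containing $\mathfrak n$. The sequence satisfies: for each $i\ge 0$, $R_{i+1}$ is a local quadratic transform of $R_i$, $R_i\subsetneq R_{i+1}$, and each $R_i$ is a regular local ring of dimension at least $2$ with maximal ideal $\mathfrak m_i$. $V_i$ denotes the valuation ring of the order valuation $\mathrm{ord}_i$ of $R_i$ ($\mathrm{ord}_i(a)=\max\{n: a\in\mathfrak m_i^n\}$ for $0\ne a\in R_i$, extended to $F$ by $\mathrm{ord}_i(a/b)=\mathrm{ord}_i(a)-\mathrm{ord}_i(b)$). An overring of $S$ is a ring between $S$ and $F$. An ideal is $N$-primary if its radical is $N$. *)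

(* Defs.v *)
(* All rings in the statement are subrings of the fixed
   quotient field F; subsets of F are represented as predicates F -> Prop. *)
From mathcomp Require Import all_boot all_algebra.
Set Implicit Arguments. Unset Strict Implicit. Unset Printing Implicit Defensive.
Import GRing.Theory Num.Theory.
Local Open Scope ring_scope.

Section CommAlgDefs.
Variable F : fieldType.
Implicit Types (A B I P Q M : F -> Prop).

Definition sub_set A B := forall z, A z -> B z.
Definition set_eq A B := forall z, A z <-> B z.
Definition strict_sub A B := sub_set A B /\ ~ sub_set B A.

Definition is_subring A :=
  [/\ A 0, A 1, (forall x y, A x -> A y -> A (x - y))
   & (forall x y, A x -> A y -> A (x * y))].

Definition is_ideal A I :=
  [/\ sub_set I A, I 0, (forall x y, I x -> I y -> I (x + y))
   & (forall a x, A a -> I x -> I (a * x))].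

Definition is_prime_ideal A P :=
  [/\ is_ideal A P, ~ P 1
   & forall a b, A a -> A b -> P (a * b) -> P a \/ P b].

Definition is_unit A a := A a /\ exists b, A b /\ a * b = 1.

Definition local_ring A m :=
  [/\ is_subring A, is_ideal A m, ~ m 1
   & forall a, A a -> ~ m a -> is_unit A a].

Definition ideal_gen A (G : F -> Prop) : F -> Prop :=
  fun z => forall I, is_ideal A I -> sub_set G I -> I z.

Definition in_seq (s : seq F) : F -> Prop := fun z => z \in s.

Definition noetherian A :=
  is_subring A /\
  forall I, is_ideal A I -> exists s : seq F, set_eq I (ideal_gen A (in_seq s)).

Definition prime_chain A (c : nat -> F -> Prop) (n : nat) :=
  (forall k, (k <= n)%N -> is_prime_ideal A (c k)) /\
  (forall k, (k < n)%N -> strict_sub (c k) (c k.+1)).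

Definition has_prime_chain A n := exists c, prime_chain A c n.

Definition krull_dim A (d : nat) := has_prime_chain A d /\ ~ has_prime_chain A d.+1.

Definition height A P (h : nat) :=
  (exists c, prime_chain A c h /\ set_eq (c h) P) /\
  ~ (exists c, prime_chain A c h.+1 /\ set_eq (c h.+1) P).

Definition regular_local A m (d : nat) :=
  [/\ local_ring A m, noetherian A, krull_dim A d
   & exists s : seq F, size s = d /\ set_eq m (ideal_gen A (in_seq s))].

Definition quotient_field_is A :=
  forall z, exists a b, [/\ A a, A b, b != 0 & z = a / b].

Definition ideal_pow A I (n : nat) : F -> Prop :=
  ideal_gen A (fun z => exists s : seq F,
     [/\ size s = n, (forall y, y \in s -> I y) & z = \prod_(y <- s) y]).

Definition blowup A m (x : F) : F -> Prop :=
  fun z => forall B, is_subring B -> sub_set A B ->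
           (forall a, m a -> B (a / x)) -> B z.

Definition localize B q : F -> Prop :=
  fun z => exists b c, [/\ B b, B c, ~ q c & z = b / c].

Definition localize_max B q : F -> Prop :=
  fun z => exists p c, [/\ q p, B c, ~ q c & z = p / c].

Definition local_quadratic_transform A m B :=
  exists x, [/\ m x, ~ ideal_pow A m 2 x &
    exists q, [/\ is_prime_ideal (blowup A m x) q, sub_set m q
                & set_eq B (localize (blowup A m x) q)]].

(* ord(a) >= ord(b) for the order valuation of (A, m):
   a lies in every power of m that contains b *)
Definition ord_ge A m (a b : F) :=
  forall k, ideal_pow A m k b -> ideal_pow A m k a.

Definition order_val_ring A m : F -> Prop :=
  fun z => exists a b, [/\ A a, A b, b != 0, z = a / b & ord_ge A m a b].

Definition is_DVR V :=
  exists v : F -> int,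
  [/\ (forall x y, x != 0 -> y != 0 -> v (x * y) = v x + v y),
      (forall x y, x != 0 -> y != 0 -> x + y != 0 ->
         (v x <= v (x + y)) \/ (v y <= v (x + y))),
      (exists t, t != 0 /\ v t = 1)
    & (forall z, V z <-> (z = 0 \/ (z != 0 /\ 0 <= v z)))].

Definition divides A a b := exists c, A c /\ b = a * c.
Definition irreducible_elt A p :=
  [/\ A p, p != 0, ~ is_unit A p
   & forall a b, A a -> A b -> p = a * b -> is_unit A a \/ is_unit A b].
Definition associated A a b := exists u, is_unit A u /\ b = u * a.
Definition is_UFD A :=
  is_subring A /\
  (forall a, A a -> a != 0 -> ~ is_unit A a ->
     exists s : seq F, (forall y, y \in s -> irreducible_elt A y) /\
                       a = \prod_(y <- s) y) /\
  (forall s t : seq F, (forall y, y \in s -> irreducible_elt A y) ->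
     (forall y, y \in t -> irreducible_elt A y) ->
     \prod_(y <- s) y = \prod_(y <- t) y ->
     size s = size t /\
     exists f : nat -> nat,
       [/\ (forall i, (i < size s)%N -> (f i < size t)%N),
           (forall i j, (i < size s)%N -> (j < size s)%N -> f i = f j -> i = j)
         & (forall i, (i < size s)%N -> associated A (nth 0 s i) (nth 0 t (f i)))]).

Definition is_localization_of A B :=
  exists M, [/\ sub_set M A, M 1, (forall a b, M a -> M b -> M (a * b)), ~ M 0
             & set_eq B (fun z => exists a c, [/\ A a, M c & z = a / c])].

Definition regular_ring A :=
  noetherian A /\
  forall P, is_prime_ideal A P ->
    exists d, regular_local (localize A P) (localize_max A P) d.

Definition overring S A := is_subring A /\ sub_set S A.
Definition proper_noeth_overring S A :=
  [/\ overring S A, ~ sub_set A S & noetherian A].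
Definition minimal_proper_noeth_overring S A :=
  proper_noeth_overring S A /\
  forall B, proper_noeth_overring S B -> sub_set B A -> set_eq B A.

Definition seq_union (R : nat -> F -> Prop) : F -> Prop := fun z => exists i, R i z.

Definition dvr_hull S : F -> Prop :=
  fun z => forall V, is_DVR V -> sub_set S V -> ~ sub_set V S -> V z.

Definition invert_elt S (x : F) : F -> Prop :=
  fun z => exists s k, S s /\ z = s / x ^+ k.

Definition principal S (x : F) : F -> Prop := fun z => exists s, S s /\ z = x * s.
Definition radical S I : F -> Prop := fun z => S z /\ exists n, I (z ^+ n).

End CommAlgDefs.

(* Main.v *)
(* A quadratic transform R_(i+1) of R_i is a localization of R_i[m_i/x_i], whose ideal (x_i) is prime and has
   local ring V_i; moreover m_i R_(i+1) = x_i R_(i+1), and a regular parameter e of R_i has the strict transform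
   e/x_i, which is again a regular parameter of R_(i+1), independent of x_i, unless it is a unit.  Follow the strict
   transforms of x_i: if V_i contains S they never become units, and those of the different V_i containing S are
   independent parameters; so there are at most dim R - 1 such V_i.  If V_i does not contain S, some strict
   transform of x_i is a unit, so that x_i divides a power of x_(i+1) in S.  Hence x_i S is N-primary for large i,
   and then S[1/x_i] is a localization of R_i, which is a regular ring and a UFD by the theorems of Serre and of
   Auslander and Buchsbaum, which rest on finite free resolutions.

   If A contains S and N generates a proper ideal of A in which no nonzero element of A can be divided infinitely
   often (A a discrete valuation ring or a Noetherian ring), then A = S: for a/b in A, dividing a and b successively
   by x_0, x_1, ... must end with a unit of some R_i.  Therefore 1/x belongs to every discrete valuation ring and to
   every Noetherian ring properly containing S, which gives T = S[1/x] and its minimality.  A localization of T at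
   a prime element descends along the sequence, either to a localization of R at a prime of height one or, if it is
   centered on x_i at some stage, to V_i. *)
From HB Require Import structures.
From mathcomp Require Import all_boot all_order all_algebra.
From mathcomp Require Import boolp ring.
Require Import Defs.
Set Implicit Arguments. Unset Strict Implicit. Unset Printing Implicit Defensive.
Import GRing.Theory Num.Theory.
Local Open Scope ring_scope.

(** * Ideals and dimension theory *)

(** Regularity is defined by a number of generators equal to the Krull dimension, a condition that
    does not visibly pass to localizations. Having a finite free resolution does pass to them, and
    for the maximal ideal it is equivalent to regularity; this is why resolutions enter. They enter
    again in factoriality, where an ideal known to be locally principal must be shown principal: a
    finite resolution makes it stably free, and in rank one a determinant then gives a generator.
    That the order of R_i is a valuation and that (x_i) is prime in the blowup come from one fact:
    for an ideal generated by a regular sequence, initial forms multiply without cancellation. The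
    bound is dim R - 1 and not dim R because the strict transforms of a full system of parameters of
    R_i cannot all lie in m_(i+1): the elements a of R_i with a/x_i in m_(i+1) form an ideal, which
    would then contain m_i, while x_i is not in it. *)

Definition incl (T : Type) (A B : T -> Prop) := forall z, A z -> B z.

Lemma pred_ext (T : Type) (A B : T -> Prop) : incl A B -> incl B A -> A = B.
Proof. by move=> AB BA; apply/funext => z; apply/propext; split; [apply: AB|apply: BA]. Qed.

Section Ideals.
Variable C : comNzRingType.
Implicit Types (I J K P Q X : C -> Prop) (s t : seq C).

Definition idl I :=
  [/\ I 0, (forall x y, I x -> I y -> I (x + y)) & forall a x, I x -> I (a * x)].

Definition prm P := [/\ idl P, ~ P 1 & forall a b, P (a * b) -> P a \/ P b].

(* Quotient rings are avoided by working modulo an ideal: igen I s is I + (s), and rseq I s says that s is a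
   regular sequence on C/I. *)
Definition addg I (x : C) : C -> Prop := fun z => exists c, I (z - c * x).

Definition igen I s := foldr (fun x J => addg J x) I s.

Definition zid : C -> Prop := fun z => z = 0.

Definition noeth := forall I, idl I -> exists s, I = igen zid s.

Definition loc (n : C -> Prop) :=
  [/\ idl n, ~ n 1 & forall a, ~ n a -> exists b, a * b = 1].

Fixpoint rseq I s :=
  if s is x :: s' then (forall a, I (x * a) -> I a) /\ rseq (addg I x) s' else True.

Lemma idl0 I : idl I -> I 0. Proof. by case. Qed.
Lemma idlD I x y : idl I -> I x -> I y -> I (x + y). Proof. by case=> _ h _; apply: h. Qed.
Lemma idlM I a x : idl I -> I x -> I (a * x). Proof. by case=> _ _; apply. Qed.
Lemma idlMr I a x : idl I -> I x -> I (x * a). Proof. by rewrite mulrC; apply: idlM. Qed.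
Lemma idlN I x : idl I -> I x -> I (- x).
Proof. by move=> hI hx; rewrite -mulN1r; apply: idlM. Qed.
Lemma idlB I x y : idl I -> I x -> I y -> I (x - y).
Proof. by move=> hI hx hy; apply: idlD => //; apply: idlN. Qed.
Lemma idlBr I x y : idl I -> I (x - y) -> I y -> I x.
Proof. by move=> hI hxy hy; rewrite -(subrK y x); apply: idlD. Qed.
Lemma idl_sum I (T : Type) (r : seq T) (p : pred T) (f : T -> C) :
  idl I -> (forall i, p i -> I (f i)) -> I (\sum_(i <- r | p i) f i).
Proof.
move=> hI hf; elim/big_ind: _ => //; first exact: idl0.
by move=> x y; apply: idlD.
Qed.

Lemma idl_zid : idl zid.
Proof. by split=> [|x y -> ->|a x ->] //; rewrite /zid ?addr0 ?mulr0. Qed.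

Lemma idl_unit I a b : idl I -> I a -> a * b = 1 -> I 1.
Proof. by move=> hI ha <-; apply: idlMr. Qed.

Lemma prm_idl P : prm P -> idl P. Proof. by case. Qed.
Hint Resolve prm_idl : core.

Lemma prmM P a b : prm P -> ~ P a -> ~ P b -> ~ P (a * b).
Proof. by move=> [_ _ h] na nb /h []. Qed.

Lemma prmX P a k : prm P -> P (a ^+ k) -> P a.
Proof.
move=> hP; elim: k => [|k IH]; first by rewrite expr0; case: hP.
by rewrite exprS; case: (hP) => _ _ h /h [].
Qed.

Lemma loc_idl n : loc n -> idl n. Proof. by case. Qed.
Hint Resolve loc_idl : core.

Lemma loc_max n I : loc n -> idl I -> ~ I 1 -> incl I n.
Proof.
move=> [_ _ hn] hI h1 z hz; apply: contrapT => /hn [b zb]; apply: h1.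
exact: idl_unit zb.
Qed.

Lemma loc_prm n : loc n -> prm n.
Proof.
move=> [hi h1 hn]; split=> // a b hab.
have [|/hn [c ac]] := pselect (n a); first by left.
right; have -> : b = c * (a * b) by rewrite mulrA (mulrC c) ac mul1r.
exact: idlM.
Qed.

Lemma loc1D n a : loc n -> n a -> exists b, (1 + a) * b = 1.
Proof.
move=> [hi h1 hn] ha; apply: hn => h; apply: h1.
by rewrite -(addrK a 1); apply: idlB.
Qed.

Lemma addg_idl I x : idl I -> idl (addg I x).
Proof.
move=> hI; split.
- by exists 0; rewrite mul0r subr0; apply: idl0.
- move=> a b [c hc] [e he]; exists (c + e).
  have -> : a + b - (c + e) * x = (a - c * x) + (b - e * x) by ring.
  exact: idlD.
- move=> a b [c hc]; exists (a * c).
  have -> : a * b - a * c * x = a * (b - c * x) by ring.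
  exact: idlM.
Qed.

Lemma addg_sub I x : incl I (addg I x).
Proof. by move=> z hz; exists 0; rewrite mul0r subr0. Qed.

Lemma addg_mem I x : idl I -> addg I x x.
Proof. by move=> hI; exists 1; rewrite mul1r subrr; apply: idl0. Qed.

Lemma addg_min I J x : idl J -> incl I J -> J x -> incl (addg I x) J.
Proof.
move=> hJ IJ hx z [c /IJ hz]; apply: (idlBr hJ hz); exact: idlM.
Qed.

Lemma addgP I x z : idl I -> addg I x z -> exists c i, I i /\ z = i + c * x.
Proof. by move=> hI [c hc]; exists c, (z - c * x); rewrite subrK. Qed.

Lemma igen_idl I s : idl I -> idl (igen I s).
Proof. by move=> hI; elim: s => //= x s IH; apply: addg_idl. Qed.

Lemma igen_sub I s : incl I (igen I s).
Proof. by elim: s => //= x s IH z hz; apply/addg_sub/IH. Qed.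

Lemma igen_mem I s x : idl I -> x \in s -> igen I s x.
Proof.
move=> hI; elim: s => //= y s IH; rewrite inE => /orP [/eqP ->|/IH h].
  by apply: addg_mem; apply: igen_idl.
exact: addg_sub.
Qed.

Lemma igen_min I J s :
  idl J -> incl I J -> (forall x, x \in s -> J x) -> incl (igen I s) J.
Proof.
move=> hJ IJ; elim: s => //= x s IH hs; apply: addg_min => //.
  by apply: IH => y hy; apply: hs; rewrite inE hy orbT.
by apply: hs; rewrite mem_head.
Qed.

Lemma igen_cat I s t : igen I (s ++ t) = igen (igen I t) s.
Proof. exact: foldr_cat. Qed.

Lemma igen_eqmem I s t : idl I -> s =i t -> igen I s = igen I t.
Proof.
move=> hI st; apply: pred_ext; apply: igen_min (igen_idl _ hI) (@igen_sub I _) _ => x.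
  by rewrite st; apply: igen_mem.
by rewrite -st; apply: igen_mem.
Qed.

Lemma igen_addg I s x : idl I -> igen (addg I x) s = igen I (x :: s).
Proof.
move=> hI; rewrite -[addg I x]/(igen I [:: x]) -igen_cat.
by apply: igen_eqmem => // y; rewrite mem_cat !inE orbC.
Qed.

Lemma noeth_fg J I : noeth -> idl I -> idl J -> incl J I -> exists s, I = igen J s.
Proof.
move=> hN hI hJ JI; have [s Is] := hN I hI; exists s.
have hz : incl zid J by move=> z ->; apply: idl0.
apply: pred_ext.
  rewrite {1}Is; apply: igen_min (igen_idl _ hJ) _ _ => [z /hz /(@igen_sub J s) //|x hx].
  exact: igen_mem.
apply: igen_min => // x hx; rewrite Is; apply: igen_mem => //; exact: idl_zid.
Qed.

(** A family without maximal members would, by choice, yield a strictly increasing sequence of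
    ideals; the finitely many generators of its union already lie in one term. *)
Lemma noeth_max (Fam : (C -> Prop) -> Prop) :
  noeth -> (forall I, Fam I -> idl I) -> (exists I, Fam I) ->
  exists I, Fam I /\ forall J, Fam J -> incl I J -> incl J I.
Proof.
move=> hN hF [I0 FI0]; apply: contrapT => nmax.
have step (I : {I | Fam I}) : exists J : {I | Fam I}, incl (sval I) (sval J) /\ ~ incl (sval J) (sval I).
  case: I => I FI; apply: contrapT => h; apply: nmax; exists I; split=> // J FJ IJ.
  by apply: contrapT => nJI; apply: h; exists (exist _ J FJ).
have [f hf] := choice step.
pose g k := sval (iter k f (exist _ I0 FI0)).
have gS k : incl (g k) (g k.+1) by case: (hf (iter k f (exist _ I0 FI0))).
have gnS k : ~ incl (g k.+1) (g k) by case: (hf (iter k f (exist _ I0 FI0))).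
have gid k : idl (g k) by apply: hF; rewrite /g; case: (iter _ _ _).
have gm k l : (k <= l)%N -> incl (g k) (g l).
  move=> /subnK <-; elim: (l - k)%N => //= i IH z hz; rewrite addSn; apply: gS; exact: IH.
pose U z := exists k, g k z.
have hU : idl U.
  split; first by exists 0%N; apply: idl0.
  - move=> x y [k hk] [l hl]; exists (maxn k l).
    by apply: idlD => //; [apply: gm (leq_maxl _ _) _ hk|apply: gm (leq_maxr _ _) _ hl].
  - by move=> a x [k hk]; exists k; apply: idlM.
have [s Us] := hN U hU.
have [k hk] : exists k, forall x, x \in s -> g k x.
  have : forall x, x \in s -> U x by move=> x hx; rewrite Us; apply: igen_mem => //; apply: idl_zid.
  elim: (s) => [|x t IH] ht; first by exists 0%N.
  have [|k hk] := IH; first by move=> y hy; apply: ht; rewrite inE hy orbT.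
  have [|l hl] := ht x; first by rewrite mem_head.
  exists (maxn k l) => y; rewrite inE => /orP [/eqP ->|/hk h].
    exact: gm (leq_maxr _ _) _ hl.
  exact: gm (leq_maxl _ _) _ h.
apply: (gnS k) => z hz; have : U z by exists k.+1.
rewrite Us; apply: igen_min => // y ->; exact: idl0.
Qed.

Lemma noeth_ind (Pr : (C -> Prop) -> Prop) : noeth ->
  (forall I, idl I -> (forall J, idl J -> incl I J -> ~ incl J I -> Pr J) -> Pr I) ->
  forall I, idl I -> Pr I.
Proof.
move=> hN ih I hI; apply: contrapT => nP.
have [||K [[hK nK] Kmax]] := @noeth_max (fun I => idl I /\ ~ Pr I) hN.
- by move=> J [].
- by exists I.
apply: nK; apply: ih => // J hJ KJ nJK; apply: contrapT => nPJ; apply: nJK.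
exact: Kmax.
Qed.

(** An ideal P maximal among those that contain I and avoid M is prime: if adding a and adding b
    both produced elements of M, the product of these elements would lie in P as soon as a * b
    does. *)
Lemma prm_disjoint I (M : C -> Prop) : noeth -> idl I -> M 1 ->
  (forall a b, M a -> M b -> M (a * b)) -> (forall a, M a -> ~ I a) ->
  exists P, [/\ prm P, incl I P & forall a, M a -> ~ P a].
Proof.
move=> hN hI M1 MM MI.
have [||P [[hP IP MP] Pmax]] :=
  @noeth_max (fun P => [/\ idl P, incl I P & forall a, M a -> ~ P a]) hN.
- by move=> J [].
- by exists I; split=> // z.
exists P; split=> //; split=> //; first exact: MP.
move=> a b hab; apply: contrapT => /not_orP [na nb].
have ext x : ~ P x -> exists m, M m /\ addg P x m.
  move=> nx; apply: contrapT => h; apply: nx.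
  apply: (Pmax (addg P x)); [|exact: addg_sub|exact: addg_mem].
  split; first exact: addg_idl.
    by move=> z /IP; apply: addg_sub.
  by move=> m hm hx; apply: h; exists m.
have [m [hm [c hc]]] := ext a na; have [m' [hm' [e he]]] := ext b nb.
apply: (MP (m * m')); first exact: MM.
have -> : m * m' = m * (m' - e * b) + (m - c * a) * (e * b) + c * e * (a * b) by ring.
by apply: idlD => //; [apply: idlD => //|]; [apply: idlM|apply: idlMr|apply: idlM].
Qed.

(* Maximal annihilators of the module C/X are prime. *)
Lemma max_annihilator X (s0 : C) : noeth -> idl X -> ~ X s0 ->
  exists s : C, [/\ ~ X s, prm (fun a => X (a * s)),
    incl (fun a => X (a * s0)) (fun a => X (a * s)) &
    forall t : C, ~ X t -> incl (fun a => X (a * s)) (fun a => X (a * t)) ->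
      incl (fun a => X (a * t)) (fun a => X (a * s))].
Proof.
move=> hN hX hs0.
have colon (s : C) : idl (fun a => X (a * s)).
  split; first by rewrite mul0r; apply: idl0.
  - by move=> x y hx hy; rewrite mulrDl; apply: idlD.
  - by move=> a x hx; rewrite -mulrA; apply: idlM.
have [||I [[s [ns Is s0s]] Imax]] :=
  @noeth_max (fun I => exists s : C, [/\ ~ X s, I = (fun a => X (a * s)) &
      incl (fun a => X (a * s0)) (fun a => X (a * s))]) hN.
- by move=> I [s [_ -> _]].
- by exists (fun a => X (a * s0)); exists s0; split=> // z.
have smax (t : C) : ~ X t -> incl (fun a => X (a * s)) (fun a => X (a * t)) ->
      incl (fun a => X (a * t)) (fun a => X (a * s)).
  move=> nt st; rewrite -Is; rewrite -Is in st; apply: Imax => //.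
  by exists t; split=> // a /s0s ha; apply: st; rewrite Is.
exists s; split=> //; split=> //; first by rewrite mul1r.
move=> a b hab; have [hb|nb] := pselect (X (b * s)); first by right.
left; apply: (smax (b * s)) => //=.
  by move=> x hx; rewrite mulrCA; apply: idlM.
by rewrite mulrA.
Qed.
End Ideals.

Ltac idl_tac := match goal with
  | |- idl (addg _ _) => apply: addg_idl; idl_tac
  | |- idl (igen _ _) => apply: igen_idl; idl_tac
  | |- idl (@zid _) => exact: idl_zid
  | H : idl ?I |- idl ?I => exact: H
  | H : prm ?I |- idl ?I => exact: (prm_idl H)
  | H : loc ?I |- idl ?I => exact: (loc_idl H)
  end.
#[global] Hint Extern 0 (idl _) => solve [idl_tac] : core.

(** * Krull's principal ideal theorem, heights and regular sequences *)

Section Dimension.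
Variable C : comNzRingType.
Implicit Types (I J K P Q X : C -> Prop) (s t : seq C).

(** The contraction to C of the extension of X to the localization of C at Q; it allows local
    statements at Q to be made inside C. *)
Definition satur Q X : C -> Prop := fun a => exists c, ~ Q c /\ X (c * a).

Lemma satur_idl Q X : prm Q -> idl X -> idl (satur Q X).
Proof.
move=> hQ hX; split.
- by exists 1; split; [case: hQ|rewrite mulr0; apply: idl0].
- move=> x y [c [nc hc]] [e [ne he]]; exists (c * e); split; first exact: prmM.
  have -> : c * e * (x + y) = e * (c * x) + c * (e * y) by ring.
  by apply: idlD => //; apply: idlM.
- move=> a x [c [nc hc]]; exists c; split=> //.
  by rewrite mulrCA; apply: idlM.
Qed.

Lemma satur_sub Q X : prm Q -> incl X (satur Q X).
Proof. by move=> hQ z hz; exists 1; split; [case: hQ|rewrite mul1r]. Qed.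

Lemma satur_idem Q X : prm Q -> incl (satur Q (satur Q X)) (satur Q X).
Proof.
move=> hQ z [c [nc [e [ne h]]]]; exists (e * c); split; first exact: prmM.
by rewrite -mulrA.
Qed.

Lemma satur_mono Q X Y : incl X Y -> incl (satur Q X) (satur Q Y).
Proof. by move=> XY z [c [nc /XY h]]; exists c. Qed.

(* Noetherian induction on X: adjoin a socle element of C/X localized at Q. *)
Lemma artinian_chain Q X : noeth C -> prm Q -> idl X ->
  (forall y, Q y -> exists k, satur Q X (y ^+ k)) ->
  forall S : nat -> C -> Prop, (forall n, idl (S n)) ->
  (forall n, incl (S n.+1) (S n)) -> (forall n, incl X (S n)) ->
  exists n0, forall n, (n0 <= n)%N -> incl (S n) (satur Q (S n.+1)).
Proof.
move=> hN hQ hX; move: X hX.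
apply: (noeth_ind hN) => X hX IH Xpow S hS Sdec XS.
have [[c [nc hc]]|n1] := pselect (satur Q X 1).
  exists 0%N => n _ z _; exists c; split=> //; apply: idlMr => //.
  by rewrite mulr1 in hc; apply: XS.
have hsX : idl (satur Q X) by apply: satur_idl.
have [s [ns sP _ _]] := max_annihilator hN hsX n1.
have Qs y : Q y -> satur Q X (y * s).
  move=> hy; have [k hk] := Xpow y hy.
  by apply: (prmX sP (k := k)) => /=; apply: idlMr.
have [|||||n0 hn0] := IH (addg X s) (addg_idl s hX) (@addg_sub _ X s) _ _ (fun n => addg (S n) s).
- move=> h; apply: ns; apply: satur_sub => //; apply: h; exact: addg_mem.
- move=> y /Xpow [k hk]; exists k; apply: satur_mono hk; exact: addg_sub.
- by move=> n; apply: addg_idl.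
- by move=> n; apply: addg_min => [|z /Sdec|]; [apply: addg_idl|apply: addg_sub|apply: addg_mem].
- by move=> n; apply: addg_min => [|z /(XS n)|]; [apply: addg_idl|apply: addg_sub|apply: addg_mem].
have Sm k l : (k <= l)%N -> incl (S l) (S k).
  move=> /subnK <-; elim: (l - k)%N => //= i IHi z; rewrite addSn => /Sdec; exact: IHi.
(* The induction will give c * a = b + t * s with b in S n.+1. If s lies locally outside some S n,
   then t must be in Q, since otherwise t would be invertible locally and put s in S n; so t * s is
   locally in X. If s lies locally in every S n, then t * s is locally in S n.+1 anyway. *)
have [[n1' hn1]|hall] := pselect (exists n, ~ satur Q (S n) s).
  exists (maxn n0 n1') => n; rewrite geq_max => /andP [n0n n1n] a ha.
  have [|c [nc hc]] := hn0 n n0n a; first exact: addg_sub.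
  have [t [b [hb e]]] := addgP (hS n.+1) hc.
  apply: satur_idem => //; exists c; split=> //; rewrite e.
  apply: idlD; [exact: satur_idl|exact: satur_sub|].
  have [/Qs ht|nt] := pselect (Q t).
    by apply: satur_mono ht; apply: XS.
  case: hn1; exists t; split=> //; apply: (Sm _ _ n1n).
  have -> : t * s = c * a - b by rewrite e addrAC subrr add0r.
  by apply: idlB => //; [apply: idlM|apply: Sdec].
exists n0 => n n0n a ha.
have [|c [nc hc]] := hn0 n n0n a; first exact: addg_sub.
have [t [b [hb e]]] := addgP (hS n.+1) hc.
apply: satur_idem => //; exists c; split=> //; rewrite e.
apply: idlD; [exact: satur_idl|exact: satur_sub|apply: idlM; first exact: satur_idl].
by apply: contrapT => h; apply: hall; exists n.+1.
Qed.

(** If no such prime exists, Q2 is minimal over Q0 + (x), so C/(Q0 + (x)) is artinian at Q2. For y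
    in Q1 outside Q0, the ideals Q0 + (y^n), saturated at Q1, then stabilize modulo x locally at Q2,
    and by Nakayama two successive ones coincide. This makes some element outside Q1 a multiple of y
    modulo Q0, hence an element of Q1. *)
Lemma principal_ideal_theorem Q0 Q1 Q2 x : noeth C ->
  prm Q0 -> prm Q1 -> prm Q2 -> incl Q0 Q1 -> ~ incl Q1 Q0 ->
  incl Q1 Q2 -> ~ incl Q2 Q1 -> Q2 x ->
  exists Q', [/\ prm Q', incl Q0 Q', Q' x, incl Q' Q2 & ~ incl Q2 Q'].
Proof.
move=> hN p0 p1 p2 Q01 nQ01 Q12 nQ12 x2; apply: contrapT => hno.
have [x1|nx1] := pselect (Q1 x); first by apply: hno; exists Q1.
pose X := addg Q0 x.
have hX : idl X by apply: addg_idl; apply: prm_idl.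
have Xpow y : Q2 y -> exists k, satur Q2 X (y ^+ k).
  move=> hy; apply: contrapT => hk.
  have [|||P [hP XP MP]] := @prm_disjoint _ X (fun a => exists c k, ~ Q2 c /\ a = c * y ^+ k) hN hX.
  - by exists 1, 0%N; split; [case: p2|rewrite expr0 mulr1].
  - move=> a b [c [k [nc ->]]] [e [l [ne ->]]]; exists (c * e), (k + l)%N; split; first exact: prmM.
    by rewrite exprD; ring.
  - by move=> a [c [k [nc ->]]] h; apply: hk; exists k, c.
  apply: hno; exists P; split=> //.
  - by move=> z hz; apply/XP/addg_sub.
  - by apply/XP/addg_mem/prm_idl.
  - move=> z hz; apply: contrapT => nz; apply: (MP z) => //.
    by exists z, 0%N; rewrite expr0 mulr1.
  - move=> h; apply: (MP y); last exact: h.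
    by exists 1, 1%N; split; [case: p2|rewrite mul1r expr1].
have [y y1 ny0] : exists2 y, Q1 y & ~ Q0 y.
  by apply: contrapT => h; apply: nQ01 => y hy; apply: contrapT => ny; apply: h; exists y.
pose S n := satur Q1 (addg Q0 (y ^+ n)).
have hS n : idl (S n) by apply: satur_idl => //; apply: addg_idl; apply: prm_idl.
have Sdec n : incl (S n.+1) (S n).
  apply: satur_mono; apply: addg_min; [exact/addg_idl/prm_idl|exact: addg_sub|].
  by rewrite exprS; apply: idlM; [apply/addg_idl/prm_idl|apply/addg_mem/prm_idl].
have Q0S n : incl Q0 (S n) by move=> z hz; apply: satur_sub => //; apply: addg_sub.
have [|||n0 hn0] := artinian_chain hN p2 hX Xpow (S := fun n => addg (S n) x).
- by move=> n; apply: addg_idl.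
- by move=> n; apply: addg_min => [|z /Sdec|]; [apply: addg_idl|apply: addg_sub|apply: addg_mem].
- by move=> n; apply: addg_min => [|z /(Q0S n)|]; [apply: addg_idl|apply: addg_sub|apply: addg_mem].
pose T := S n0.+1.
(* Nakayama over the localization at Q2, for S n0 = T + x S n0 *)
have [s Ss] := noeth_fg hN (hS n0) (hS n0.+1) (Sdec n0).
have TQ2 : incl (satur Q2 T) T.
  move=> z [c [nc [e [ne h]]]]; exists (e * c); split; last by rewrite -mulrA.
  by apply: prmM => // /Q12.
have key : incl (S n0) T.
  have : exists s, incl (S n0) (satur Q2 (igen T s)) /\ forall z, z \in s -> S n0 z.
    exists s; split; first by move=> z; rewrite {1}Ss; apply: satur_sub.
    by move=> z hz; rewrite Ss; apply: igen_mem.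
  case=> {s Ss} s; elim: s => [|z s IH] [hs sS]; first by move=> w /hs /TQ2.
  apply: IH; split; last by move=> w hw; apply: sS; rewrite inE hw orbT.
  have hI : idl (igen T s) by apply: igen_idl; apply: hS.
  have zS : S n0 z by apply: sS; rewrite mem_head.
  have hz : satur Q2 (igen T s) z.
    have [|c [nc hc]] := hn0 n0 (leqnn _) z; first exact: addg_sub.
    have [t [b [hb e]]] := addgP (hS n0.+1) hc.
    have tS : S n0 t.
      have htx : S n0 (x * t).
        have -> : x * t = c * z - b by rewrite e; ring.
        by apply: idlB => //; [apply: idlM|apply: Sdec].
      case: htx => f [nf hf]; exists (f * x); split; first exact: prmM.
      by rewrite -mulrA.
    have [e' [ne' he']] := hs _ tS.
    have [f [g [hg eg]]] := addgP hI he'.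
    exists (e' * c - x * f); split.
      move=> h; have /(prmM p2 ne') : ~ Q2 c by []; apply.
      by apply: (idlBr (prm_idl p2) h); apply: idlMr => //; apply: prm_idl.
    have -> : (e' * c - x * f) * z = e' * (c * z) - x * (f * z) by ring.
    have -> : f * z = e' * t - g by rewrite eg; ring.
    have -> : e' * (c * z) - x * (e' * t - g) = e' * b + x * g by rewrite e; ring.
    by apply: idlD => //; apply: idlM => //; apply: igen_sub.
  move=> w /hs [c [nc hc]]; apply: satur_idem => //; exists c; split=> //.
  move: hc; apply: addg_min => //; first exact: satur_idl.
  exact: satur_sub.
have : T (y ^+ n0) by apply/key/satur_sub/addg_mem/prm_idl.
case=> c [nc hc]; have [b [q [hq e]]] := addgP (prm_idl p0) hc.
have hyc : Q0 (y ^+ n0 * (c - b * y)).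
  have -> : y ^+ n0 * (c - b * y) = q by rewrite exprS in e; rewrite -(addrK (b * (y * y ^+ n0)) q) -e; ring.
  exact: hq.
case: (p0) => _ _ /(_ _ _ hyc) [/(prmX p0) //|/Q01 h].
by apply: nc; apply: (idlBr (prm_idl p1) h); apply: idlM => //; apply: prm_idl.
Qed.

Definition chain (c : nat -> C -> Prop) n :=
  (forall k, (k <= n)%N -> prm (c k)) /\
  (forall k, (k < n)%N -> incl (c k) (c k.+1) /\ ~ incl (c k.+1) (c k)).

Lemma chain_take c n k : (k <= n)%N -> chain c n -> chain c k.
Proof.
move=> kn [h1 h2]; split=> i hi; [apply: h1|apply: h2]; exact: leq_trans hi kn.
Qed.

Lemma chain_incl c n i j : chain c n -> (i <= j <= n)%N -> incl (c i) (c j).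
Proof.
move=> [_ h] /andP [/subnK <-]; elim: (j - i)%N => [_ z|k IH] //; rewrite addSn => hk z hz.
by case: (h _ hk) => h1 _; apply/h1/IH => //; apply: ltnW.
Qed.

Lemma chain_behead c n : chain c n.+1 -> chain (c \o S) n.
Proof. by move=> [h1 h2]; split=> k hk; [apply: h1|apply: h2]. Qed.

Lemma chain_cons P c n : prm P -> incl P (c 0%N) -> ~ incl (c 0%N) P -> chain c n ->
  chain (fun k => if k is k'.+1 then c k' else P) n.+1.
Proof. by move=> hP h1 h2 [h3 h4]; split=> -[|k] hk //; [apply: h3|apply: h4]. Qed.

Lemma chain_rcons P c n : prm P -> incl (c n) P -> ~ incl P (c n) -> chain c n ->
  chain (fun k => if (k <= n)%N then c k else P) n.+1.
Proof.
move=> hP h1 h2 [h3 h4]; split=> k hk; first by case: ifP => // kn; apply: h3.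
rewrite ltnS in hk; rewrite hk; case: ifP => [kn|/negbT]; first exact: h4.
by rewrite -ltnNge ltnS => nk; have -> : k = n by apply/eqP; rewrite eqn_leq hk.
Qed.

(** The principal ideal theorem is applied to three consecutive primes at the top of the chain and
    replaces the middle one by a prime containing x; repeated downwards, this brings x into the
    first prime above the bottom. *)
Lemma chain_exchange n c x : noeth C -> chain c n.+1 -> c n.+1 x ->
  exists c', [/\ chain c' n.+1, c' 0%N = c 0%N, c' n.+1 = c n.+1 & c' 1%N x].
Proof.
move=> hN; elim: n c => [|n IH] c hc hx; first by exists c.
have [hx'|nx] := pselect (c n.+1 x).
  have [c' [h1 h2 h3 h4]] := IH c (chain_take (leqnSn _) hc) hx'.
  exists (fun k => if (k <= n.+1)%N then c' k else c n.+2); split=> //; last by rewrite ltnn.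
  apply: chain_rcons => //; [|rewrite h3|rewrite h3].
  - by case: hc => h _; apply: h.
  - by case: hc => _ h; case: (h n.+1).
  - by case: hc => _ h; case: (h n.+1).
have [p h] := hc.
have [||||||||Q' [pQ h1 h2 h3 h4]] := @principal_ideal_theorem (c n) (c n.+1) (c n.+2) x hN.
- by apply: p; rewrite ltnW.
- by apply: p.
- exact: p.
- by case: (h n).
- by case: (h n).
- by case: (h n.+1).
- by case: (h n.+1).
- exact: hx.
have [||c' [g1 g2 g3 g4]] := IH (fun k => if (k <= n)%N then c k else Q').
- apply: chain_rcons => //; last by apply: chain_take hc; rewrite ltnW.
  by move=> QI; apply: nx; case: (h n _) => // hi _; apply/hi/QI.
- by rewrite ltnn.
rewrite ltnn leq0n in g2 g3.
exists (fun k => if (k <= n.+1)%N then c' k else c n.+2); split=> //; last by rewrite ltnn.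
apply: chain_rcons => //; rewrite ?g3 //; exact: p.
Qed.

(** The last hypothesis says that c n is minimal over c 0 + (s). Exchanging the first generator into
    the prime c 1 leaves a chain above c 1 that is governed by the remaining generators. *)
Lemma height_theorem c n s : noeth C -> chain c n -> (forall x, x \in s -> c n x) ->
  (forall P, prm P -> incl (c 0%N) P -> (forall x, x \in s -> P x) -> incl P (c n) ->
     incl (c n) P) -> (n <= size s)%N.
Proof.
move=> hN; elim: s c n => [|x s IH] c n hc sc hmin.
  case: n hc sc hmin => // n hc _ hmin.
  have [p h] := hc; case: (h n (leqnn _)) => _ []; move=> z /hmin h'.
  apply: (@chain_incl c n.+1 0%N n) => //; first by rewrite leqnSn.
  apply: h' => //; first exact: p.
  by apply: chain_incl hc _; rewrite leqnn.
case: n hc sc hmin => // n hc sc hmin.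
have [|c' [h1 h2 h3 h4]] := chain_exchange hN hc (x := x); first by apply: sc; rewrite mem_head.
rewrite ltnS; apply: (IH (c' \o S)) => /=; rewrite ?h3.
- exact: chain_behead.
- by move=> y hy; apply: sc; rewrite inE hy orbT.
- move=> P pP c1P sP; apply: hmin => //.
    by rewrite -h2 => z hz; apply/c1P/(chain_incl (i := 0%N) h1).
  by move=> y; rewrite inE => /orP [/eqP ->|/sP //]; apply: c1P.
Qed.

Section Local.
Variable n : C -> Prop.
Hypotheses (hN : noeth C) (hn : loc n).
#[local] Hint Resolve hn : core.

Lemma dim_le J z c k : idl J -> n = igen J z -> chain c k -> incl J (c 0%N) -> (k <= size z)%N.
Proof.
move=> hJ nz hc Jc.
have znm : forall x, x \in z -> n x by move=> x hx; rewrite nz; apply: igen_mem.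
have pk i : (i <= k)%N -> incl (c i) n.
  by case: hc => h _ /h pi; apply: loc_max => //; case: pi.
have bound c' l : chain c' l -> c' l = n -> incl J (c' 0%N) -> (l <= size z)%N.
  move=> hc' cl Jc'; apply: (height_theorem hN hc'); rewrite cl //.
  move=> P hP c0P zP Pn; rewrite nz; apply: igen_min => //.
  by move=> w /Jc'; apply: c0P.
have [h|h] := pselect (incl n (c k)).
  by apply: bound hc _ Jc; apply: pred_ext => //; apply: pk.
apply: ltnW; apply: bound (chain_rcons (loc_prm hn) (pk k (leqnn k)) h hc) _ _; last by [].
by rewrite ltnn.
Qed.

Lemma ascending_seq_stable J (a : nat -> C) : idl J ->
  (forall k, exists c, J (a k - c * a k.+1)) -> exists k c, J (a k.+1 - c * a k).
Proof.
move=> hJ ha.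
have aS k : incl (addg J (a k)) (addg J (a k.+1)).
  by apply: addg_min; [exact: addg_idl|exact: addg_sub|exact: ha].
have [||I [[k ->] Imax]] := @noeth_max _ (fun I => exists k, I = addg J (a k)) hN.
- by move=> I [k ->]; apply: addg_idl.
- by exists (addg J (a 0%N)), 0%N.
have h : addg J (a k) (a k.+1) by apply: (Imax (addg J (a k.+1))); [exists k.+1|apply: aS|apply: addg_mem].
by exists k.
Qed.

(** Modulo J, write b = x^k a_k. Cancelling powers of x gives a_k = x a_(k+1), so the ideals J +
    (a_k) increase and stop; then a_(k+1) = c x a_(k+1) for some c, and 1 - c x is a unit. *)
Lemma krull_intersection J x b : idl J -> n x -> (forall a, J (x * a) -> J a) ->
  (forall k, exists a, J (b - x ^+ k * a)) -> J b.
Proof.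
move=> hJ hx xreg hb; have [a ha] := choice hb.
have xk k y : J (x ^+ k * y) -> J y.
  by elim: k => [|k IH]; rewrite ?expr0 ?mul1r // exprS -mulrA => /xreg.
have step k : J (a k - x * a k.+1).
  apply: (xk k); have -> : x ^+ k * (a k - x * a k.+1) = (b - x ^+ k.+1 * a k.+1) - (b - x ^+ k * a k).
    by rewrite exprS; ring.
  exact: idlB.
have [|k [c hc]] := ascending_seq_stable hJ (a := a); first by move=> k; exists x.
have hak : J (a k.+1).
  have [|e he] := @loc1D _ n (- (c * x)) hn; first by apply: idlN => //; apply: idlM => //.
  have -> : a k.+1 = e * ((1 + - (c * x)) * a k.+1) by rewrite mulrA (mulrC e) he mul1r.
  apply: idlM => //.
  have -> : (1 + - (c * x)) * a k.+1 = (a k.+1 - c * a k) + c * (a k - x * a k.+1) by ring.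
  by apply: idlD => //; apply: idlM.
by apply: (idlBr hJ (ha k.+1)); apply: idlM.
Qed.

Lemma nakayama1 I J x : idl I -> idl J -> incl J I -> n x ->
  (forall a, I a -> exists b, I b /\ J (a - x * b)) -> incl I J.
Proof.
move=> hI hJ JI hx h.
have [s Is] := noeth_fg hN hI hJ JI.
have : exists s, incl I (igen J s) /\ forall z, z \in s -> I z.
  by exists s; split; rewrite Is // => z hz; apply: igen_mem.
case=> {s Is} s; elim: s => [|z s IH] [hs sI] //.
apply: IH; split; last by move=> w hw; apply: sI; rewrite inE hw orbT.
have hJs : idl (igen J s) by apply: igen_idl.
have [|b [hb zb]] := h z; first by apply: sI; rewrite mem_head.
have [c [g [hg eb]]] := addgP hJs (hs _ hb).
have [|e he] := @loc1D _ n (- (x * c)) hn; first by apply: idlN => //; apply: idlMr => //.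
move=> w /hs; apply: addg_min => //.
have -> : z = e * ((1 + - (x * c)) * z) by rewrite mulrA (mulrC e) he mul1r.
apply: idlM => //.
have -> : (1 + - (x * c)) * z = (z - x * b) + x * g by rewrite eb; ring.
by apply: idlD; [|apply: igen_sub|apply: idlM].
Qed.

(** By induction J + (x) is prime. An element outside J is x^k b modulo J with b outside J + (x), so
    a product of two such elements is a power of x times an element outside J + (x), and x is
    regular modulo J. *)
Lemma rseq_prm J z : idl J -> n = igen J z -> rseq J z -> prm J.
Proof.
elim: z J => [|x z IH] J hJ nz /=; first by rewrite -[J]/(igen J [::]) -nz => _; apply: loc_prm.
move=> [xreg hz].
have hx : n x by rewrite nz; apply: addg_mem; apply: igen_idl.
have hP : prm (addg J x) by apply: IH => //; rewrite igen_addg.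
have Jx y : addg J x y -> exists c, J (y - x * c).
  by move=> [c hc]; exists c; rewrite mulrC.
have decomp a : ~ J a -> exists k b, ~ addg J x b /\ J (a - x ^+ k * b).
  move=> na; apply: contrapT => h; apply: na; apply: (krull_intersection hJ hx xreg) => k.
  elim: k => [|k [b hb]]; first by exists a; rewrite expr0 mul1r subrr; apply: idl0.
  have /Jx [c hc] : addg J x b by apply: contrapT => nb; apply: h; exists k, b.
  exists c; have -> : a - x ^+ k.+1 * c = (a - x ^+ k * b) + x ^+ k * (b - x * c).
    by rewrite exprS; ring.
  by apply: idlD => //; apply: idlM.
have xk k y : J (x ^+ k * y) -> J y.
  by elim: k => [|k IHk]; rewrite ?expr0 ?mul1r // exprS -mulrA => /xreg.
split=> //.
  by move=> h; case: hP => _ h1 _; apply: h1; apply: addg_sub.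
move=> a b hab; apply: contrapT => /not_orP [/decomp [k [a' [na' ha]]] /decomp [l [b' [nb' hb]]]].
apply: (prmM hP na' nb'); apply: addg_sub; apply: (xk (k + l)%N).
have -> : x ^+ (k + l) * (a' * b') =
  a * b - (a - x ^+ k * a') * b - x ^+ k * a' * (b - x ^+ l * b') by rewrite exprD; ring.
by apply: idlB => //; [apply: idlB => //; apply: idlMr|apply: idlM].
Qed.

Lemma rseq_chain J z : idl J -> n = igen J z -> rseq J z ->
  exists c, [/\ chain c (size z), c 0%N = J & c (size z) = n].
Proof.
elim: z J => [|x z IH] J hJ nz hz.
  by exists (fun=> J); split=> //; split=> // k _; apply: rseq_prm hz.
have hP : prm J by apply: rseq_prm hz.
have hJx : idl (addg J x) by apply: addg_idl.
have nz' : n = igen (addg J x) z by rewrite igen_addg.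
case: hz => xreg hz; have [c [h1 h2 h3]] := IH _ hJx nz' hz.
exists (fun k => if k is k'.+1 then c k' else J); split=> //.
apply: chain_cons; rewrite ?h2 //; first exact: addg_sub.
move=> h; have /h : addg J x x by apply: addg_mem.
by rewrite -[x]mulr1 => /xreg; case: hP.
Qed.

(** After x is exchanged into the second prime of the chain, induction and the dimension bound
    identify this prime with J + (x). Each element of the bottom prime P is then x b modulo J with b
    in P, so P = J by Nakayama; as P is a prime without x, x is regular modulo J. *)
Lemma dim_rseq J z c : idl J -> n = igen J z -> chain c (size z) -> incl J (c 0%N) -> rseq J z.
Proof.
elim: z J c => [|x z IH] J c hJ nz hc Jc //.
have hJx : idl (addg J x) by apply: addg_idl.
have nz' : n = igen (addg J x) z by rewrite igen_addg.
have ctop : c (size z).+1 = n.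
  apply: pred_ext; first by case: (hc) => p _; apply: loc_max => //; [apply/prm_idl/p|case: (p _ (leqnn (size z).+1))].
  apply: contrapT => h.
  have cn : incl (c (size z).+1) n.
    by case: (hc) => p _; apply: loc_max => //; [apply/prm_idl/p|case: (p _ (leqnn (size z).+1))].
  by have := dim_le (J := J) (z := x :: z) hJ nz (chain_rcons (loc_prm hn) cn h hc) Jc; rewrite ltnn.
have [|c' [h1 h2 h3 h4]] := chain_exchange hN hc (x := x).
  by rewrite ctop nz; apply: addg_mem; apply: igen_idl.
have c'p k : (k <= (size z).+1)%N -> prm (c' k) by case: h1 => h _; apply: h.
have Jxc' : incl (addg J x) (c' 1%N).
  apply: addg_min => //; first by apply: prm_idl; apply: c'p.
  by move=> w /Jc; rewrite -h2; apply: (chain_incl h1).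
have hz : rseq (addg J x) z by apply: (IH _ (c' \o S)) => //; apply: chain_behead.
have hP : prm (addg J x) by apply: rseq_prm hz.
have E1 : incl (c' 1%N) (addg J x).
  apply: contrapT => h.
  by have := dim_le hJx nz' (chain_cons hP Jxc' h (chain_behead h1)) (fun w hw => hw); rewrite ltnn.
have [c01 nc01] : incl (c' 0%N) (c' 1%N) /\ ~ incl (c' 1%N) (c' 0%N) by case: h1 => _ h; apply: h.
have p0 : prm (c' 0%N) by apply: c'p.
have nx : ~ c' 0%N x.
  move=> hx; apply: nc01 => w /E1; apply: addg_min => //; by rewrite h2.
have c0J : incl (c' 0%N) J.
  apply: (@nakayama1 _ _ x) => //; [by rewrite h2|by rewrite nz; apply: addg_mem; apply: igen_idl|].
  move=> a ha; have [b [j [hj ea]]] := addgP hJ (E1 _ (c01 _ ha)).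
  exists b; split; last by rewrite ea mulrC addrK.
  case: (p0) => _ _ h; case: (h b x) => //.
  have -> : b * x = a - j by rewrite ea addrC addKr.
  by apply: idlB => //; rewrite h2; apply: Jc.
have EJ : c' 0%N = J by apply: pred_ext => //; rewrite h2.
split=> // a; rewrite -EJ => h; case: (p0) => _ _ h'; by case: (h' _ _ h).
Qed.
End Local.
End Dimension.

(** * Finite free resolutions *)

Section MatrixModules.
Variable C : comNzRingType.
Implicit Types (J I : C -> Prop).

(* A submodule K of (C/J)^k is represented by its preimage in C^k, and span J M and ker J M are the image and the
   kernel of M : (C/J)^r -> (C/J)^k; pd J s K says that K has a free resolution of length s over C/J. *)
Definition vin J k (u : 'rV[C]_k) := forall i, J (u 0 i).

Definition span J r k (M : 'M[C]_(r, k)) : 'rV[C]_k -> Prop :=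
  fun u => exists w, vin J (u - w *m M).

Definition ker J r k (M : 'M[C]_(r, k)) : 'rV[C]_r -> Prop := fun w => vin J (w *m M).

Definition smod J k (K : 'rV[C]_k -> Prop) :=
  [/\ incl (@vin J k) K, (forall u v, K u -> K v -> K (u + v)) & forall a u, K u -> K (a *: u)].

Definition dsum k l (K : 'rV[C]_k -> Prop) (L : 'rV[C]_l -> Prop) : 'rV[C]_(k + l) -> Prop :=
  fun u => K (lsubmx u) /\ L (rsubmx u).

Fixpoint pd J s k (K : 'rV[C]_k -> Prop) : Prop :=
  exists r (M : 'M[C]_(r, k)), K = span J M /\
    if s is s'.+1 then pd J s' (ker J M) else incl (ker J M) (@vin J r).

Lemma igenP J s z : igen J s z <-> exists w : 'rV_(size s), J (z - \sum_i w 0 i * s`_i).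
Proof.
elim: s z => [|x s IH] z /=.
  split=> [h|[w]]; last by rewrite big_ord0 subr0.
  by exists 0; rewrite big_ord0 subr0.
split=> [[c /IH [w hw]]|[w]].
  exists (\row_i (if unlift ord0 i is Some j then w 0 j else c)).
  rewrite big_ord_recl mxE unlift_none /=.
  rewrite (eq_bigr (fun i => w 0 i * s`_i)) => [|i _]; first by rewrite opprD addrA.
  by rewrite mxE liftK.
rewrite big_ord_recl /= opprD addrA => h; exists (w 0 0); apply/IH.
by exists (\row_i w 0 (lift ord0 i)); under eq_bigr do rewrite mxE.
Qed.

Section Basics.
Variable J : C -> Prop.
Hypothesis hJ : idl J.

Lemma vin_eq0 k (u : 'rV[C]_k) : u = 0 -> vin J u.
Proof. by move=> -> i; rewrite mxE; apply: idl0. Qed.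
Lemma vinD k (u v : 'rV[C]_k) : vin J u -> vin J v -> vin J (u + v).
Proof. by move=> hu hv i; rewrite mxE; apply: idlD. Qed.
Lemma vinZ k a (u : 'rV[C]_k) : vin J u -> vin J (a *: u).
Proof. by move=> hu i; rewrite mxE; apply: idlM. Qed.
Lemma vinN k (u : 'rV[C]_k) : vin J u -> vin J (- u).
Proof. by rewrite -scaleN1r; apply: vinZ. Qed.
Lemma vinB k (u v : 'rV[C]_k) : vin J u -> vin J v -> vin J (u - v).
Proof. by move=> hu hv; apply/vinD/vinN. Qed.
Lemma vinM k l (u : 'rV[C]_k) (M : 'M_(k, l)) : vin J u -> vin J (u *m M).
Proof. by move=> hu i; rewrite mxE; apply: idl_sum => // j _; apply: idlMr. Qed.

Lemma vin_lr k l (u : 'rV[C]_(k + l)) : vin J u <-> vin J (lsubmx u) /\ vin J (rsubmx u).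
Proof.
split=> [hu|[hl hr] i]; first by split=> i; rewrite mxE.
rewrite -[u]hsubmxK mxE; case: split => j; [exact: hl|exact: hr].
Qed.

Lemma vin_row k l (u : 'rV[C]_k) (v : 'rV[C]_l) : vin J (row_mx u v) <-> vin J u /\ vin J v.
Proof. by rewrite vin_lr row_mxKl row_mxKr. Qed.

Section Sub.
Variables (k : nat) (K : 'rV[C]_k -> Prop).
Hypothesis hK : smod J K.
Lemma smod_vin u : vin J u -> K u. Proof. by case: hK => h _ _; apply: h. Qed.
Lemma smod0 : K 0. Proof. by apply: smod_vin; apply: vin_eq0. Qed.
Lemma smodD u v : K u -> K v -> K (u + v). Proof. by case: hK => _ h _; apply: h. Qed.
Lemma smodZ a u : K u -> K (a *: u). Proof. by case: hK => _ _; apply. Qed.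
Lemma smodN u : K u -> K (- u). Proof. by rewrite -scaleN1r; apply: smodZ. Qed.
Lemma smodB u v : K u -> K v -> K (u - v). Proof. by move=> hu hv; apply/smodD/smodN. Qed.
Lemma smodM r (M : 'M_(r, k)) w : (forall i, K (row i M)) -> K (w *m M).
Proof.
move=> h; rewrite mulmx_sum_row; elim/big_ind: _ => [|u v|i _]; [exact: smod0|exact: smodD|by apply: smodZ].
Qed.
Lemma smodBr u v : K (u - v) -> K v -> K u.
Proof. by move=> h1 h2; rewrite -(subrK v u); apply: smodD. Qed.
Lemma span_min r (M : 'M_(r, k)) : (forall i, K (row i M)) -> incl (span J M) K.
Proof. by move=> h u [w hw]; apply: smodBr (smod_vin hw) _; apply: smodM. Qed.
End Sub.

Lemma span_smod r k (M : 'M[C]_(r, k)) : smod J (span J M).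
Proof.
split=> [u hu|u v [w hw] [w' hw']|a u [w hw]].
- by exists 0; rewrite mul0mx subr0.
- by exists (w + w'); rewrite mulmxDl opprD addrACA; apply: vinD.
- by exists (a *: w); rewrite -scalemxAl -scalerBr; apply: vinZ.
Qed.

Lemma span_mul r k (M : 'M[C]_(r, k)) w : span J M (w *m M).
Proof. by exists w; rewrite subrr; apply: vin_eq0. Qed.

Lemma span_row r k (M : 'M[C]_(r, k)) i : span J M (row i M).
Proof. by rewrite rowE; apply: span_mul. Qed.

Lemma span_sub r r' k (M : 'M[C]_(r, k)) (M' : 'M[C]_(r', k)) :
  incl (span J M') (span J M) -> exists A : 'M_(r', r), forall u, vin J (u *m (M' - A *m M)).
Proof.
move=> h; have /choice [f hf] : forall i, exists w, vin J (row i M' - w *m M).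
  by move=> i; apply: h; apply: span_row.
exists (\matrix_i f i) => u; rewrite mulmx_sum_row.
elim/big_ind: _ => [|v w|i _]; [by apply: vin_eq0|exact: vinD|apply: vinZ].
by rewrite linearB /= row_mul rowK.
Qed.

Lemma ker_smod r k (M : 'M[C]_(r, k)) : smod J (ker J M).
Proof.
split=> [u hu|u v hu hv|a u hu]; first exact: vinM.
- by rewrite /ker mulmxDl; apply: vinD.
- by rewrite /ker -scalemxAl; apply: vinZ.
Qed.

Lemma ker_block r k r' k' (M : 'M[C]_(r, k)) (M' : 'M[C]_(r', k')) :
  ker J (block_mx M 0 0 M') = dsum (ker J M) (ker J M').
Proof.
apply/funext => u; apply/propext.
by rewrite /ker -{1}[u]hsubmxK mul_row_block !mulmx0 addr0 add0r vin_row.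
Qed.

Lemma span_block r k r' k' (M : 'M[C]_(r, k)) (M' : 'M[C]_(r', k')) :
  span J (block_mx M 0 0 M') = dsum (span J M) (span J M').
Proof.
apply: pred_ext => u.
  case=> w; rewrite -{1}[w]hsubmxK mul_row_block !mulmx0 addr0 add0r => /vin_lr.
  by rewrite !linearB /= row_mxKl row_mxKr => -[h1 h2]; split; [exists (lsubmx w)|exists (rsubmx w)].
case=> -[w hw] [w' hw']; exists (row_mx w w').
rewrite mul_row_block !mulmx0 addr0 add0r; apply/vin_lr.
by rewrite !linearB /= row_mxKl row_mxKr.
Qed.

(** The first coordinates of the elements of K form a finitely generated ideal; the elements with
    first coordinate 0 are handled by induction on k. *)
Lemma smod_fg k (K : 'rV[C]_k -> Prop) : noeth C -> smod J K -> exists r (M : 'M_(r, k)), K = span J M.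
Proof.
move=> hN; elim: k K => [|k IH] K hK.
  exists 0%N, 0; apply: pred_ext => u _; first by exists 0; move=> [].
  by apply: (smod_vin hK); case.
move: K hK; rewrite -[k.+1]/(1 + k)%N => K hK.
pose I a := exists u, K u /\ lsubmx u 0 0 = a.
have hI : idl I.
  split; first by exists 0; split; [apply: smod0 hK|rewrite !mxE].
  - by move=> a b [u [hu <-]] [v [hv <-]]; exists (u + v); split; [apply: smodD|rewrite !mxE].
  - by move=> a b [u [hu <-]]; exists (a *: u); split; [apply: smodZ|rewrite !mxE].
have [s Is] := hN I hI.
have /choice [f hf] : forall i : 'I_(size s), exists u, K u /\ lsubmx u 0 0 = s`_i.
  by move=> i; rewrite -[exists u, _]/(I s`_i) Is; apply: igen_mem; [exact: idl_zid|exact: mem_nth].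
pose K' (v : 'rV[C]_k) := K (row_mx (0 : 'rV_1) v).
have hK' : smod J K'.
  split=> [u hu|u v hu hv|a u hu].
  - by apply: (smod_vin hK); apply/vin_row; split=> //; apply: vin_eq0.
  - by have := smodD hK hu hv; rewrite add_row_mx addr0.
  - by have := smodZ hK a hu; rewrite scale_row_mx scaler0.
have [r [M KM]] := IH K' hK'.
pose L : 'M_(size s, 1 + k) := \matrix_i f i.
exists (size s + r)%N, (col_mx L (row_mx 0 M)); apply: pred_ext => u.
  move=> hu; have : I (lsubmx u 0 0) by exists u.
  rewrite Is => /igenP [w hw].
  have Kd : K (u - w *m L).
    by apply: smodB => //; apply: smodM => // i; rewrite rowK; case: (hf i).
  have d0 : lsubmx (u - w *m L) = 0.
    apply/matrixP => i j; rewrite !ord1; move: hw; rewrite /zid !mxE => hw; rewrite -[RHS]hw.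
    congr (_ - _); apply: eq_bigr => l _; rewrite mxE.
    by case: (hf l) => _ <-; rewrite mxE.
  have : K' (rsubmx (u - w *m L)) by rewrite /K' -d0 hsubmxK.
  rewrite KM => -[w' hw']; exists (row_mx w w').
  rewrite mul_row_col opprD addrA mul_mx_row mulmx0 -[u - w *m L]hsubmxK d0.
  rewrite opp_row_mx add_row_mx oppr0 addr0.
  by apply/vin_row; split=> //; apply: vin_eq0.
apply: span_min => // i; rewrite -[i]splitK; case: (split i) => j /=.
  by rewrite rowKu rowK; case: (hf j).
rewrite rowKd row_row_mx row0 -/(K' _) KM; exact: span_row.
Qed.
End Basics.
End MatrixModules.

(** * Minimal free resolutions over a local ring *)

Section LocalModules.
Variable C : comNzRingType.
Implicit Types (J I : C -> Prop).

Lemma prod_congr I (T : Type) (r : seq T) (f g : T -> C) : idl I ->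
  (forall i, I (f i - g i)) -> I (\prod_(i <- r) f i - \prod_(i <- r) g i).
Proof.
move=> hI h; elim: r => [|x r IH]; first by rewrite !big_nil subrr; apply: idl0.
rewrite !big_cons; have -> (a b c d : C) : a * b - c * d = (a - c) * b + c * (b - d) by ring.
by apply: idlD => //; [apply: idlMr|apply: idlM].
Qed.

Lemma det_congr I r (A B : 'M[C]_r) : idl I -> (forall i j, I (A i j - B i j)) -> I (\det A - \det B).
Proof.
move=> hI h; rewrite /determinant -sumrB; apply: idl_sum => // s _.
by rewrite -mulrBr; apply: idlM => //; apply: prod_congr.
Qed.

Lemma near_1_inv n r (A : 'M[C]_r) : loc n -> (forall i j, n ((A - 1%:M) i j)) ->
  exists B, A *m B = 1%:M /\ B *m A = 1%:M.
Proof.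
move=> hn h.
have /(loc1D hn) [b hb] : n (\det A - \det (1%:M : 'M[C]_r)).
  by apply: det_congr => // i j; have := h i j; rewrite !mxE.
rewrite det1 addrC subrK in hb.
exists (b *: \adj A); rewrite -scalemxAr -scalemxAl mul_mx_adj mul_adj_mx.
by rewrite scale_scalar_mx mulrC hb.
Qed.

Variable n : C -> Prop.
Hypotheses (hN : noeth C) (hn : loc n).
#[local] Hint Resolve hn : core.

(* The minimal version of pd. *)
Fixpoint res J s k (K : 'rV[C]_k -> Prop) : Prop :=
  exists r (M : 'M[C]_(r, k)), [/\ K = span J M, incl (ker J M) (@vin _ n r) &
    if s is s'.+1 then res J s' (ker J M) else incl (ker J M) (@vin _ J r)].

Lemma res_pd J s k (K : 'rV[C]_k -> Prop) : res J s K -> pd J s K.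
Proof.
elim: s k K => [|s IH] k K [r [M [KM _ h]]]; exists r, M; split=> //; exact: IH.
Qed.

Section Fixed.
Variable J : C -> Prop.
Hypotheses (hJ : idl J) (Jn : incl J n).

(** A relation with a unit coordinate makes the corresponding generator redundant, so generators can
    be deleted until all relations lie in n. *)
Lemma min_gens k (K : 'rV[C]_k -> Prop) : smod J K ->
  exists r (M : 'M_(r, k)), K = span J M /\ incl (ker J M) (@vin _ n r).
Proof.
move=> hK; have [r0 [M0 KM0]] := smod_fg hJ hN hK.
have [r] : exists r, exists (M : 'M_(r, k)), K = span J M by exists r0, M0.
elim: r => [|r IH] [M KM]; first by exists 0%N, M; split=> // u _ [].
have [h|h] := pselect (incl (ker J M) (@vin _ n r.+1)); first by exists r.+1, M.
have [u [hu [i nui]]] : exists u, ker J M u /\ exists i, ~ n (u 0 i).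
  apply: contrapT => h1; apply: h => u hu i; apply: contrapT => nui; apply: h1.
  by exists u; split=> //; exists i.
have [c uc] : exists c, u 0 i * c = 1 by case: hn => _ _; apply.
apply: IH; exists (row' i M); rewrite KM; apply: pred_ext; last first.
  apply: span_min => //; first exact: span_smod.
  by move=> j; rewrite (_ : row j _ = row (lift i j) M); [exact: span_row|apply/rowP => l; rewrite !mxE].
have x0 (x : 'rV_r.+1) : x 0 i = 0 -> x *m M = col' i x *m row' i M.
  move=> hx; apply/rowP => l; rewrite !mxE (bigD1_ord i) //= hx mul0r add0r.
  by apply: eq_bigr => j _; rewrite !mxE.
apply: span_min => //; first exact: span_smod.
(* Clears coordinate i of the i-th unit vector by a multiple of the relation u, and leaves the other
   unit vectors unchanged. *)
move=> j; pose x : 'rV_r.+1 := delta_mx 0 j - ((j == i)%:R * c) *: u.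
have hx : x 0 i = 0.
  by rewrite !mxE eqxx /= eq_sym; case: eqP => _; rewrite ?mul0r ?subr0 // mul1r mulrC uc subrr.
apply: (smodBr (span_smod hJ _) (v := x *m M)).
  apply: (smod_vin (span_smod hJ _)).
  rewrite rowE -mulmxBl opprB addrC subrK -scalemxAl; exact: vinZ.
by rewrite x0 //; apply: span_mul.
Qed.

Lemma ker_scale r k (M : 'M[C]_(r, k)) (G : 'M[C]_(k, k)) (H : 'M[C]_(k, k)) : G *m H = 1%:M -> H *m G = 1%:M ->
  ker J (M *m H) = ker J M.
Proof.
move=> GH HG; apply: pred_ext => u hu; last by rewrite /ker mulmxA; apply: vinM.
by have := vinM hJ G hu; rewrite mulmxA -[_ *m H *m G]mulmxA HG mulmx1.
Qed.

Lemma span_scale r k (M : 'M[C]_(r, k)) (G H : 'M[C]_k) : G *m H = 1%:M -> H *m G = 1%:M ->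
  (fun u => span J M (u *m G)) = span J (M *m H).
Proof.
move=> GH HG; apply: pred_ext => u [w hw]; exists w.
  by have := vinM hJ H hw; rewrite mulmxBl -(mulmxA u) GH mulmx1 mulmxA.
by have := vinM hJ G hw; rewrite mulmxBl -(mulmxA w) -(mulmxA M) HG mulmx1.
Qed.

Lemma res_change s k (K : 'rV[C]_k -> Prop) (G H : 'M[C]_k) : G *m H = 1%:M -> H *m G = 1%:M ->
  res J s K -> res J s (fun u => K (u *m G)).
Proof.
move=> GH HG; case: s => [|s] [r [M [-> Mn hM]]];
  by exists r, (M *m H); rewrite (ker_scale _ GH HG) (span_scale _ GH HG).
Qed.

(** The matrices A and B that express each list of generators by the other satisfy (B A - 1) M = 0
    modulo J, so by minimality B A is congruent to 1 modulo n and is invertible; likewise A B. *)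
Lemma min_change r r' k (M : 'M[C]_(r, k)) (M' : 'M[C]_(r', k)) : span J M = span J M' ->
  incl (ker J M) (@vin _ n r) -> incl (ker J M') (@vin _ n r') ->
  r = r' /\ exists (A : 'M_(r', r)) (B : 'M_(r, r')), [/\ A *m B = 1%:M, B *m A = 1%:M &
    ker J M' = fun u => ker J M (u *m A)].
Proof.
move=> MM' Mn M'n.
have [|A hA] := @span_sub _ _ hJ _ _ _ M M'; first by rewrite MM'.
have [|B hB] := @span_sub _ _ hJ _ _ _ M' M; first by rewrite MM'.
have aux p q (N : 'M[C]_(p, k)) (N' : 'M[C]_(q, k)) (D : 'M_(p, q)) (E : 'M_(q, p)) :
    incl (ker J N) (@vin _ n p) -> (forall u, vin J (u *m (N' - E *m N))) ->
    (forall u, vin J (u *m (N - D *m N'))) ->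
    exists X, (D *m E) *m X = 1%:M /\ X *m (D *m E) = 1%:M.
  move=> Nn h1 h2; apply: near_1_inv => // i j.
  have : vin n (row i (D *m E - 1%:M)); last by move=> /(_ j); rewrite mxE.
  apply: Nn; rewrite /ker rowE -mulmxA.
  have -> : (D *m E - 1%:M) *m N = - (N - D *m N') - D *m (N' - E *m N).
    rewrite mulmxBl mul1mx mulmxBr mulmxA; move: (D *m E *m N) (D *m N') => a b.
    by apply/matrixP => i' j'; rewrite !mxE; ring.
  by rewrite mulmxBr mulmxN mulmxA; apply: vinB => //; apply: vinN.
have [X [BAX XBA]] := aux _ _ M M' B A Mn hA hB.
have [Y [ABY YAB]] := aux _ _ M' M A B M'n hB hA.
have rr : r = r'.
  apply/eqP; rewrite eqn_leq; apply/andP; split.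
    by apply: (@mulmx1_min _ _ _ B (A *m X)); rewrite mulmxA.
  by apply: (@mulmx1_min _ _ _ A (B *m Y)); rewrite mulmxA.
split=> //; exists A, (X *m B); split.
- subst r'; apply: mulmx1C; by rewrite -mulmxA.
- by rewrite -mulmxA.
apply: pred_ext => u; rewrite /ker -mulmxA => hu.
  have -> : u *m (A *m M) = u *m M' - u *m (M' - A *m M) by rewrite mulmxBr subKr.
  exact: vinB.
by rewrite -(subrK (u *m (A *m M)) (u *m M')) -mulmxBr; apply: vinD.
Qed.

Lemma res_min s r k (M : 'M[C]_(r, k)) : incl (ker J M) (@vin _ n r) -> res J s (span J M) ->
  if s is s'.+1 then res J s' (ker J M) else incl (ker J M) (@vin _ J r).
Proof.
move=> Mn; case: s => [|s] [r' [M' [E M'n h]]];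
  have [rr [A [B [AB BA ->]]]] := min_change (esym E) M'n Mn; subst r'.
  by move=> u /h /(vinM hJ B); rewrite -mulmxA AB mulmx1.
exact: res_change AB BA h.
Qed.

Lemma res_ext s k r (M : 'M[C]_(r, k)) K : K = span J M -> incl (ker J M) (@vin _ n r) ->
  res J s.+1 K -> res J s (ker J M).
Proof. by move=> -> Mn /(res_min Mn). Qed.

Lemma res_vin s k : res J s (@vin _ J k).
Proof.
elim: s k => [|s IH] k; exists 0%N, (0 : 'M_(0, k)).
  split=> [|u _ []|u _ []] //; apply: pred_ext => u; first by exists 0; rewrite mulmx0 subr0.
  by move=> [w]; rewrite mulmx0 subr0.
split=> [|u _ []|] //; first apply: pred_ext => u; first by exists 0; rewrite mulmx0 subr0.
  by move=> [w]; rewrite mulmx0 subr0.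
rewrite (_ : ker J _ = @vin _ J 0) //; apply: pred_ext => u _; first by case.
by move=> i; rewrite mulmx0 mxE; apply: idl0.
Qed.

Lemma res_leq s k (K : 'rV[C]_k -> Prop) : res J s K -> res J s.+1 K.
Proof.
elim: s k K => [|s IH] k K [r [M [KM Mn h]]]; exists r, M; split=> //; last exact: IH.
rewrite (_ : ker J _ = @vin _ J r); first exact: res_vin.
by apply: pred_ext => // u; apply: smod_vin; apply: ker_smod.
Qed.

Lemma res_full s k : res J s (fun _ : 'rV[C]_k => True).
Proof.
elim: s => [|s IH]; last exact: res_leq.
exists k, 1%:M; split.
- by apply: pred_ext => // u _; exists u; rewrite mulmx1 subrr; apply: vin_eq0.
- by move=> u; rewrite /ker mulmx1 => hu i; apply: Jn.
- by move=> u; rewrite /ker mulmx1.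
Qed.

Lemma dsum_min r k r' k' (M : 'M[C]_(r, k)) (M' : 'M[C]_(r', k')) :
  incl (ker J M) (@vin _ n r) -> incl (ker J M') (@vin _ n r') ->
  incl (ker J (block_mx M 0 0 M')) (@vin _ n (r + r')).
Proof. by move=> h h'; rewrite ker_block => u [/h h1 /h' h2]; apply/vin_lr. Qed.

(** Minimal presentations of K and L combine to one of the sum, and the length of a resolution can
    be read off any minimal presentation; so the property passes to the kernel, which is again a
    direct sum. *)
Lemma res_summand s k l (K : 'rV[C]_k -> Prop) (L : 'rV[C]_l -> Prop) :
  smod J K -> smod J L -> res J s (dsum K L) -> res J s K /\ res J s L.
Proof.
elim: s k l K L => [|s IH] k l K L hK hL.
  have [r [M [KM Mn]]] := min_gens hK; have [r' [M' [LM Mn']]] := min_gens hL.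
  rewrite KM LM -span_block => /(res_min (dsum_min Mn Mn')).
  rewrite ker_block => h; split; [exists r, M|exists r', M']; split=> // u hu.
    have /h : dsum (ker J M) (ker J M') (row_mx u 0).
      by rewrite /dsum row_mxKl row_mxKr; split=> //; rewrite /ker mul0mx; apply: vin_eq0.
    by move=> /vin_row [].
  have /h : dsum (ker J M) (ker J M') (row_mx 0 u).
    by rewrite /dsum row_mxKl row_mxKr; split=> //; rewrite /ker mul0mx; apply: vin_eq0.
  by move=> /vin_row [].
have [r [M [KM Mn]]] := min_gens hK; have [r' [M' [LM Mn']]] := min_gens hL.
rewrite KM LM -span_block => /(res_min (dsum_min Mn Mn')).
rewrite ker_block => /IH [||h1 h2]; try exact: ker_smod.
by split; [exists r, M|exists r', M'].
Qed.

Lemma res_dsum s k l (K : 'rV[C]_k -> Prop) (L : 'rV[C]_l -> Prop) :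
  res J s K -> res J s L -> res J s (dsum K L).
Proof.
elim: s k l K L => [|s IH] k l K L [r [M [KM Mn h]]] [r' [M' [LM Mn' h']]];
  exists (r + r')%N, (block_mx M 0 0 M'); rewrite span_block // -KM -LM ker_block //.
  by split=> // u [hu hu']; apply/vin_lr; split; [apply: Mn|apply: Mn'|apply: h|apply: h'].
split=> //; last exact: IH.
by move=> u [hu hu']; apply/vin_lr; split; [apply: Mn|apply: Mn'].
Qed.

(* Schanuel: the kernel of (M, M') is isomorphic to ker M (+) C^r' and to C^r (+) ker M'. *)
Lemma pd_res s k (K : 'rV[C]_k -> Prop) : pd J s K -> res J s K.
Proof.
elim: s k K => [|s IH] k K [r [M [KM h]]].
  by exists r, M; split=> // u /h hu i; apply: Jn.
have hK : smod J K by rewrite KM; apply: span_smod.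
have [r' [M' [KM' Mn']]] := min_gens hK.
exists r', M'; split=> //.
have [|A hA] := @span_sub _ _ hJ _ _ _ M M'; first by rewrite -KM -KM'.
have [|B hB] := @span_sub _ _ hJ _ _ _ M' M; first by rewrite -KM -KM'.
have h1 := res_dsum (IH _ _ h) (res_full s r').
(* Two shears. As M' = A M and M = B M' modulo J, the first carries the kernel of M stacked on M' to
   ker M (+) C^r', and the second carries C^r (+) ker M' to that same kernel. *)
pose G : 'M[C]_(r + r') := block_mx 1%:M 0 A 1%:M.
pose H : 'M[C]_(r + r') := block_mx 1%:M 0 (- A) 1%:M.
pose G' : 'M[C]_(r + r') := block_mx 1%:M (- B) 0 1%:M.
pose H' : 'M[C]_(r + r') := block_mx 1%:M B 0 1%:M.
have GH : G *m H = 1%:M.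
  by rewrite mulmx_block !(mul1mx, mul0mx, mulmx0, mulmx1, addr0, add0r, subrr, addNr) -scalar_mx_block.
have HG : H *m G = 1%:M by apply: mulmx1C.
have GH' : G' *m H' = 1%:M.
  by rewrite mulmx_block !(mul1mx, mul0mx, mulmx0, mulmx1, addr0, add0r, subrr, addNr) -scalar_mx_block.
have HG' : H' *m G' = 1%:M by apply: mulmx1C.
have := res_change GH' HG' (res_change GH HG h1).
rewrite (_ : (fun u => _) = dsum (fun _ : 'rV_r => True) (ker J M')).
  move=> /res_summand; case=> //; exact: ker_smod.
apply/funext => u; apply/propext; rewrite /dsum -{1 2}[u]hsubmxK.
move: (lsubmx u) (rsubmx u) => v w.
rewrite mul_row_block !mulmx1 mulmx0 addr0 mul_row_block !mulmx1 mulmx0 add0r row_mxKl row_mxKr.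
have E : (v + (v *m (- B) + w) *m A) *m M =
    v *m (M - B *m M') + v *m B *m (M' - A *m M) + w *m M' - w *m (M' - A *m M).
  rewrite !mulmxDl !mulmxBr !mulmxN !mulNmx !mulmxA.
  move: (v *m M) (v *m B *m M') (v *m B *m A *m M) (w *m M') (w *m A *m M) => a b c e f.
  by apply/rowP => i; rewrite !mxE; ring.
rewrite /ker E; split=> [[h2 _]|[_ h2]]; last by split=> //; apply: vinB => //; apply: vinD => //; apply: vinD.
split=> //; move: h2; rewrite -addrA => h2.
rewrite (_ : w *m M' = (v *m (M - B *m M') + (v *m B *m (M' - A *m M) + (w *m M' - w *m (M' - A *m M))))
  - v *m (M - B *m M') - v *m B *m (M' - A *m M) + w *m (M' - A *m M)).
  by apply: vinD => //; apply: vinB => //; apply: vinB => //; rewrite -!addrA in h2 *.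
move: (_ *m (M - _)) (_ *m (M' - _)) (w *m (M' - _)) (w *m M') => a b c e.
by apply/rowP => i; rewrite !mxE; ring.
Qed.
End Fixed.
End LocalModules.

(** * Reduction modulo a regular element, and the syzygy theorem *)

Section ChangeOfBase.
Variables (C : comNzRingType) (n : C -> Prop).
Hypotheses (hN : noeth C) (hn : loc n).
Implicit Types J : C -> Prop.

Definition addv J k (K : 'rV[C]_k -> Prop) : 'rV[C]_k -> Prop :=
  fun u => exists v, K v /\ vin J (u - v).

Section ModX.
Variables (J : C -> Prop) (x : C).
Hypotheses (hJ : idl J) (Jn : incl J n) (hx : n x) (xreg : forall a, J (x * a) -> J a).
Let J' := addg J x.

Let hJ' : idl J'. Proof. exact: addg_idl. Qed.
Let J'n : incl J' n. Proof. exact: addg_min. Qed.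

(** x is regular on C^k / K. Kernels have this property because x is regular modulo J, and it makes
    reduction modulo x exact. *)
Definition xsat k (K : 'rV[C]_k -> Prop) := forall v, K (x *: v) -> K v.

Lemma vin_sub k : incl (@vin _ J k) (@vin _ J' k).
Proof. by move=> u hu i; apply: addg_sub. Qed.

Lemma vin_addg k (u : 'rV[C]_k) : vin J' u <-> exists t, vin J (u - x *: t).
Proof.
split=> [hu|[t ht] i].
  have /choice [f hf] : forall i, exists c, J (u 0 i - c * x) by exact: hu.
  by exists (\row_i f i) => i; rewrite !mxE mulrC.
by exists (t 0 i); have := ht i; rewrite !mxE mulrC.
Qed.

Lemma vin_xZ k (t : 'rV[C]_k) : vin J' (x *: t).
Proof. by apply/vin_addg; exists t; rewrite subrr; apply: vin_eq0. Qed.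

Lemma addv_span r k (M : 'M[C]_(r, k)) : addv J' (span J M) = span J' M.
Proof.
apply: pred_ext => u; last by case=> w hw; exists (w *m M); split=> //; apply: span_mul.
move=> [v [[w hw] huv]]; exists w; rewrite -(subrK v u) -addrA.
by apply: vinD => //; apply: vin_sub.
Qed.

Lemma ker_xsat r k (M : 'M[C]_(r, k)) : xsat (ker J M).
Proof.
move=> v; rewrite /ker -scalemxAl => h i; apply: xreg.
by have := h i; rewrite mxE.
Qed.

Lemma ker_addg r k (M : 'M[C]_(r, k)) : xsat (span J M) -> ker J' M = addv J' (ker J M).
Proof.
move=> sM; apply: pred_ext => u.
  move=> /vin_addg [t ht].
  have /sM [w hw] : span J M (x *: t).
    by exists u; rewrite -opprB; apply: vinN.
  exists (u - x *: w); split; last by rewrite subKr; apply: vin_xZ.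
  rewrite /ker.
  have -> : (u - x *: w) *m M = (u *m M - x *: t) + x *: (t - w *m M).
    by rewrite mulmxBl scalerBr -scalemxAl addrA subrK.
  by apply: vinD => //; apply: vinZ.
move=> [v [hv huv]]; rewrite /ker -(subrK v u) mulmxDl.
by apply: vinD => //; [apply: vinM|apply: vin_sub].
Qed.

Lemma res_reduce s k (Z : 'rV[C]_k -> Prop) : xsat Z -> res n J s Z -> res n J' s (addv J' Z).
Proof.
elim: s k Z => [|s IH] k Z sZ [r [M [ZM Mn h]]]; exists r, M; rewrite ZM in sZ *;
  rewrite addv_span ker_addg //.
  split=> // u [v [hv huv]]; rewrite -(subrK v u); apply: vinD => //.
  - by move=> i; apply: J'n.
  - exact: Mn.
  - by apply: vin_sub; apply: h.
split=> //; last by apply: IH => //; apply: ker_xsat.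
move=> u [v [hv huv]]; rewrite -(subrK v u); apply: vinD => //.
- by move=> i; apply: J'n.
- exact: Mn.
Qed.

(** In terms of a matrix V of generators of Z, the hypothesis reads (1 - x T) V = 0 modulo the span
    of M, and 1 - x T is invertible since x is in n. *)
Lemma nakayama_mod r k (Z : 'rV[C]_k -> Prop) (M : 'M[C]_(r, k)) : smod J Z ->
  (forall v, Z v -> exists2 t, Z t & span J M (v - x *: t)) -> incl Z (span J M).
Proof.
move=> hZ h; have [q [V ZV]] := smod_fg hJ hN hZ.
have hS : smod J (span J M) by apply: span_smod.
have /choice [f hf] : forall i, exists w, span J M (row i V - x *: (w *m V)).
  move=> i; have [|t tZ ht] := h (row i V); first by rewrite ZV; apply: span_row.
  move: tZ; rewrite ZV => -[w hw]; exists w.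
  have -> : row i V - x *: (w *m V) = (row i V - x *: t) + x *: (t - w *m V).
    by rewrite scalerBr addrA subrK.
  by apply: (smodD hS) => //; apply: (smodZ hS); apply: (smod_vin hS).
pose T := \matrix_i f i.
have [|X [_ hX]] := @near_1_inv _ n q (1%:M - x *: T) hn.
  move=> i j; rewrite !mxE addrAC subrr add0r.
  by apply: idlN => //; apply: idlMr.
rewrite ZV; apply: span_min => // i.
have -> : V = X *m ((1%:M - x *: T) *m V) by rewrite mulmxA hX mul1mx.
rewrite row_mul; apply: (smodM hJ hS) => j.
by rewrite mulmxBl mul1mx linearB /= -scalemxAl linearZ /= row_mul rowK.
Qed.

Lemma gens_lift r k (Z : 'rV[C]_k -> Prop) (M0 : 'M[C]_(r, k)) : smod J Z -> xsat Z ->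
  addv J' Z = span J' M0 -> incl (ker J' M0) (@vin _ n r) ->
  exists M : 'M_(r, k), [/\ Z = span J M, ker J' M0 = addv J' (ker J M) &
    incl (ker J M) (@vin _ n r)].
Proof.
move=> hZ sZ EM M0n.
have /choice [f hf] : forall i, exists z, Z z /\ vin J' (row i M0 - z).
  by move=> i; rewrite -[exists z, _]/(addv J' Z _) EM; apply: span_row.
pose M := \matrix_i f i; exists M.
have M0M u : vin J' (u *m (M0 - M)).
  rewrite mulmx_sum_row; elim/big_ind: _ => [|v w|i _]; [by apply: vin_eq0|exact: vinD|apply: vinZ => //].
  by rewrite linearB /= rowK; case: (hf i).
have ZM : Z = span J M.
  apply: pred_ext; last by apply: span_min => // i; rewrite rowK; case: (hf i).
  apply: nakayama_mod => // v hv.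
  have : addv J' Z v by exists v; split=> //; apply: vin_eq0; rewrite ?subrr.
  rewrite EM => -[w hw].
  have /vin_addg [t ht] : vin J' (v - w *m M).
    rewrite -(subrK (w *m M0) v) -addrA -mulmxBr; exact: vinD.
  exists t; last by exists w; rewrite addrAC.
  apply: sZ; have -> : x *: t = (v - w *m M) - (v - w *m M - x *: t) by rewrite subKr.
  apply: (smodB hZ); last exact: (smod_vin hZ).
  by apply: (smodB hZ) => //; apply: (smodM hJ hZ) => i; rewrite rowK; case: (hf i).
have KM : ker J' M0 = addv J' (ker J M).
  rewrite -ker_addg -?ZM //; apply: pred_ext => u hu.
    have E : u *m M = u *m M0 - u *m (M0 - M) by rewrite mulmxBr subKr.
    by rewrite /ker E; apply: vinB.
  have E : u *m M0 = u *m M + u *m (M0 - M) by rewrite mulmxBr addrC subrK.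
  by rewrite /ker E; apply: vinD.
split=> // u hu; apply: M0n; rewrite KM; exists u; split=> //.
by apply: vin_eq0; rewrite ?subrr.
Qed.

(** A minimal presentation modulo x lifts to one modulo J with an x-saturated kernel, so the
    resolution lifts one step at a time; at the end, a kernel that vanishes modulo x vanishes by
    Nakayama. *)
Lemma res_lift s k (Z : 'rV[C]_k -> Prop) : smod J Z -> xsat Z ->
  res n J' s (addv J' Z) -> res n J s Z.
Proof.
elim: s k Z => [|s IH] k Z hZ sZ [r [M0 [/(gens_lift hZ sZ) hM /hM [M [ZM KM Mn]] h]]];
  exists r, M; split=> //; last by apply: IH; [exact: ker_smod|exact: ker_xsat|rewrite -KM].
have -> : @vin _ J r = span J (0 : 'M_(0, r)).
  apply: pred_ext => u; first by exists 0; rewrite mulmx0 subr0.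
  by case=> w; rewrite mulmx0 subr0.
apply: nakayama_mod; first exact: ker_smod.
move=> v hv; have /h /vin_addg [t ht] : ker J' M0 v.
  by rewrite KM; exists v; split=> //; apply: vin_eq0; rewrite ?subrr.
exists t; last by exists 0; rewrite mulmx0 subr0.
apply: ker_xsat; have -> : x *: t = v - (v - x *: t) by rewrite subKr.
by apply: (smodB (ker_smod hJ M)) => //; apply: (smod_vin (ker_smod hJ M)).
Qed.
End ModX.

(** The first kernel is x-saturated, so its resolution may be computed modulo x, where one parameter
    fewer remains. With no parameter left, J = n and a minimal presentation has no relations modulo
    J. *)
Lemma syzygy_theorem J z : idl J -> n = igen J z -> rseq J z ->
  forall k (K : 'rV[C]_k -> Prop), smod J K -> res n J (size z) K.
Proof.
elim: z J => [|x z IH] J hJ nz hz k K hK.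
  have Jn : incl J n by rewrite nz.
  have [r [M [KM Mn]]] := min_gens hN hn hJ hK.
  by exists r, M; split=> //; rewrite nz in Mn.
have Jn : incl J n by rewrite nz; apply: igen_sub.
have [r [M [KM Mn]]] := min_gens hN hn hJ hK.
exists r, M; split=> //; case: hz => xreg hz.
have hx : n x by rewrite nz; apply: addg_mem; apply: igen_idl.
apply: (@res_lift _ x) => //; [exact: ker_smod|exact: ker_xsat|].
apply: IH => //; first by rewrite igen_addg.
split=> [u hu|u v [u' [h1 h2]] [v' [h3 h4]]|a u [u' [h1 h2]]].
- by exists 0; split; [exact: (smod0 hJ (ker_smod hJ M))|rewrite subr0].
- exists (u' + v'); split; first exact: (smodD (ker_smod hJ M)).
  by rewrite opprD addrACA; apply: vinD.
- exists (a *: u'); split; first exact: (smodZ (ker_smod hJ M)).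
  by rewrite -scalerBr; apply: vinZ.
Qed.

(* A socle element s0 of C/J forces the last map of a minimal resolution to vanish. *)
Lemma res_socle J s0 s k (K : 'rV[C]_k -> Prop) : idl J -> incl J n -> ~ J s0 ->
  (forall a, n a -> J (a * s0)) -> smod J K -> incl K (@vin _ n k) -> res n J s K ->
  incl K (@vin _ J k).
Proof.
move=> hJ Jn ns0 hs0; elim: s k K => [|s IH] k K hK Kn [r [M [KM Mn h]]].
all: have {}h : incl (ker J M) (@vin _ J r) by [|apply: IH => //; apply: ker_smod].
all: case: r M KM Mn h => [|r] M KM Mn h.
all: try by move=> u; rewrite KM => -[w]; rewrite (_ : w *m M = 0) ?subr0 // [w]thinmx0 mul0mx.
(* The entries of M lie in n and are killed by s0 modulo J, so s0 times the first unit vector is a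
   relation. As all relations have entries in J, this would put s0 in J; hence M has no rows. *)
all: case: ns0; have /h /(_ 0) : ker J M (s0 *: delta_mx 0 0); last by rewrite !mxE !eqxx mulr1.
all: move=> i; rewrite -scalemxAl -rowE !mxE mulrC; apply: hs0.
all: have /Kn /(_ i) : K (row 0 M) by rewrite KM; apply: span_row.
all: by rewrite mxE.
Qed.
End ChangeOfBase.

(** * Serre's criterion: a finite resolution of the maximal ideal implies regularity *)

Section Serre.
Variables (C : comNzRingType) (n : C -> Prop).
Hypotheses (hN : noeth C) (hn : loc n).
Implicit Types J Q : C -> Prop.

Definition colon J (s : C) : C -> Prop := fun a => J (a * s).

Definition max_annih J s := [/\ ~ J s, prm (colon J s) &
  forall t, ~ J t -> incl (colon J s) (colon J t) -> incl (colon J t) (colon J s)].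

Lemma prm_prod J (T : Type) (r : seq T) (f : T -> C) : prm J -> (forall i, ~ J (f i)) ->
  ~ J (\prod_(i <- r) f i).
Proof.
move=> hJ h; elim/big_ind: _ => [|a b|i _] //; first by case: hJ.
exact: prmM.
Qed.

(** L is chosen with J + (L) as large as possible. A zero divisor a kills some s with maximal
    annihilator. If a killed no r in L, each r would have a multiplier killing r but not s; the
    product of these kills L, and not s because the annihilator of s is prime. Yet s lies in J +
    (L). *)
Lemma finite_max_annih J : idl J -> exists L : seq C, (forall s, s \in L -> max_annih J s) /\
  forall a t, ~ J t -> J (a * t) -> exists2 s, s \in L & J (a * s).
Proof.
move=> hJ.
have [||I [[L [-> hL]] Imax]] := @noeth_max _ (fun I => exists L,
    I = igen J L /\ forall s, s \in L -> max_annih J s) hN.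
- by move=> I [L [-> _]].
- by exists J, [::].
exists L; split=> // a t nt hat.
have [s [ns sP ts smax]] := max_annihilator hN hJ nt.
have sL : igen J L s.
  apply: (Imax (igen J (s :: L))); last exact: igen_mem (mem_head _ _).
    by exists (s :: L); split=> // r; rewrite inE => /orP [/eqP ->|/hL].
  exact: addg_sub.
apply: contrapT => hno.
have /choice [b hb] : forall r, exists b, r \in L -> J (b * r) /\ ~ J (b * s).
  move=> r; have [rL|nrL] := boolP (r \in L); last by exists 0.
  apply: contrapT => h; apply: hno; exists r => //.
  have [_ _ rmax] := hL r rL; apply: (rmax s ns); last exact: ts.
  by move=> b hb; apply: contrapT => nb; apply: h; exists b.
pose p := \prod_(r <- L) (if r \in L then b r else 1).
have np : ~ colon J s p.
  apply: prm_prod => // r; case: ifP => [/hb [_ //]|_]; by rewrite /colon mul1r.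
apply: np; rewrite /colon.
have : incl (igen J L) (fun z => J (p * z)); last exact.
apply: igen_min.
- split; first by rewrite mulr0; apply: idl0.
  + by move=> x y hx hy; rewrite mulrDr; apply: idlD.
  + by move=> c x hx; rewrite mulrCA; apply: idlM.
- by move=> z; apply: idlM.
move=> r rL; rewrite /p (big_rem r) //= rL.
move: (\prod_(y <- rem r L) _) => q; rewrite (_ : b r * q * r = q * (b r * r)); last by ring.
by apply: idlM => //; case: (hb r rL).
Qed.

Lemma avoid_max_annih J (L : seq C) : idl J -> incl J n -> (forall s, (forall a, n a -> J (a * s)) -> J s) ->
  (forall s, s \in L -> max_annih J s) -> exists x, n x /\ forall s, s \in L -> ~ J (x * s).
Proof.
move=> hJ Jn hsoc; elim: L => [|s L IH] hL; first by exists 0; split=> //; apply: idl0.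
have [|x [hx xL]] := IH; first by move=> r rL; apply: hL; rewrite inE rL orbT.
have [ns sP smax] : max_annih J s by apply: hL; rewrite mem_head.
have [xs|nxs] := pselect (J (x * s)); last first.
  by exists x; split=> // r; rewrite inE => /orP [/eqP ->|/xL].
have [b0 [nb0 hb0]] : exists b, n b /\ ~ J (b * s).
  apply: contrapT => h; apply: ns; apply: hsoc => a ha; apply: contrapT => h'; apply: h.
  by exists a.
have /choice [b hb] : forall r, exists b, r \in L -> J (b * r) /\ ~ J (b * s).
  move=> r; have [rL|nrL] := boolP (r \in L); last by exists 0.
  apply: contrapT => h; apply: (xL r rL).
  have [_ _ rmax] : max_annih J r by apply: hL; rewrite inE rL orbT.
  apply: (rmax s ns); last exact: xs.
  by move=> b hb; apply: contrapT => nb; apply: h; exists b.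
pose p := \prod_(r <- L) (if r \in L then b r else 1).
have np : ~ colon J s p.
  apply: prm_prod => // r; case: ifP => [/hb [_ //]|_]; by rewrite /colon mul1r.
(* x kills s, b0 does not, and p kills all of L but not s. So the sum does not kill s, and on the
   members of L it acts as x does. *)
exists (x + b0 * p); split; first by apply: idlD => //; apply: idlMr.
move=> r; rewrite inE => /orP [/eqP -> h|rL h].
  apply: (prmM sP hb0 np); rewrite /colon.
  by rewrite -(addKr (x * s) (b0 * p * s)) -mulrDl; apply: idlD => //; apply: idlN.
apply: (xL r rL); rewrite -(addrK (b0 * p * r) (x * r)) -mulrDl.
apply: idlB => //; rewrite /p (big_rem r) //= rL.
move: (\prod_(y <- rem r L) _) => q; rewrite (_ : b0 * (b r * q) * r = b0 * q * (b r * r)); last by ring.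
by apply: idlM => //; case: (hb r rL).
Qed.

(** Let x be a regular element, and suppose that it lies in Q. The candidates z + x^(j+1) are
    outside Q and outnumber the annihilators of L by one. If all were zero divisors, two would share
    an annihilator; it would contain their difference x^(j+1) (1 - x^k) up to sign, and hence x. *)
Lemma regular_element J Q z : idl J -> incl J n -> (forall s, (forall a, n a -> J (a * s)) -> J s) ->
  idl Q -> n z -> ~ Q z -> exists x, [/\ n x, ~ Q x & forall a, J (x * a) -> J a].
Proof.
move=> hJ Jn hsoc hQ hz nz.
have [L [hL zd]] := finite_max_annih hJ.
have [x [hx xL]] := avoid_max_annih hJ Jn hsoc hL.
have reg y : (forall s, s \in L -> ~ J (y * s)) -> forall a, J (y * a) -> J a.
  by move=> yL a hya; apply: contrapT => na; have [s /yL] := zd _ _ na hya.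
have [Qx|nQx] := pselect (Q x); last by exists x; split=> //; apply: reg.
apply: contrapT => hno.
have /choice [f hf] : forall j : 'I_(size L).+1, exists i : 'I_(size L), J ((z + x ^+ j.+1) * L`_i).
  move=> j; apply: contrapT => h; apply: hno; exists (z + x ^+ j.+1); split.
  - by apply: idlD => //; rewrite exprS; apply: idlMr.
  - by move=> h'; apply: nz; apply: (idlBr hQ (y := - x ^+ j.+1)); rewrite ?opprK // exprS; apply: idlN => //; apply: idlMr.
  - by apply: reg => s /(nthP 0) [i il <-] hs; apply: h; exists (Ordinal il).
have /injectivePn [j [j' jj' fjj]] : ~~ injectiveb f.
  apply/negP => /injectiveP /leq_card; by rewrite !card_ord ltnn.
wlog lt : j j' jj' fjj / (j < j')%N.
  move=> H; case: (ltngtP j j') => [lt|lt|/val_inj e]; [exact: (H j j')| |by rewrite e eqxx in jj'].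
  by apply: (H j' j) => //; rewrite eq_sym.
have hjs := hf j; have hj's := hf j'; rewrite -fjj in hj's.
set s := L`_(f j) in hjs hj's; have sL : s \in L by apply: mem_nth.
have [ns sP _] := hL s sL.
have : colon J s (x ^+ j.+1 * (1 - x ^+ (j' - j))).
  rewrite /colon (_ : _ * s = (z + x ^+ j.+1) * s - (z + x ^+ j'.+1) * s); first exact: idlB.
  by rewrite mulrBr mulr1 -exprD addSn subnKC ?(ltnW lt) //; ring.
have [_ _ h] := sP; move=> /h [|h1]; first by move=> /(prmX sP); apply: xL.
have [|e he] := @loc1D _ n (- x ^+ (j' - j)) hn.
  by apply: idlN => //; move: lt; rewrite -subn_gt0; case: (j' - j)%N => // k _; rewrite exprS; apply: idlMr.
by case: sP => hi n1 _; apply: n1; rewrite -he; apply: idlMr.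
Qed.

Lemma min_same_size J r k (M M' : 'M[C]_(r, k)) : idl J -> incl J n -> span J M = span J M' ->
  incl (ker J M) (@vin _ n r) -> incl (ker J M') (@vin _ n r).
Proof.
move=> hJ Jn MM' Mn.
have [|A hA] := @span_sub _ _ hJ _ _ _ M M'; first by rewrite MM'.
have [|B hB] := @span_sub _ _ hJ _ _ _ M' M; first by rewrite MM'.
have [|X [BAX _]] := @near_1_inv _ n _ (B *m A) hn.
  move=> i j; have : vin n (row i (B *m A - 1%:M)); last by move=> /(_ j); rewrite mxE.
  apply: Mn; rewrite /ker rowE -mulmxA.
  have -> : (B *m A - 1%:M) *m M = - (M - B *m M') - B *m (M' - A *m M).
    rewrite mulmxBl mul1mx mulmxBr mulmxA; move: (B *m A *m M) (B *m M') => a b.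
    by apply/matrixP => i' j'; rewrite !mxE; ring.
  by rewrite mulmxBr mulmxN mulmxA; apply: vinB => //; apply: vinN.
have AXB : A *m (X *m B) = 1%:M by rewrite mulmxA; apply: mulmx1C; rewrite mulmxA.
move=> u hu; have /Mn hA' : ker J M (u *m A).
  rewrite /ker -mulmxA; have -> : u *m (A *m M) = u *m M' - u *m (M' - A *m M) by rewrite mulmxBr subKr.
  exact: vinB.
by rewrite -[u]mulmx1 -AXB mulmxA; apply: vinM.
Qed.

Lemma vin1 J (u : 'rV[C]_1) : vin J u <-> J (u 0 0).
Proof. by split=> [|h i]; [apply|rewrite ord1]. Qed.

Lemma vin_const J c : vin J (c%:M : 'rV[C]_1) <-> J c.
Proof. by rewrite vin1 mxE eqxx mulr1n. Qed.

Lemma span_addg J k x (Y : 'M[C]_(k, 1)) : idl J -> span (addg J x) Y = span J (col_mx (x%:M : 'M_1) Y).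
Proof.
move=> hJ; apply: pred_ext => u [w].
  move/vin_addg => [t ht]; exists (row_mx t w).
  by rewrite mul_row_col mul_mx_scalar opprD addrCA addrC.
rewrite -{1}[w]hsubmxK mul_row_col mul_mx_scalar => h.
exists (rsubmx w); apply/vin_addg; exists (lsubmx w).
by move: h; rewrite opprD addrA addrAC.
Qed.

Lemma ker_col J k x (Y : 'M[C]_(k, 1)) (t : 'rV_1) (w : 'rV_k) :
  ker J (col_mx (x%:M : 'M_1) Y) (row_mx t w) <-> vin J (w *m Y + x *: t).
Proof. by rewrite /ker mul_row_col mul_mx_scalar addrC. Qed.

(* Modulo (x), the kernel of the minimal presentation (x, Y) of n splits as n (+) ker Y:
   the relative form of n/xn = k (+) n/(x). *)
Lemma ker_split J k x (Y : 'M[C]_(k, 1)) : idl J -> incl J n -> n x ->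
  span J (col_mx (x%:M : 'M_1) Y) = @vin _ n 1 ->
  incl (ker J (col_mx (x%:M : 'M_1) Y)) (@vin _ n (1 + k)) ->
  addv (addg J x) (ker J (col_mx (x%:M : 'M_1) Y)) = dsum (@vin _ n 1) (ker (addg J x) Y).
Proof.
move=> hJ Jn hx hX Xn.
have hJ' : idl (addg J x) by [].
have J'n : incl (addg J x) n by apply: addg_min.
apply: pred_ext => u.
  move=> [v [hv huv]]; split.
    rewrite -(subrK v u) linearD /=; apply: vinD => //.
      by move/vin_lr: huv => [h _] i; apply: J'n.
    by move/Xn: hv => /vin_lr [].
  rewrite /ker -(subrK v u) linearD /= mulmxDl; apply: vinD => //.
    by move/vin_lr: huv => [_ h]; apply: vinM.
  move: hv; rewrite -{1}[v]hsubmxK => /ker_col hv; apply/vin_addg.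
  by exists (- lsubmx v); rewrite scalerN opprK.
move=> []; rewrite -[u]hsubmxK; move: (lsubmx u) (rsubmx u) => c w.
rewrite row_mxKl row_mxKr => hc /vin_addg [b hb].
have /Xn : ker J (col_mx (x%:M : 'M_1) Y) (row_mx (- b) w) by apply/ker_col; rewrite scalerN.
move=> /vin_row [hb' hw].
have : vin n (c + b) by apply: vinD => //; rewrite -[b]opprK; apply: vinN.
rewrite -hX => -[t']; rewrite -{1}[t']hsubmxK; move: (lsubmx t') (rsubmx t') => t0 t.
rewrite mul_row_col mul_mx_scalar => ht.
set j := c + b - _ in ht.
exists (row_mx (c - x *: t0 - j) (w - x *: t)); split.
  apply/ker_col.
  have -> : (w - x *: t) *m Y + x *: (c - x *: t0 - j) = w *m Y - x *: b.
    rewrite /j mulmxBl -scalemxAl; move: (w *m Y) (t *m Y) => p q.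
    by apply/rowP => i; rewrite !mxE; ring.
  exact: hb.
rewrite opp_row_mx add_row_mx; apply/vin_row.
rewrite subKr -addrA -opprD subKr; split; last exact: vin_xZ.
by apply: vinD => //; [apply: vin_xZ|apply: vin_sub].
Qed.

(** Induction on the number of minimal generators. If there is one, C/J has no socle, so n contains
    an x regular modulo J and outside n^2 + J, which can be put into a minimal system of generators.
    The first kernel reduced modulo x has a finite resolution, and the maximal ideal modulo J + (x)
    is a direct summand of it. *)
Lemma serre_regular r J s : idl J -> incl J n ->
  forall M : 'M[C]_(r, 1), span J M = @vin _ n 1 -> incl (ker J M) (@vin _ n r) ->
  res n J s (@vin _ n 1) -> exists z, [/\ size z = r, n = igen J z & rseq J z].
Proof.
elim: r J => [|r IH] J hJ Jn M hM Mn hres.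
  exists [::]; split=> //=; apply: pred_ext => // a ha.
  have : vin n (a%:M : 'rV[C]_1) by apply/vin_const.
  by rewrite -hM => -[w]; rewrite (_ : w *m M = 0) ?[w]thinmx0 ?mul0mx // subr0 => /vin_const.
have hsoc s0 : (forall a, n a -> J (a * s0)) -> J s0.
  move=> hs0; apply: contrapT => ns0.
  have h := res_socle hJ Jn ns0 hs0 _ (fun u hu => hu) hres.
  have nJ : incl n J.
    move=> a /vin_const ha; apply/vin_const; apply: h => //.
    by split=> [u hu i|u v|a' u]; [apply: Jn|apply: vinD|apply: vinZ].
  have /Mn /(_ 0) : ker J M (delta_mx 0 0).
    rewrite /ker -rowE => i; apply: nJ; have : vin n (row 0 M) by rewrite -hM; apply: span_row.
    exact.
  by rewrite !mxE !eqxx; case: hn.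
(* Q = n^2 + J *)
pose Q a := exists w : 'rV[C]_r.+1, vin n w /\ vin J (a%:M - w *m M).
have hQ : idl Q.
  split.
  - exists 0; split; first exact: vin_eq0.
    by rewrite mul0mx subr0; apply/vin_const; apply: idl0.
  - move=> a b [w [hw h]] [w' [hw' h']]; exists (w + w'); split; first exact: vinD.
    by rewrite raddfD /= mulmxDl opprD addrACA; apply: vinD.
  - move=> a b [w [hw h]]; exists (a *: w); split; first exact: vinZ.
    by rewrite -scalemxAl -scale_scalar_mx -scalerBr; apply: vinZ.
have hz : n (M 0 0).
  have : vin n (row 0 M) by rewrite -hM; apply: span_row.
  by move=> /(_ 0); rewrite mxE.
have nQz : ~ Q (M 0 0).
  move=> [w [hw h]]; have /Mn /(_ 0) : ker J M (delta_mx 0 0 - w).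
    rewrite /ker mulmxBl -rowE (_ : row 0 M = (M 0 0)%:M) //.
    by apply/matrixP => i j; rewrite !ord1 !mxE eqxx mulr1n.
  rewrite !mxE !eqxx => h1; case: hn => hi n1 _; apply: n1.
  by apply: (idlBr hi h1); apply: hw.
have [x [hx nQx xreg]] := regular_element hJ Jn hsoc hQ hz nQz.
have [w hw] : span J M (x%:M) by rewrite hM; apply/vin_const.
(* As x is outside n^2 + J, one of its coefficients on the rows of M is a unit, and x can replace
   that row. *)
have [i nwi] : exists i, ~ n (w 0 i).
  apply: contrapT => h; apply: nQx; exists w; split=> // i.
  by apply: contrapT => h'; apply: h; exists i.
have [c hc] : exists c, w 0 i * c = 1 by case: hn => _ _; apply.
pose Y := row' i M; pose X : 'M[C]_(1 + r, 1) := col_mx (x%:M : 'M_1) Y.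
have Yn j : vin n (row j Y).
  have -> : row j Y = row (lift i j) M by apply/rowP => l; rewrite !mxE.
  by rewrite -hM; apply: span_row.
have XM : span J X = @vin _ n 1.
  apply: pred_ext.
    apply: span_min => //.
      by split=> [u hu l|u v|a u]; [apply: Jn|apply: vinD|apply: vinZ].
    move=> l; rewrite -[l]splitK; case: (split l) => p /=.
      rewrite rowKu; have -> : row p (x%:M : 'M[C]_1) = x%:M by apply/matrixP => a b; rewrite !ord1 !mxE.
      by apply/vin_const.
    by rewrite rowKd.
  have hS := span_smod hJ X.
  have XY j : span J X (row j Y).
    by have := span_row hJ X (rshift 1 j); rewrite rowKd.
  have Xx : span J X x%:M.
    have := span_row hJ X (lshift r 0); rewrite rowKu.
    by have -> // : row 0 (x%:M : 'M[C]_1) = x%:M by apply/matrixP => a b; rewrite !ord1 !mxE.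
  rewrite -hM; apply: span_min => // l.
  case: (unliftP i l) => [j ->|->].
    by have := XY j; rewrite (_ : row j Y = row (lift i j) M) //; apply/rowP => p; rewrite !mxE.
  have -> : row i M = c *: (w *m M - (col' i w) *m Y).
    apply/rowP => p; rewrite !mxE (bigD1_ord i) //=.
    under [X in _ - X]eq_bigr do rewrite !mxE.
    by rewrite addrK mulrA (mulrC c) hc mul1r.
  apply: (smodZ hS); apply: (smodB hS); last exact: (smodM hJ hS).
  have -> : w *m M = x%:M - (x%:M - w *m M) by rewrite subKr.
  by apply: (smodB hS) => //; apply: (smod_vin hS).
have Xn : incl (ker J X) (@vin _ n (1 + r)).
  by apply: (@min_same_size J _ _ M X) => //; rewrite XM.
have J'n : incl (addg J x) n by apply: addg_min.
have hJ' : idl (addg J x) by [].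
have [z [sz nz hzr]] : exists z, [/\ size z = r, n = igen (addg J x) z & rseq (addg J x) z].
  apply: (IH (addg J x) hJ' J'n Y).
  - by rewrite span_addg.
  - move=> u /vin_addg [t ht].
    have /Xn /vin_row [] // : ker J X (row_mx (- t) u).
    by apply/ker_col; rewrite scalerN.
  have := res_reduce hn hJ Jn hx xreg (@ker_xsat _ _ _ xreg _ _ X) (res_ext hn hJ (esym XM) Xn (res_leq hJ hres)).
  rewrite ker_split // => /res_summand; case=> //.
  - by split=> [u hu l|u v|a u]; [apply: J'n|apply: vinD|apply: vinZ].
  - exact: ker_smod.
exists (x :: z); split=> //=; first by rewrite sz.
by rewrite nz igen_addg.
Qed.

Lemma serre_theorem s : pd (@zid C) s (@vin _ n 1) ->
  exists z, n = igen (@zid C) z /\ rseq (@zid C) z.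
Proof.
have hz := idl_zid C; have zn : incl (@zid C) n by move=> a ->; apply: idl0.
move=> /(pd_res hN hn hz zn) hres.
have [|r [M [nM Mn]]] := @min_gens _ _ hN hn _ hz 1 (@vin _ n 1).
  by split=> [u hu l|u v|a u]; [apply: zn|apply: vinD|apply: vinZ].
by have [z [_ nz hzr]] := serre_regular hz zn (esym nM) Mn hres; exists z.
Qed.
End Serre.

(** * Powers of an ideal generated by a regular sequence *)

Section IdealPowers.
Variable C : comNzRingType.
Implicit Types (J : C -> Prop) (s : seq C).

(** Makes [jpow top s k] the k-th power of the ideal generated by s. *)
Definition top : C -> Prop := fun _ => True.

(* J I^k, where I = (s) and I0 = (s0), through J I^(k+1) = J I0^(k+1) + a J I^k. *)
Fixpoint jpow J s : nat -> C -> Prop :=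
  if s is a :: s0 then
    fix jp k := if k is k'.+1 then
      fun z => exists z0 z', [/\ jpow J s0 k z0, jp k' z' & z = z0 + a * z'] else J
  else fun k => if k is _.+1 then @zid C else J.

Lemma jpow0 J s : jpow J s 0 = J. Proof. by case: s. Qed.

Lemma jpowS J a s k z : jpow J (a :: s) k.+1 z <->
  exists z0 z', [/\ jpow J s k.+1 z0, jpow J (a :: s) k z' & z = z0 + a * z'].
Proof. by []. Qed.

Lemma idl_top : idl top. Proof. by []. Qed.

Lemma jpow_idl J s k : idl J -> idl (jpow J s k).
Proof.
move=> hJ; elim: s k => [|a s IHs] k; first by case: k => // k; apply: idl_zid.
elim: k => [|k IH] //.
split.
- exists 0, 0; rewrite mulr0 addr0; split=> //; apply: idl0 => //; exact: IHs.
- move=> _ _ [z0 [z' [h1 h2 ->]]] [w0 [w' [h3 h4 ->]]]; exists (z0 + w0), (z' + w').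
  by split; [apply: idlD => //; exact: IHs|apply: idlD|rewrite mulrDr addrACA].
- move=> b _ [z0 [z' [h1 h2 ->]]]; exists (b * z0), (b * z').
  by split; [apply: idlM => //; exact: IHs|apply: idlM|rewrite mulrDr mulrCA].
Qed.

Lemma jpow_cons J a s k : idl J -> incl (jpow J s k) (jpow J (a :: s) k).
Proof.
move=> hJ; case: k => [|k] z; first by rewrite !jpow0.
move=> hz; exists z, 0; rewrite mulr0 addr0; split=> //; apply: idl0; exact: (@jpow_idl J (a :: s)).
Qed.

Lemma jpow_mem J s k x z : idl J -> x \in s -> jpow J s k z -> jpow J s k.+1 (x * z).
Proof.
move=> hJ; elim: s k z => [|a s IHs] k z //.
rewrite inE => /orP [/eqP ->|xs].
  move=> hz; exists 0, z; rewrite add0r; split=> //; apply: idl0; exact: (@jpow_idl J s).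
elim: k z => [|k IH] z.
  by rewrite jpow0 => hz; apply: jpow_cons => //; apply: IHs; rewrite ?jpow0.
move=> [z0 [z' [h1 h2 ->]]]; exists (x * z0), (x * z').
by split; [apply: IHs|apply: IH|rewrite mulrDr mulrCA].
Qed.

Lemma jpow_mono J J' s k : incl J J' -> incl (jpow J s k) (jpow J' s k).
Proof.
move=> JJ; elim: s k => [|a s IHs]; case=> [|k] //.
elim: k => [|k IH] z [z0 [z' [h1 h2 ->]]]; exists z0, z'; split=> //; try exact: IHs.
  exact: JJ.
exact: IH.
Qed.

Lemma jpow_mul_gen J s k x z : idl J -> igen (@zid C) s x -> jpow J s k z -> jpow J s k.+1 (x * z).
Proof.
move=> hJ hx hz; have hI := jpow_idl s k.+1 hJ.
move: x hx; apply: igen_min => [|x ->|x xs]; last exact: jpow_mem.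
  split; first by rewrite mul0r; apply: idl0.
  - by move=> x y hx hy; rewrite mulrDl; apply: idlD.
  - by move=> b x hx; rewrite -mulrA; apply: idlM.
by rewrite mul0r; apply: idl0.
Qed.

Lemma jpow_shift J s k : idl J -> (forall x, x \in s -> J x) -> incl (jpow top s k.+1) (jpow J s k).
Proof.
move=> hJ; elim: s k => [|a s IHs] k sJ; first by move=> z ->; apply: idl0; apply: jpow_idl.
have sJ' x : x \in s -> J x by move=> xs; apply: sJ; rewrite inE xs orbT.
elim: k => [|k IH] z [z0 [z' [h1 h2 ->]]].
  apply: idlD => //; first by have := IHs 0%N sJ' _ h1; rewrite jpow0.
  by apply: idlMr => //; apply: sJ; rewrite mem_head.
by exists z0, z'; split=> //; [apply: IHs|apply: IH].
Qed.

Lemma jpow_mul J s i j y z : idl J -> jpow J s i z -> jpow top s j y -> jpow J s (i + j) (y * z).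
Proof.
move=> hJ hz.
suff H t : {subset t <= s} -> forall j y, jpow top t j y -> jpow J s (i + j) (y * z) by apply: H.
elim: t => [|a t IHt] ts; case=> [|k] {}y.
- by move=> _; rewrite addn0; apply: idlM => //; apply: jpow_idl.
- by move=> ->; rewrite mul0r; apply: idl0; apply: jpow_idl.
- by move=> _; rewrite addn0; apply: idlM => //; apply: jpow_idl.
have {}IHt : forall j y, jpow top t j y -> jpow J s (i + j) (y * z).
  by apply: IHt => x xt; apply: ts; rewrite inE xt orbT.
have as_ : a \in s by apply: ts; rewrite mem_head.
elim: k y => [|k IH] y [y0 [y' [h1 h2 ->]]]; rewrite mulrDl -mulrA addnS.
  apply: idlD; [exact: jpow_idl|by rewrite -addnS; apply: IHt|apply: jpow_mem => //].
  by rewrite addn0; apply: idlM => //; apply: jpow_idl.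
apply: idlD; [exact: jpow_idl|by rewrite -addnS; apply: IHt|apply: jpow_mem => //].
exact: IH.
Qed.

Lemma jpow_unshift s k : incl (jpow (igen (@zid C) s) s k) (jpow top s k.+1).
Proof.
suff H t : {subset t <= s} -> forall j, incl (jpow (igen (@zid C) s) t j) (jpow top s j.+1) by apply: H.
have one z : igen (@zid C) s z -> jpow top s 1 z.
  by move=> hz; rewrite -[z]mulr1; apply: jpow_mul_gen => //; rewrite jpow0.
elim: t => [|a t IHt] ts; case=> [|j]; try exact: one.
  by move=> z ->; apply: idl0; apply: jpow_idl.
have {}IHt : forall j, incl (jpow (igen (@zid C) s) t j) (jpow top s j.+1).
  by apply: IHt => x xt; apply: ts; rewrite inE xt orbT.
have as_ : a \in s by apply: ts; rewrite mem_head.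
elim: j => [|j IH] z [z0 [z' [h1 h2 ->]]].
  apply: idlD; [exact: jpow_idl|exact: IHt|apply: jpow_mem => //; exact: one].
apply: idlD; [exact: jpow_idl|exact: IHt|apply: jpow_mem => //; exact: IH].
Qed.

Lemma jpow_scale J s k a z : idl J -> J a -> jpow top s k z -> jpow J s k (a * z).
Proof.
move=> hJ ha hz; rewrite mulrC; apply: (@jpow_mul J s 0 k) => //; by rewrite jpow0.
Qed.

(* s is a regular sequence when read from its last element. *)
Fixpoint rrev s := if s is a :: s0 then
  (forall c, igen (@zid C) s0 (a * c) -> igen (@zid C) s0 c) /\ rrev s0 else True.

Lemma rseq_rev s : rseq (@zid C) (rev s) -> rrev s.
Proof.
have cat J t a : rseq J (t ++ [:: a]) -> idl J -> rseq J t /\ forall c, igen J t (a * c) -> igen J t c.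
  elim: t J => [|b t IH] J /=; first by case.
  move=> [h1 h2] hJ; case: (IH _ h2) => //.
  by rewrite igen_addg // => h3 h4.
elim: s => [|a s IH] //; rewrite rev_cons -cats1 => /cat [|h1 h2]; first exact: idl_zid.
split; last exact: IH.
have E : igen (@zid C) (rev s) = igen (@zid C) s by apply: igen_eqmem => [|x]; [exact: idl_zid|rewrite mem_rev].
by rewrite -E.
Qed.

(* The consequence of the freeness of I^k / J I^k over C/J, where I = (s), that the induction on s needs. *)
Definition free_at s := forall J b k z, idl J -> (forall x, x \in s -> J x) ->
  (forall c, J (b * c) -> J c) -> jpow top s k z -> jpow J s k (b * z) -> jpow J s k z.

(** Let I = (s). From a z in I^(k+1), induction gives z in I^k; then a z is in I I^k with a regular
    modulo I, and freeness puts z in I I^k. *)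
Lemma regular_mod_pow s a : free_at s -> (forall c, igen (@zid C) s (a * c) -> igen (@zid C) s c) ->
  forall k z, jpow top s k (a * z) -> jpow top s k z.
Proof.
move=> hs areg; elim=> [|k IH] z; first by rewrite jpow0.
move=> h; apply: jpow_unshift; have hm x : x \in s -> igen (@zid C) s x by apply: igen_mem; apply: idl_zid.
apply: (hs _ a) => //; last by apply: jpow_shift.
by apply: IH; apply: jpow_shift h.
Qed.

(** Let I = (s). Two decompositions z0 + a z' = w0 + a w' give a (w' - z') in I^(k+1), so w' - z' is
    in I^(k+1) since a is regular modulo this power. As a and s lie in J, both corrections are
    absorbed. *)
Lemma jpow_cancel J a s k z0 z' : free_at s ->
  (forall c, igen (@zid C) s (a * c) -> igen (@zid C) s c) -> idl J ->
  (forall x, x \in a :: s -> J x) -> jpow top s k.+1 z0 ->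
  jpow J (a :: s) k.+1 (z0 + a * z') -> jpow J s k.+1 z0 /\ jpow J (a :: s) k z'.
Proof.
move=> hs areg hJ sJ hz0 [w0 [w' [h1 h2 e]]].
have sJ' x : x \in s -> J x by move=> xs; apply: sJ; rewrite inE xs orbT.
have hw : jpow top s k.+1 (w' - z').
  apply: (regular_mod_pow hs areg); have -> : a * (w' - z') = z0 - w0.
    by rewrite mulrBr; apply/eqP; rewrite subr_eq addrAC eq_sym subr_eq e addrC.
  apply: idlB => //; first exact: jpow_idl.
  by apply: jpow_mono h1.
have E : z0 = w0 + a * (w' - z') by rewrite mulrBr addrA -e addrK.
split.
  rewrite E; apply: idlD => //; first exact: jpow_idl.
  by apply: jpow_scale => //; apply: sJ; rewrite mem_head.
have -> : z' = w' - (w' - z') by rewrite subKr.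
apply: idlB => //; first exact: (@jpow_idl J (a :: s)).
by apply: jpow_cons => //; apply: jpow_shift.
Qed.

Lemma rrev_free s : rrev s -> free_at s.
Proof.
elim: s => [|a s IHs] /=.
  by move=> _ J b [|k] z hJ _ breg hz; [apply: breg|].
move=> [areg /IHs hs] J b k z hJ sJ breg.
have sJ' x : x \in s -> J x by move=> xs; apply: sJ; rewrite inE xs orbT.
elim: k z => [|k IH] z; first by move=> _; apply: breg.
move=> [z0 [z' [h1 h2 ->]]]; rewrite mulrDr mulrCA => h.
have [|h3 h4] := jpow_cancel hs areg hJ sJ _ h.
  by apply: idlM => //; apply: jpow_idl.
exists z0, z'; split=> //; first exact: (hs _ b).
exact: IH.
Qed.

Lemma rrev_cancel J a s k z0 z' : rrev (a :: s) -> idl J ->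
  (forall x, x \in a :: s -> J x) -> jpow top s k.+1 z0 ->
  jpow J (a :: s) k.+1 (z0 + a * z') -> jpow J s k.+1 z0 /\ jpow J (a :: s) k z'.
Proof. by move=> [areg /rrev_free hs]; apply: jpow_cancel. Qed.

(** The graded ring of the powers of (s), reduced modulo J, is a polynomial ring over the domain
    C/J. The induction compares the terms x0 and y0 free of a: one of them lies in J times its
    power, and once it is dropped a factor a can be cancelled, which lowers the total degree. *)
Lemma rrev_valuation J s i j x y : rrev s -> prm J -> (forall x, x \in s -> J x) ->
  jpow top s i x -> jpow top s j y -> jpow J s (i + j) (x * y) -> jpow J s i x \/ jpow J s j y.
Proof.
move=> + hP; have hJ := prm_idl hP.
elim: s i j x y => [|a s IHs] i j x y hs sJ.
  case: i => [|i]; last by move=> -> _ _; left.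
  case: j => [|j]; last by move=> _ -> _; right.
  by move=> _ _; rewrite addn0; case: hP => _ _; apply.
have sJ' z : z \in s -> J z by move=> zs; apply: sJ; rewrite inE zs orbT.
have hs0 : rrev s by case: hs.
have regP b : ~ J b -> forall c, J (b * c) -> J c.
  by move=> nb c; case: (hP) => _ _ h /h [].
have [N] := ubnP (i + j); elim: N i j x y => // N IHN i j x y.
case: i => [|i].
  move=> _ _ hy h; have [hx|nx] := pselect (J x); first by left.
  by right; apply: (rrev_free hs hJ sJ (regP _ nx)).
case: j => [|j].
  move=> _ hx _ h; have [hy|ny] := pselect (J y); first by right.
  by left; apply: (rrev_free hs hJ sJ (regP _ ny)) => //; rewrite mulrC -[i.+1]addn0.
rewrite ltnS => lN [x0 [x' [hx0 hx' ->]]] [y0 [y' [hy0 hy' ->]]] h.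
have half i' j' u0 u' v : (i'.+1 + j'.+1 <= N)%N -> jpow top s i'.+1 u0 -> jpow top (a :: s) i' u' ->
    jpow top (a :: s) j'.+1 v -> jpow J (a :: s) (i'.+1 + j'.+1) ((u0 + a * u') * v) ->
    jpow J s i'.+1 u0 -> jpow J (a :: s) i'.+1 (u0 + a * u') \/ jpow J (a :: s) j'.+1 v.
  move=> le hu0 hu' hv huv Ju0.
  have h1 : jpow J (a :: s) (i' + j'.+1).+1 (0 + a * (u' * v)).
    have -> : 0 + a * (u' * v) = (u0 + a * u') * v - v * u0 by ring.
    apply: idlB => //; first exact: (@jpow_idl J (a :: s)).
    by apply: (@jpow_mul J (a :: s) i'.+1 j'.+1) => //; apply: jpow_cons.
  have [|_ /(IHN _ _ _ _ _ hu' hv) []] := rrev_cancel hs hJ sJ _ h1.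
  - by apply: idl0; apply: jpow_idl.
  - by [].
  - by move=> Ju'; left; exists u0, u'.
  - by right.
have h0 : jpow J (a :: s) (i + j.+1).+1 (x0 * y0 + a * (x0 * y' + x' * (y0 + a * y'))).
  by move: h; rewrite addSn; congr (jpow _ _ _ _); ring.
have [|h1 _] := rrev_cancel hs hJ sJ _ h0.
  by rewrite mulrC; apply: (@jpow_mul top s i.+1 j.+1); [exact: idl_top|exact: hx0|exact: hy0].
have [hx|hy] := IHs i.+1 j.+1 x0 y0 hs0 sJ' hx0 hy0 h1.
  by apply: half => //; exists y0, y'.
rewrite or_comm; apply: half => //; first by rewrite addnC.
  by exists x0, x'.
by rewrite mulrC addnC.
Qed.

Lemma rrev_coef J a s N (z : nat -> C) : rrev (a :: s) -> idl J -> (forall x, x \in a :: s -> J x) ->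
  (forall i, (i <= N)%N -> jpow top s (N - i) (z i)) ->
  jpow J (a :: s) N (\sum_(i < N.+1) z i * a ^+ i) -> forall i, (i <= N)%N -> jpow J s (N - i) (z i).
Proof.
move=> hs hJ sJ; elim: N z => [|N IH] z hz.
  by rewrite big_ord_recl big_ord0 addr0 expr0 mulr1 => h [|i] //; rewrite jpow0.
rewrite big_ord_recl expr0 mulr1.
under eq_bigr => i _ do rewrite exprSr mulrA mulrC.
rewrite -big_distrr /= => h.
have [|h1 h2] := rrev_cancel hs hJ sJ _ h; first exact: (hz 0%N).
case=> [|i] hi //; rewrite subSS; apply: (IH (z \o S)) => // k hk.
by rewrite /= -subSS; apply: hz.
Qed.
End IdealPowers.

(** * Subrings of a field *)

(** [asbool] makes the predicate boolean, and the proof hA is an argument so that the closure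
    property can be found by instance inference. *)
Definition srp (F : fieldType) (A : F -> Prop) (hA : is_subring A) : {pred F} := fun x => `[< A x >].

Fact srp_closed (F : fieldType) (A : F -> Prop) (hA : is_subring A) : subring_closed (srp hA).
Proof.
case: (hA) => a0 a1 aB aM; split; first exact/asboolP.
- by move=> x y /asboolP hx /asboolP hy; apply/asboolP; apply: aB.
- by move=> x y /asboolP hx /asboolP hy; apply/asboolP; apply: aM.
Qed.

HB.instance Definition _ (F : fieldType) (A : F -> Prop) (hA : is_subring A) :=
  GRing.isSubringClosed.Build F (srp hA) (srp_closed hA).

Definition sr (F : fieldType) (A : F -> Prop) (hA : is_subring A) := {x : F | x \in srp hA}.

HB.instance Definition _ (F : fieldType) (A : F -> Prop) (hA : is_subring A) :=
  [isSub of sr hA for @sval _ _].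
HB.instance Definition _ (F : fieldType) (A : F -> Prop) (hA : is_subring A) :=
  [Choice of sr hA by <:].
HB.instance Definition _ (F : fieldType) (A : F -> Prop) (hA : is_subring A) :=
  [SubChoice_isSubComNzRing of sr hA by <:].

Section Transfer.
Variables (F : fieldType) (A : F -> Prop) (hA : is_subring A).
Local Notation C := (sr hA).

Lemma sr_mem (a : C) : A (val a).
Proof. by case: a => a /= /asboolP. Qed.

Definition mk a (ha : A a) : C := exist _ a (introT (asboolP (A a)) ha).

Lemma val_mk a (ha : A a) : val (mk ha) = a. Proof. by []. Qed.

Lemma valM (x y : C) : val (x * y) = val x * val y. Proof. exact: rmorphM. Qed.
Lemma valD (x y : C) : val (x + y) = val x + val y. Proof. exact: rmorphD. Qed.
Lemma valB (x y : C) : val (x - y) = val x - val y. Proof. exact: rmorphB. Qed.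
Lemma val1 : val (1 : C) = 1. Proof. exact: rmorph1. Qed.
Lemma val0 : val (0 : C) = 0. Proof. exact: rmorph0. Qed.

Lemma sub0 : A 0. Proof. by case: hA. Qed.
Lemma sub1 : A 1. Proof. by case: hA. Qed.
Lemma subB x y : A x -> A y -> A (x - y). Proof. by case: hA => _ _ h _; apply: h. Qed.
Lemma subM x y : A x -> A y -> A (x * y). Proof. by case: hA => _ _ _; apply. Qed.
Lemma subN x : A x -> A (- x). Proof. by rewrite -sub0r; apply: subB; apply: sub0. Qed.
Lemma subD x y : A x -> A y -> A (x + y).
Proof. by move=> hx hy; rewrite -[y]opprK; apply: subB => //; apply: subN. Qed.
Lemma subX x k : A x -> A (x ^+ k).
Proof. by move=> hx; elim: k => [|k IH]; rewrite ?expr0 ?exprS; [exact: sub1|apply: subM]. Qed.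
Lemma sub_sum (T : Type) (r : seq T) (f : T -> F) : (forall i, A (f i)) -> A (\sum_(i <- r) f i).
Proof. by move=> h; elim/big_ind: _ => [|x y|//]; [exact: sub0|exact: subD]. Qed.

Lemma sr_lift s : (forall x, x \in s -> A x) -> exists t : seq C, map val t = s.
Proof.
elim: s => [|x s IH] hs; first by exists [::].
have [|t <-] := IH; first by move=> y ys; apply: hs; rewrite inE ys orbT.
have hx : A x by apply: hs; rewrite mem_head.
by exists (mk hx :: t).
Qed.

Definition up (I : F -> Prop) : C -> Prop := fun a => I (val a).
Definition dn (I : C -> Prop) : F -> Prop := fun z => exists a, val a = z /\ I a.

Lemma dnP I (a : C) : dn I (val a) <-> I a.
Proof. by split=> [[b [/val_inj ->]]//|h]; exists a. Qed.

Lemma dnK I : up (dn I) = I.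
Proof. by apply: pred_ext => a /dnP. Qed.

Lemma upK I : incl I A -> dn (up I) = I.
Proof.
move=> IA; apply: pred_ext => z; first by move=> [a [<- h]].
by move=> hz; exists (mk (IA _ hz)).
Qed.

Lemma idl_up I : is_ideal A I -> idl (up I).
Proof.
move=> [_ i0 iD iM]; split=> [|x y|a x]; rewrite /up ?rmorph0 ?rmorphD ?rmorphM //.
  exact: iD.
by apply: iM; apply: sr_mem.
Qed.

Lemma idl_dn I : idl I -> is_ideal A (dn I).
Proof.
move=> hI; split.
- by move=> z [a [<- _]]; apply: sr_mem.
- by exists 0; split; [exact: rmorph0|apply: idl0].
- by move=> _ _ [a [<- ha]] [b [<- hb]]; exists (a + b); split; [exact: rmorphD|apply: idlD].
- by move=> z _ hz [a [<- ha]]; exists (mk hz * a); split; [exact: rmorphM|apply: idlM].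
Qed.

Lemma prm_up P : is_prime_ideal A P -> prm (up P).
Proof.
move=> [hi h1 hP]; split; [exact: idl_up|by rewrite /up rmorph1|].
by move=> a b; rewrite /up rmorphM; apply: hP; apply: sr_mem.
Qed.

Lemma prm_dn P : prm P -> is_prime_ideal A (dn P).
Proof.
move=> hP; split; first exact: idl_dn (prm_idl hP).
  by rewrite -(rmorph1 (val : C -> F)) => /dnP; case: hP.
move=> a b ha hb; rewrite -[a](val_mk ha) -[b](val_mk hb) -rmorphM => /dnP h.
by case: hP => _ _ /(_ _ _ h) [] h'; [left|right]; apply/dnP.
Qed.

Lemma loc_up m : local_ring A m -> loc (up m).
Proof.
move=> [_ hm h1 hu]; split; [exact: idl_up|by rewrite /up rmorph1|].
move=> a /(hu _ (sr_mem a)) [_ [b [hb ab]]]; exists (mk hb); apply: val_inj.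
by rewrite rmorphM rmorph1.
Qed.

Lemma ideal_genP (s : seq C) : ideal_gen A (in_seq (map val s)) = dn (igen (@zid C) s).
Proof.
have hz : idl (@zid C) by apply: idl_zid.
apply: pred_ext => z.
  apply; first exact/idl_dn/igen_idl.
  by move=> _ /mapP [a sa ->]; apply/dnP; apply: igen_mem.
move=> [a [<- ha]] I hI sI; rewrite -[I _]/(up I a).
have hi := idl_up hI; move: a ha; apply: igen_min => //.
  by move=> b ->; apply: idl0.
by move=> b bs; apply: sI; apply: map_f.
Qed.

Lemma ideal_gen_lift m (s : seq F) : incl m A -> set_eq m (ideal_gen A (in_seq s)) ->
  exists t : seq C, map val t = s /\ up m = igen (@zid C) t.
Proof.
move=> mA ms; have [|t ts] := @sr_lift s.
  by move=> x xs; apply: mA; apply/ms => I _ sI; apply: sI.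
exists t; split=> //; rewrite -[RHS]dnK; congr up.
by rewrite -ideal_genP ts; apply: pred_ext => z /ms.
Qed.

Lemma noeth_up : noetherian A -> noeth C.
Proof.
move=> [_ hN] I hI; have hd := idl_dn hI.
have [s hs] := hN _ hd; have [|t [_ ht]] := ideal_gen_lift _ hs; first by case: hd.
by exists t; rewrite -ht dnK.
Qed.

Lemma noeth_dn : noeth C -> noetherian A.
Proof.
move=> hN; split=> // I hI; have [s hs] := hN _ (idl_up hI).
exists (map val s) => z; rewrite ideal_genP -hs upK //; by case: hI.
Qed.

Lemma chain_up c k : prime_chain A c k -> chain (fun i => up (c i)) k.
Proof.
move=> [h1 h2]; split=> i hi; first exact/prm_up/h1.
have [h3 h4] := h2 _ hi; split; first by move=> a /h3.
have [[ciA _ _ _] _ _] := h1 _ hi.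
by move=> h; apply: h4 => z hz; rewrite -(val_mk (ciA _ hz)); apply: h.
Qed.

Lemma chain_dn (c : nat -> C -> Prop) k : chain c k -> prime_chain A (fun i => dn (c i)) k.
Proof.
move=> [h1 h2]; split=> i hi; first exact/prm_dn/h1.
have [h3 h4] := h2 _ hi; split; first by move=> z [a [<- /h3 h]]; apply/dnP.
by move=> h; apply: h4 => a ha; apply/dnP; apply: h; apply/dnP.
Qed.

Lemma zid_incl (I : C -> Prop) : idl I -> incl (@zid C) I.
Proof. by move=> hI a ->; apply: idl0. Qed.

(** A system of d generators is a regular sequence in every order, hence also when read backwards,
    as the results on powers require. *)
Lemma regular_up m d : regular_local A m d -> exists z : seq C, [/\ size z = d, up m = igen (@zid C) z &
  forall t, size t = d -> up m = igen (@zid C) t -> rseq (@zid C) t /\ rrev t].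
Proof.
move=> [hl hN [[c hc] _] [s [sd ms]]].
have [|t [ts mt]] := ideal_gen_lift _ ms; first by case: hl => _ [].
have hc' := chain_up hc.
have reg t' : size t' = d -> up m = igen (@zid C) t' -> rseq (@zid C) t'.
  move=> td mt'; rewrite -td in hc'.
  apply: (dim_rseq (noeth_up hN) (loc_up hl) (idl_zid C) mt' hc').
  by apply: zid_incl; apply: prm_idl; case: hc' => h _; apply: h.
exists t; split=> //; first by rewrite -sd -ts size_map.
move=> t' td mt'; split; first exact: reg.
apply: rseq_rev; apply: reg; rewrite ?size_rev //.
by rewrite mt'; apply: igen_eqmem => [|x]; [exact: idl_zid|rewrite mem_rev].
Qed.

Lemma regular_dn m (z : seq C) : noeth C -> local_ring A m -> up m = igen (@zid C) z ->
  rseq (@zid C) z -> regular_local A m (size z).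
Proof.
move=> hN hl mz hz; have hn := loc_up hl; split=> //; first exact: noeth_dn.
- have [c [hc _ _]] := rseq_chain hN hn (idl_zid C) mz hz.
  split; first by exists (fun i => dn (c i)); apply: chain_dn.
  move=> [c' /chain_up hc'].
  suff: ((size z).+1 <= size z)%N by rewrite ltnn.
  apply: (dim_le hN hn (idl_zid C) mz hc').
  by apply: zid_incl; apply: prm_idl; case: hc' => h _; apply: h.
exists (map val z); split; first by rewrite size_map.
move=> x; rewrite ideal_genP -mz upK //; by case: hl => _ [].
Qed.

Lemma chain_le_dim m d (s : seq C) c k : regular_local A m d -> up m = igen (@zid C) s ->
  prime_chain A c k -> (k <= size s)%N.
Proof.
move=> [hl hN _ _] ms /chain_up hc.
apply: (dim_le (noeth_up hN) (loc_up hl) (idl_zid C) ms hc).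
by apply: zid_incl; apply: prm_idl; case: hc => h _; apply: h.
Qed.

Lemma ideal_powP m (s : seq C) k (a : C) : is_ideal A m -> up m = igen (@zid C) s ->
  ideal_pow A m k (val a) <-> jpow (@top C) s k a.
Proof.
move=> hm ms; have hi := idl_up hm; have ht := idl_top C.
have mA : incl m A by case: hm.
split.
  move=> h; apply/dnP; apply: h; first exact/idl_dn/jpow_idl.
  move=> _ [t [<- tm ->]] {a}.
  have [|t' E] := @sr_lift t; first by move=> x /tm /mA.
  subst t; exists (\prod_(y <- t') y); split; first by rewrite big_map rmorph_prod.
  have {}tm : forall y, y \in t' -> up m y by move=> y yt; apply: tm; apply: map_f.
  rewrite size_map; elim: t' tm => [|y t' IH] tm; first by rewrite big_nil jpow0.
  rewrite big_cons; apply: jpow_mul_gen => //; first by rewrite -ms; apply: tm; rewrite mem_head.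
  by apply: IH => x xt; apply: tm; rewrite inE xt orbT.
move=> ha I hI sI.
have hI' := idl_up hI; rewrite -[I _]/(up I a).
have H : forall u, {subset u <= s} -> forall k b, jpow (@top C) u k b ->
  exists r : seq (C * seq C), (forall p, p \in r -> size p.2 = k /\ {subset p.2 <= s}) /\
    b = \sum_(p <- r) p.1 * \prod_(y <- p.2) y.
  clear; elim=> [|x u IHu] us; case=> [|k] b.
  - by move=> _; exists [:: (b, [::])]; split=> [p|]; [rewrite inE => /eqP ->|rewrite big_seq1 big_nil mulr1].
  - by move=> ->; exists [::]; rewrite big_nil.
  - by move=> _; exists [:: (b, [::])]; split=> [p|]; [rewrite inE => /eqP ->|rewrite big_seq1 big_nil mulr1].
  have {}IHu : forall k b, jpow (@top C) u k b ->
    exists r : seq (C * seq C), (forall p, p \in r -> size p.2 = k /\ {subset p.2 <= s}) /\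
    b = \sum_(p <- r) p.1 * \prod_(y <- p.2) y.
    by apply: IHu => y yu; apply: us; rewrite inE yu orbT.
  elim: k b => [|k IH] b [b0 [b' [/IHu [r [hr ->]] hb' ->]]].
    exists (rcons r (b', [:: x])); split=> [p|]; last first.
      by rewrite -cats1 big_cat /= !big_seq1 mulrC.
    rewrite mem_rcons inE => /orP [/eqP ->|/hr //]; split=> // y; rewrite inE => /eqP ->.
    by apply: us; rewrite mem_head.
  have [r' [hr' ->]] := IH _ hb'.
  exists (r ++ [seq (p.1, x :: p.2) | p <- r']); split=> [p|]; last first.
    rewrite big_cat /= big_map big_distrr /=; congr (_ + _); apply: eq_bigr => p _.
    by rewrite big_cons mulrCA.
  rewrite mem_cat => /orP [/hr //|/mapP [q /hr' [qs qsub] ->]] /=.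
  split; first by rewrite qs.
  by move=> y; rewrite inE => /orP [/eqP ->|/qsub //]; apply: us; rewrite mem_head.
have [r [hr ->]] := H s (fun x hx => hx) k a ha.
rewrite big_seq; apply: idl_sum => // p /hr [ps psub]; apply: idlM => //.
apply: sI; exists (map val p.2); split; first by rewrite size_map.
  move=> _ /mapP [y yp ->]; rewrite -[m _]/(up m y) ms.
  by apply: igen_mem; [exact: idl_zid|exact: psub].
by rewrite rmorph_prod big_map.
Qed.
End Transfer.
Arguments up {F A} hA I a.
Arguments dn {F A hA} I z.
Arguments noeth_up {F A} hA _ [I] _.

(** * Localization of free resolutions *)

Section ScalarExtension.
Variables (C D : comNzRingType) (phi : {rmorphism C -> D}).
Hypotheses (phi_inj : injective phi)
  (phi_frac : forall x : D, exists a c e, phi c * e = 1 /\ phi c * x = phi a).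

Definition ext k (K : 'rV[C]_k -> Prop) : 'rV[D]_k -> Prop :=
  fun u => exists c e v, [/\ phi c * e = 1, K v & phi c *: u = map_mx phi v].

Lemma vin_zid (E : comNzRingType) k (u : 'rV[E]_k) : vin (@zid E) u <-> u = 0.
Proof.
split=> [h|-> i]; last by rewrite mxE.
by apply/rowP => i; rewrite mxE; apply: h.
Qed.

Lemma span_zid (E : comNzRingType) r k (M : 'M[E]_(r, k)) u : span (@zid E) M u <-> exists w, u = w *m M.
Proof.
split=> -[w hw]; exists w; first by move/vin_zid/eqP: hw; rewrite subr_eq0 => /eqP.
by apply/vin_zid; rewrite hw subrr.
Qed.

Lemma common_denominator k (u : 'rV[D]_k) : exists c e v, phi c * e = 1 /\ phi c *: u = map_mx phi v.
Proof.
elim: k u => [|k IH] u.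
  by exists 1, 1, 0; rewrite rmorph1 mulr1; split=> //; apply/rowP => -[].
move: u; rewrite -[k.+1]/(1 + k)%N => u.
have [c [e [v [ce hv]]]] := IH (rsubmx u).
have [a [c' [e' [ce' ha]]]] := phi_frac (lsubmx u 0 0).
exists (c' * c), (e' * e), (row_mx ((c * a)%:M) (c' *: v)); split.
  by rewrite rmorphM mulrACA ce ce' mulr1.
rewrite -{1}[u]hsubmxK map_row_mx scale_row_mx; congr row_mx.
  apply/matrixP => i j; rewrite !ord1 !mxE eqxx mulr1n !rmorphM -ha mxE.
  by rewrite mulrCA mulrA.
by rewrite map_mxZ -hv scalerA rmorphM.
Qed.

Lemma ext_span r k (M : 'M[C]_(r, k)) : ext (span (@zid C) M) = span (@zid D) (map_mx phi M).
Proof.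
apply: pred_ext => u.
  move=> [c [e [v [ce /span_zid [w ->] h]]]]; apply/span_zid; exists (e *: map_mx phi w).
  by rewrite -scalemxAl -map_mxM -h scalerA mulrC ce scale1r.
move=> /span_zid [w ->]; have [c [e [v [ce hv]]]] := common_denominator w.
exists c, e, (v *m M); split=> //; first by apply/span_zid; exists v.
by rewrite map_mxM -hv scalemxAl.
Qed.

Lemma ext_ker r k (M : 'M[C]_(r, k)) : ext (ker (@zid C) M) = ker (@zid D) (map_mx phi M).
Proof.
apply: pred_ext => u.
  move=> [c [e [v [ce /vin_zid hv h]]]]; apply/vin_zid.
  by rewrite -[u]scale1r -ce mulrC -scalerA h -scalemxAl -map_mxM hv map_mx0 scaler0.
move=> /vin_zid hu; have [c [e [v [ce hv]]]] := common_denominator u.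
exists c, e, v; split=> //; apply/vin_zid.
have E : map_mx phi (v *m M) = 0 by rewrite map_mxM -hv -scalemxAl hu scaler0.
apply/rowP => i; apply: phi_inj; have /rowP /(_ i) := E.
by rewrite mxE => ->; rewrite !mxE rmorph0.
Qed.

(** Images and kernels of matrices commute with passing to fractions. Only [pd] is transported,
    since minimality of a resolution may be lost. *)
Lemma pd_ext s k (K : 'rV[C]_k -> Prop) : pd (@zid C) s K -> pd (@zid D) s (ext K).
Proof.
elim: s k K => [|s IH] k K [r [M [-> h]]]; exists r, (map_mx phi M); rewrite ext_span -ext_ker; split=> //;
  last exact: IH.
move=> u [c [e [v [ce /h/vin_zid -> hu]]]]; apply/vin_zid.
by rewrite -[u]scale1r -ce mulrC -scalerA hu map_mx0 scaler0.
Qed.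
End ScalarExtension.

(** * Rings of fractions inside the field *)

Section Fractions.
Variable F : fieldType.
Implicit Types (A B M P Q I : F -> Prop).

Definition fracs A M : F -> Prop := fun z => exists a c, [/\ A a, M c & z = a / c].

Definition mult A M := [/\ incl M A, M 1, (forall a b, M a -> M b -> M (a * b)) & ~ M 0].

Section Fracs.
Variables (A M : F -> Prop).
Hypotheses (hA : is_subring A) (hM : mult A M).

Lemma mult_neq0 c : M c -> c != 0.
Proof. by move=> hc; apply/eqP => e; case: hM => _ _ _; apply; rewrite -e. Qed.

Lemma fracs_sub : incl A (fracs A M).
Proof. by move=> z hz; exists z, 1; rewrite divr1; split=> //; case: hM. Qed.

Lemma fracs_inv c : M c -> fracs A M c^-1.
Proof. by move=> hc; exists 1, c; rewrite mul1r; split=> //; case: hA. Qed.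

Lemma fracs_subring : is_subring (fracs A M).
Proof.
have [MA M1 MM M0] := hM.
split; [by apply: fracs_sub; apply: sub0|by apply: fracs_sub; apply: sub1| |].
  move=> _ _ [a [c [ha hc ->]]] [b [e [hb he ->]]]; exists (a * e - b * c), (c * e).
  have /mult_neq0 c0 := hc; have /mult_neq0 e0 := he.
  split; [|exact: MM|by field; rewrite c0 e0].
  by apply: subB => //; apply: subM => //; apply: MA.
move=> _ _ [a [c [ha hc ->]]] [b [e [hb he ->]]]; exists (a * b), (c * e).
have /mult_neq0 c0 := hc; have /mult_neq0 e0 := he.
by split; [apply: subM|apply: MM|field; rewrite c0 e0].
Qed.

Lemma fracs_noeth : noetherian A -> noetherian (fracs A M).
Proof.
have [MA M1 MM M0] := hM; have hB := fracs_subring.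
move=> [_ hN]; split=> // I hI; have [IB i0 iD iM] := hI.
have hIA : is_ideal A (fun z => A z /\ I z).
  split=> [z []|||] //; first by split=> //; apply: sub0.
    by move=> x y [hx ix] [hy iy]; split; [apply: subD|apply: iD].
  by move=> a x ha [hx ix]; split; [apply: subM|apply: iM => //; apply: fracs_sub].
have [s hs] := hN _ hIA.
have sI x : x \in s -> A x /\ I x by move=> xs; apply/hs => K _; apply.
exists s => z; split.
  move=> hz; have [a [c [ha hc e]]] := IB _ hz; have c0 := mult_neq0 hc.
  move=> J hJ sJ; have [JB j0 jD jM] := hJ.
  have aI : A a /\ I a.
    split=> //; rewrite (_ : a = c * z); last by rewrite e mulrC divfK.
    by apply: iM => //; apply: fracs_sub; apply: MA.
  have hJA : is_ideal A (fun z => A z /\ J z).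
    split=> [y []|||] //; first by split=> //; apply: sub0.
      by move=> x y [hx ix] [hy iy]; split; [apply: subD|apply: jD].
    by move=> b x hb [hx ix]; split; [apply: subM|apply: jM => //; apply: fracs_sub].
  have [] : (fun z => A z /\ J z) a.
    apply: (proj1 (hs a) aI _ hJA) => x xs; split; [by case: (sI x xs)|exact: sJ].
  by move=> _ ja; rewrite e mulrC; apply: jM => //; apply: fracs_inv.
by apply=> // x xs; case: (sI x xs).
Qed.
End Fracs.

Lemma compl_mult A P : is_subring A -> is_prime_ideal A P -> mult A (fun c => A c /\ ~ P c).
Proof.
move=> hA [[PA p0 _ _] p1 pM]; split=> [z []|||[]] //; first by split=> //; apply: sub1.
by move=> a b [ha na] [hb nb]; split; [apply: subM|move=> /(pM _ _ ha hb) []].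
Qed.

Lemma localizeE A P : localize A P = fracs A (fun c => A c /\ ~ P c).
Proof.
apply: pred_ext => z; first by move=> [b [c [hb hc nc ->]]]; exists b, c.
by move=> [b [c [hb [hc nc] ->]]]; exists b, c.
Qed.

Section Localize.
Variables (A P : F -> Prop).
Hypotheses (hA : is_subring A) (hP : is_prime_ideal A P).

Let hM := compl_mult hA hP.

Lemma prime_neq0 c : A c -> ~ P c -> c != 0.
Proof. by move=> hc nc; apply: (mult_neq0 hM). Qed.

Lemma localize_subring : is_subring (localize A P).
Proof. rewrite localizeE; exact: fracs_subring. Qed.

Lemma localize_sub : incl A (localize A P).
Proof. rewrite localizeE; exact: fracs_sub. Qed.

Lemma localize_max_num a c : A a -> A c -> ~ P c -> localize_max A P (a / c) -> P a.
Proof.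
have [[PA p0 pD pI] p1 pM] := hP.
move=> ha hc nc [p [e [hp he ne E]]].
have c0 := prime_neq0 hc nc; have e0 := prime_neq0 he ne.
have E' : a * e = p * c by apply/eqP; rewrite -eqr_div ?E.
by case: (pM a e ha he) => //; rewrite E' mulrC; apply: pI.
Qed.

Lemma localize_local : local_ring (localize A P) (localize_max A P).
Proof.
have [[PA p0 pD pI] p1 pM] := hP.
split; first exact: localize_subring.
- split.
  + by move=> _ [p [c [hp hc nc ->]]]; exists p, c; split=> //; apply: PA.
  + by exists 0, 1; rewrite mul0r; split=> //; apply: sub1.
  + move=> _ _ [p [c [hp hc nc ->]]] [q [e [hq he ne ->]]].
    have c0 := prime_neq0 hc nc; have e0 := prime_neq0 he ne.
    exists (e * p + c * q), (c * e); split; [|exact: subM|by move=> /(pM _ _ hc he) []|by field; rewrite c0 e0].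
    by apply: pD; apply: pI.
  + move=> _ _ [a [c [ha hc nc ->]]] [q [e [hq he ne ->]]].
    have c0 := prime_neq0 hc nc; have e0 := prime_neq0 he ne.
    exists (a * q), (c * e); split; [exact: pI|exact: subM|by move=> /(pM _ _ hc he) []|by field; rewrite c0 e0].
- move=> h; apply: (p1); have a1 := sub1 hA.
  by apply: (@localize_max_num 1 1 a1 a1 p1); rewrite divr1.
- move=> z hz nz; split=> //; have [a [c [ha hc nc e]]] := hz.
  have na : ~ P a by move=> pa; apply: nz; exists a, c.
  have c0 := prime_neq0 hc nc; have a0 := prime_neq0 ha na.
  exists (c / a); split; first by exists c, a.
  by rewrite e; field; rewrite c0 a0.
Qed.

Lemma localize_noeth : noetherian A -> noetherian (localize A P).
Proof. rewrite localizeE; exact: fracs_noeth. Qed.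

Lemma prime_contract Q : is_prime_ideal (localize A P) Q -> is_prime_ideal A (fun z => A z /\ Q z).
Proof.
move=> [[QA q0 qD qM] q1 qP]; split; [split|by case|].
- by move=> z [].
- by split=> //; apply: sub0.
- by move=> x y [hx ix] [hy iy]; split; [apply: subD|apply: qD].
- by move=> a x ha [hx ix]; split; [apply: subM|apply: qM => //; apply: localize_sub].
- move=> a b ha hb [hab /qP []]; try exact: localize_sub; by [left|right].
Qed.

Lemma chain_contract c k : prime_chain (localize A P) c k ->
  prime_chain A (fun i z => A z /\ c i z) k /\ incl (fun z => A z /\ c k z) P.
Proof.
move=> [h1 h2]; split; last first.
  move=> z [hz cz]; apply: contrapT => nz.
  have [[_ _ _ cM] c1 _] := h1 k (leqnn k); apply: c1.
  rewrite -(mulVf (prime_neq0 hz nz)); apply: cM => //.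
  by exists 1, z; rewrite mul1r; split=> //; apply: sub1.
split=> i hi; first exact/prime_contract/h1.
have [h3 h4] := h2 i hi; split; first by move=> z [hz /h3].
move=> h; apply: h4 => z hz.
have [[cA _ _ cM] _ _] := h1 _ hi; have [[_ _ _ cM'] _ _] := h1 i (ltnW hi).
have [a [e [ha he ne E]]] := cA _ hz; have e0 := prime_neq0 he ne.
have [_ ca] : A a /\ c i a.
  apply: h; split=> //; rewrite (_ : a = e * z); last by rewrite E mulrC divfK.
  by apply: cM => //; apply: localize_sub.
rewrite E mulrC; apply: cM' => //; exists 1, e; rewrite mul1r; split=> //; exact: sub1.
Qed.
End Localize.
End Fractions.

Section Inclusion.
Variables (F : fieldType) (A B : F -> Prop) (hA : is_subring A) (hB : is_subring B) (AB : incl A B).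

Definition sr_incl (a : sr hA) : sr hB := mk hB (AB (sr_mem a)).

Lemma val_sr_incl a : val (sr_incl a) = val a. Proof. by []. Qed.

Fact sr_incl_zmod : zmod_morphism sr_incl.
Proof. by move=> x y; apply: val_inj; rewrite valB !val_sr_incl valB. Qed.

Fact sr_incl_monoid : monoid_morphism sr_incl.
Proof.
by split=> [|x y]; apply: val_inj; rewrite ?val1 ?valM !val_sr_incl ?val1 ?valM.
Qed.

HB.instance Definition _ := GRing.isZmodMorphism.Build (sr hA) (sr hB) sr_incl sr_incl_zmod.
HB.instance Definition _ := GRing.isMonoidMorphism.Build (sr hA) (sr hB) sr_incl sr_incl_monoid.

Lemma sr_incl_inj : injective sr_incl.
Proof. by move=> x y /(congr1 val); rewrite !val_sr_incl => /val_inj. Qed.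
End Inclusion.

(** * Localizations of regular local rings are regular *)

Section RegularLocalization.
Variables (F : fieldType).
Implicit Types (A M P R m : F -> Prop).

Lemma fracs_denominator A M (hA : is_subring A) (hM : mult A M) (hB : is_subring (fracs A M)) :
  forall x : sr hB, exists (a c : sr hA) e, sr_incl hB (fracs_sub hM) c * e = 1 /\
    sr_incl hB (fracs_sub hM) c * x = sr_incl hB (fracs_sub hM) a.
Proof.
move=> x; have [a [c [ha hc e]]] := sr_mem x.
have hcA : A c by case: (hM) => MA _ _ _; apply: MA.
have c0 := mult_neq0 hM hc.
exists (mk hA ha), (mk hA hcA), (mk hB (fracs_inv hA hc)); split; apply: val_inj;
  rewrite valM !val_sr_incl.
  by rewrite val1 !val_mk mulfV.
by rewrite !val_mk e mulrC divfK.
Qed.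

(** The syzygy theorem gives P a finite free resolution over R, which localizes to one of the
    maximal ideal of R_P; Serre's criterion applies. The strict inequality of dimensions comes from
    contracting a longest chain of R_P to R and adding m on top. *)
Theorem regular_localization R m d P : regular_local R m d -> is_prime_ideal R P ->
  exists d', regular_local (localize R P) (localize_max R P) d' /\ (~ incl m P -> (d' < d)%N).
Proof.
move=> hreg hP; have [hl hN hdim _] := hreg; have [hR _ _ _] := hl.
have hM := compl_mult hR hP.
have hB' : is_subring (fracs R (fun c => R c /\ ~ P c)) by apply: fracs_subring.
have hlB := localize_local hR hP.
have hNB := localize_noeth hR hP hN.
rewrite localizeE in hlB hNB *.
have [z [sz mz hz]] := regular_up hR hreg.
have [hzr _] := hz z sz mz.
have hPi : idl (up hR P) by apply: idl_up; case: hP.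
have hpd : pd (@zid (sr hR)) (size z) (@vin _ (up hR P) 1).
  have hs : smod (@zid (sr hR)) (@vin _ (up hR P) 1).
    split=> [u hu i|u v|a u]; [|exact: vinD|exact: vinZ].
    by rewrite hu; apply: idl0.
  have hh := (syzygy_theorem (noeth_up hR hN) (loc_up hR hl) (idl_zid _) mz hzr hs).
  exact: res_pd hh.
have := pd_ext (@sr_incl_inj _ _ _ hR hB' (fracs_sub hM)) (fracs_denominator hR hM (hB:=hB')) hpd.
set hMx := localize_max R P in hlB *.
have hlB' := loc_up hB' hlB; have hiB := loc_idl hlB'.
have -> : ext (sr_incl hB' (fracs_sub hM)) (@vin _ (up hR P) 1) = @vin _ (up hB' hMx) 1.
  apply: pred_ext => u.
    move=> [c [e [v [ce hv E]]]]; rewrite -[u]scale1r -ce mulrC -scalerA E.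
    apply: vinZ => // i; rewrite mxE /up val_sr_incl.
    exists (val (v 0 i)), 1; rewrite divr1; split=> //; [exact: hv|exact: sub1|by case: hP].
  move=> /vin1 [p [c [hp hc nc E]]].
  have pR : R p by case: hP => -[PR _ _ _] _ _; apply: PR.
  have c0 : c != 0 := prime_neq0 hR hP hc nc.
  have hci : fracs R (fun c => R c /\ ~ P c) c^-1 by apply: fracs_inv.
  exists (mk hR hc), (mk hB' hci), (mk hR pR)%:M; split.
  - by apply: val_inj; rewrite valM val1 val_sr_incl !val_mk mulfV.
  - by apply/vin_const.
  - apply/rowP => i; rewrite ord1 !mxE eqxx mulr1n; apply: val_inj; rewrite valM !val_sr_incl !val_mk.
    by rewrite E mulrC divfK.
move=> /(serre_theorem (noeth_up hB' hNB) hlB') [z' [mz' hz']].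
exists (size z'); have hres := regular_dn (noeth_up hB' hNB) hlB mz' hz'; split=> // nmP.
have [_ _ [[c hc] _] _] := hres.
have [|hc' cP] := @chain_contract _ _ _ hR hP c (size z'); first by rewrite localizeE.
have hn := loc_up hR hl.
have [hPi' P1 _] := hP.
have mP : incl P m.
  move=> y hy; have [PR _ _ _] := hPi'.
  have h1 : ~ up hR P 1 by rewrite /up val1.
  exact: (@loc_max _ _ _ hn hPi h1 (mk hR (PR _ hy)) hy).
have [_ [mR _ _ _] _ _] := hl.
have hch := chain_rcons (loc_prm hn) _ _ (chain_up hR hc').
rewrite -sz; apply: (dim_le (noeth_up hR hN) hn (idl_zid _) mz (hch _ _)).
- by move=> a /cP /mP.
- by move=> h; apply: nmP => y hy; apply: cP; apply: (h (mk hR (mR _ hy)) hy).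
- by rewrite leq0n; apply: zid_incl; apply: idl_up; case: hc' => /(_ 0%N (leq0n _)) [].
Qed.
End RegularLocalization.

(** * Regular local rings are factorial *)

Section StablyFree.
Variable D : comNzRingType.

(* diag(G, 1_a) is conjugate to the identity of size b. *)
Definition stably_free p (G : 'M[D]_p) a b :=
  exists (N : 'M_(p + a, b)) (M : 'M_(b, p + a)), block_mx G 0 0 1%:M = N *m M /\ M *m N = 1%:M.

(** The images of N M and M N are isomorphic, and those of M N and 1 - M N together make up D^r.
    Adding D^a turns the image of 1 - M N into D^b, so im(N M) (+) D^b is D^(r + a). *)
Lemma stably_free_compl p r (N : 'M[D]_(p, r)) (M : 'M[D]_(r, p)) a b :
  (N *m M) *m (N *m M) = N *m M -> M *m (N *m M) = M ->
  stably_free (1%:M - M *m N) a b -> stably_free (N *m M) b (r + a).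
Proof.
move=> GG MG [N' [M' [NM MN]]].
have [E defE] : exists E, E = M *m N by exists (M *m N).
rewrite -defE in NM.
have EE : E *m E = E by rewrite defE mulmxA -(mulmxA M) MG.
have EM : E *m M = M by rewrite defE -mulmxA MG.
have NEM : N *m E *m M = N *m M by rewrite -mulmxA EM.
have NEN : N *m E *m (1%:M - E) = 0 by rewrite mulmxBr mulmx1 -mulmxA EE subrr.
have M1 : row_mx (N *m E) 0 *m N' = 0.
  rewrite -[N']mulmx1 -MN !mulmxA -(mulmxA _ N') -NM mul_row_block.
  by rewrite NEN !mulmx0 mul0mx !addr0 row_mx0 mul0mx.
have M2 : M' *m col_mx (E *m M) 0 = 0.
  rewrite -[M']mul1mx -MN -!mulmxA (mulmxA N') -NM mul_block_col.
  by rewrite mulmxA mulmxBl mul1mx EE subrr mul0mx !mulmx0 !mul0mx !addr0 col_mx0 mulmx0.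
exists (col_mx (row_mx (N *m E) 0) M'), (row_mx (col_mx (E *m M) 0) N'); split.
  rewrite mul_col_row M1 M2 MN; congr block_mx.
  by rewrite mul_row_col mulmx0 addr0 mulmxA -(mulmxA N) EE NEM.
rewrite mul_row_col mul_col_row -NM add_block_mx !mulmx0 !mul0mx !addr0 !add0r.
have -> : E *m M *m (N *m E) = E by rewrite EM mulmxA -defE EE.
by rewrite [E + _]addrC subrK -scalar_mx_block.
Qed.

(** A projective module with a finite free resolution is stably free: the surjection M from a free
    module onto the image of G is split by N, and its kernel is the image of 1 - M N, which has a
    shorter resolution. *)
Lemma pd_stably_free s p (G : 'M[D]_p) : G *m G = G -> pd (@zid D) s (fun u : 'rV_p => u *m G = u) ->
  exists a b, stably_free G a b.
Proof.
elim: s p G => [|s IH] p G GG [r [M [KM hM]]].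
all: have MG : M *m G = M by
  apply/row_matrixP => i; rewrite row_mul; move: (span_row (idl_zid D) M i); rewrite -KM.
all: have [N NM] : exists N : 'M_(p, r), G = N *m M by
  (have /choice [f hf] : forall i, exists w, row i G = w *m M by
    move=> i; apply/span_zid; rewrite -KM -row_mul GG);
  exists (\matrix_i f i); apply/row_matrixP => i; rewrite row_mul rowK.
  have MN : M *m N = 1%:M.
    apply/row_matrixP => i; apply/eqP; rewrite -subr_eq0 -linearB /=; apply/eqP/vin_zid/hM/vin_zid.
    by rewrite -row_mul mulmxBl mul1mx -mulmxA -NM MG subrr row0.
  exists 0%N, r, (col_mx N 0), (row_mx M 0); split.
    rewrite mul_col_row !mulmx0 !mul0mx -NM; congr block_mx; by rewrite [1%:M]flatmx0.
  by rewrite mul_row_col mulmx0 addr0.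
have MNM : M *m (N *m M) = M by rewrite -NM.
have [||a [b hab]] := IH r (1%:M - M *m N).
- rewrite mulmxBr mulmx1 mulmxBl mul1mx mulmxA -(mulmxA M N M) MNM subrr subr0 //.
- rewrite (_ : (fun u => _) = ker (@zid D) M) //; apply: pred_ext => u.
    rewrite mulmxBr mulmx1 => /eqP; rewrite subr_eq addrC -subr_eq subrr eq_sym => /eqP h.
    by apply/vin_zid; rewrite -{1}MNM !mulmxA -(mulmxA u) h mul0mx.
  by move=> /vin_zid h; rewrite mulmxBr mulmx1 mulmxA h mul0mx subr0.
exists b, (r + a)%N; rewrite NM; apply: stably_free_compl => //; by rewrite -NM.
Qed.
End StablyFree.

Section DeterminantTrick.
Variables (F : fieldType) (B : F -> Prop) (hB : is_subring B).

Lemma det_in k (M : 'M[F]_k) : (forall i j, B (M i j)) -> B (\det M).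
Proof.
move=> hM; apply: sub_sum => // s; apply: subM => //.
  by apply: subX => //; apply: subN => //; apply: sub1.
by elim/big_ind: _ => [|x y|i _] //; [apply: sub1|apply: subM].
Qed.

Lemma mulmx_in p q r (M : 'M[F]_(p, q)) (N : 'M[F]_(q, r)) :
  (forall i j, B (M i j)) -> (forall i j, B (N i j)) -> forall i j, B ((M *m N) i j).
Proof. by move=> hM hN i j; rewrite mxE; apply: sub_sum => // k; apply: subM. Qed.

(* The determinant of an isomorphism B^q -> I (+) B^b generates I. *)
Lemma stably_free_principal (I : F -> Prop) m b q (w : 'cV[F]_m) (v : 'rV[F]_m)
  (N : 'M[F]_(m + b, q)) (M : 'M[F]_(q, m + b)) : is_ideal B I ->
  (forall i, I (w i 0)) -> v *m w = 1%:M -> (forall z j, I z -> B (z * v 0 j)) ->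
  (forall i j, B (N i j)) -> (forall i j, B (M i j)) ->
  block_mx (w *m v) 0 0 1%:M = N *m M -> M *m N = 1%:M ->
  exists g, I g /\ forall z, I z -> exists t, B t /\ z = g * t.
Proof.
move=> [IB i0 iD iM] wI vw vB hN hM NM MN.
pose W : 'M[F]_(m + b, 1 + b) := block_mx w 0 0 1%:M.
pose V : 'M[F]_(1 + b, m + b) := block_mx v 0 0 1%:M.
have VW : V *m W = 1%:M.
  by rewrite mulmx_block !mulmx0 !mul0mx !addr0 !add0r vw mulmx1 -scalar_mx_block.
have WV : W *m V = N *m M.
  by rewrite mulmx_block !mulmx0 !mul0mx !addr0 !add0r mulmx1 NM.
pose G := V *m N; pose H := M *m W.
have HG : H *m G = 1%:M by rewrite /H /G mulmxA -(mulmxA M) WV mulmxA MN mul1mx.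
have GH : G *m H = 1%:M.
  rewrite /H /G mulmxA -(mulmxA V) -WV mulmxA VW mul1mx VW //.
have eq_q : q = (1 + b)%N.
  by apply/eqP; rewrite eqn_leq (mulmx1_min HG) (mulmx1_min GH).
clear HG; subst q.
have dGH : \det G * \det H = 1 by rewrite -det_mulmx GH det1.
have HE : H = row_mx (lsubmx M *m w) (rsubmx M).
  by rewrite /H -{1}[M]hsubmxK mul_row_block !mulmx0 mulmx1 addr0 add0r.
have GE : G = col_mx (v *m usubmx N) (dsubmx N).
  by rewrite /G -{1}[N]vsubmxK mul_block_col !mul0mx mul1mx addr0 add0r.
clearbody G H.
have HI i : I (H i (lshift b 0)).
  rewrite HE row_mxEl mxE; elim/big_ind: _ => // k _.
  by apply: iM => //; rewrite mxE.
have HB i j : B (H i j).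
  rewrite -[j]splitK; case: (split j) => k /=; first by rewrite ord1; apply: IB.
  by rewrite HE row_mxEr mxE.
exists (\det H); split.
  rewrite (expand_det_col _ (lshift b 0 : 'I_(1 + b))).
  elim/big_ind: _ => // i _; rewrite mulrC; apply: iM => //.
  apply: subM => //; last by apply: det_in => k l; rewrite !mxE.
  by apply: subX => //; apply: subN => //; apply: sub1.
move=> z hz; exists (z * \det G); split; last by rewrite mulrCA (mulrC (\det H)) dGH mulr1.
have -> : z * \det G = \det (block_mx z%:M 0 0 1%:M *m G).
  by rewrite det_mulmx det_ublock det1 mulr1 det_scalar expr1.
apply: det_in; rewrite GE mul_block_col !mul0mx mul1mx addr0 add0r mulmxA => i j.
rewrite -[i]splitK; case: (split i) => k /=; last by rewrite col_mxEd mxE.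
rewrite col_mxEu; apply: mulmx_in => k' l; last by rewrite mxE.
by rewrite mul_scalar_mx mxE ord1; apply: vB.
Qed.
End DeterminantTrick.

(** * The Auslander-Buchsbaum theorem *)

Section Factoriality.
Variable F : fieldType.
Implicit Types (A B I P Q R m : F -> Prop).

Definition isect A a b : F -> Prop := fun z => exists r s, [/\ A r, A s, z = a * r & z = b * s].

(** Existence of least common multiples. In this form it asks that certain ideals be principal,
    which can be attacked locally and by free resolutions. *)
Definition gcd_prop A := forall a b, A a -> A b ->
  exists c, A c /\ forall z, isect A a b z <-> exists t, A t /\ z = c * t.

Definition prime_elt A x := [/\ A x, x != 0, ~ divides A x 1 &
  forall a b, A a -> A b -> divides A x (a * b) -> divides A x a \/ divides A x b].

Lemma isectC A a b z : isect A a b z -> isect A b a z.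
Proof. by move=> [r [s [hr hs zr zs]]]; exists s, r. Qed.

Lemma isect_ideal A a b : is_subring A -> A a -> is_ideal A (isect A a b).
Proof.
move=> hA ha; split.
- by move=> _ [r [s [hr hs -> _]]]; apply: subM.
- by exists 0, 0; rewrite !mulr0; split=> //; apply: sub0.
- move=> _ y [r [s [hr hs -> e]]] [r' [s' [hr' hs' -> e']]]; exists (r + r'), (s + s').
  by split; [apply: subD|apply: subD|rewrite mulrDr|rewrite mulrDr -e -e'].
- move=> c _ hc [r [s [hr hs -> e]]]; exists (c * r), (c * s).
  by split; [apply: subM|apply: subM|rewrite mulrCA|rewrite e mulrCA].
Qed.

Lemma divide_out A x a : noetherian A -> A x -> ~ divides A x 1 -> x != 0 -> A a -> a != 0 ->
  exists k a', [/\ A a', ~ divides A x a' & a = x ^+ k * a'].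
Proof.
move=> hN hx x1 x0 ha a0; have [hA _] := hN; apply: contrapT => hno.
have step k : exists b : sr hA, a = x ^+ k * val b.
  elim: k => [|k [b hb]]; first by exists (mk hA ha); rewrite mul1r.
  have [|nd] := pselect (divides A x (val b)); last first.
    by case: hno; exists k, (val b); split=> //; apply: sr_mem.
  by case=> c [hc e]; exists (mk hA hc); rewrite hb e exprSr mulrA.
have [b hb] := choice step.
have bS k : val (b k) = x * val (b k.+1).
  by apply: (mulfI (expf_neq0 k x0)); rewrite -hb mulrA -exprSr -hb.
have [|k [c hc]] := ascending_seq_stable (noeth_up hA hN) (idl_zid _) (a := b).
  move=> k; exists (mk hA hx); apply: val_inj; rewrite valB valM val_mk -bS subrr val0 //.
have e : val (b k.+1) = val c * val (b k).
  by move/(congr1 val): hc; rewrite valB valM val0 => /eqP; rewrite subr_eq0 => /eqP.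
case: x1; exists (val c); split; first exact: sr_mem.
have b0 : val (b k.+1) != 0 by apply: contra_neq a0 => b0; rewrite (hb k.+1) b0 mulr0.
by apply: (mulIf b0); rewrite mul1r {1}e bS mulrCA mulrA.
Qed.

Lemma prime_pow_dvd A x j b s y : is_subring A -> prime_elt A x -> ~ divides A x b -> A b -> A s -> A y ->
  x ^+ j * y = b * s -> exists s', A s' /\ s = x ^+ j * s'.
Proof.
move=> hA [hx x0 x1 xP] nb hb; elim: j s y => [|j IH] s y hs hy e.
  by exists s; rewrite mul1r.
have [|//|[s' [hs' es]]] := xP b s hb hs.
  by exists (x ^+ j * y); split; [apply: subM => //; apply: subX|rewrite -e exprS mulrA].
have [|s'' [hs'' es']] := IH s' y hs' hy.
  by apply: (mulfI x0); rewrite mulrA -exprS e es mulrCA.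
by exists s''; split=> //; rewrite es es' exprS mulrA.
Qed.

(** Powers of x are split off from a and b; only the larger exponent enters the least common
    multiple. *)
Lemma gcd_reduce A x : noetherian A -> prime_elt A x ->
  (forall a b, A a -> A b -> ~ divides A x a -> ~ divides A x b ->
    exists c, A c /\ forall z, isect A a b z <-> exists t, A t /\ z = c * t) -> gcd_prop A.
Proof.
move=> hN xP H a b ha hb; have [hA _] := hN; have [hx x0 x1 _] := xP.
have z0 : forall a b, a = 0 -> exists c, A c /\ forall z, isect A a b z <-> exists t, A t /\ z = c * t.
  move=> {ha hb}a {}b ->; exists 0; split=> [|z]; first exact: sub0.
  split=> [[r [s [hr hs -> _]]]|[t [ht ->]]]; first by exists r.
  by rewrite mul0r; exists 0, 0; rewrite !mulr0; split=> //; apply: sub0.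
have sym : forall a b, (exists c, A c /\ forall z, isect A a b z <-> exists t, A t /\ z = c * t) ->
    exists c, A c /\ forall z, isect A b a z <-> exists t, A t /\ z = c * t.
  move=> {ha hb}a {}b [c [hc h]]; exists c; split=> // z; rewrite -h; split; exact: isectC.
have [/z0 //|a0] := eqVneq a 0; have [/z0 h0|b0] := eqVneq b 0; first exact: sym.
have [k [a' [ha' na' ea]]] := divide_out hN hx x1 x0 ha a0.
have [l [b' [hb' nb' eb]]] := divide_out hN hx x1 x0 hb b0.
rewrite {}ea {}eb {ha hb a0 b0}.
wlog lk : a' b' k l ha' hb' na' nb' / (l <= k)%N.
  move=> W; have [/W|/ltnW kl] := leqP l k; first exact.
  by apply: sym; apply: W.
have [c [hc h]] := H a' b' ha' hb' na' nb'.
have E : x ^+ k = x ^+ l * x ^+ (k - l) by rewrite -exprD subnKC.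
have xl0 : x ^+ l != 0 by apply: expf_neq0.
exists (x ^+ k * c); split; first by apply: subM => //; apply: subX.
move=> z; split=> [[r [s [hr hs zr zs]]]|[t [ht ->]]].
  have e : x ^+ (k - l) * (a' * r) = b' * s.
    by apply: (mulfI xl0); rewrite !mulrA -E -zr zs.
  have [s' [hs' es]] := prime_pow_dvd hA xP nb' hb' hs (subM hA ha' hr) e.
  have /h [t [ht et]] : isect A a' b' (a' * r).
    exists r, s'; split=> //; apply: (mulfI (expf_neq0 (k - l) x0)).
    by rewrite e es mulrCA.
  by exists t; split=> //; rewrite zr -mulrA et mulrA.
have /h [r [s [hr hs er es]]] : exists t', A t' /\ c * t = c * t' by exists t.
exists r, (x ^+ (k - l) * s); split=> //; first by apply: subM => //; apply: subX.
  by rewrite -mulrA er mulrA.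
by rewrite -mulrA es E mulrACA mulrCA -!mulrA; congr (_ * _); rewrite mulrCA.
Qed.

Lemma localize_denominator A Q r (f : 'I_r -> F) : is_subring A -> is_prime_ideal A Q ->
  (forall j, localize A Q (f j)) -> exists t, [/\ A t, ~ Q t & forall j, A (t * f j)].
Proof.
move=> hA hQ hf; have [_ Q1 QM] := hQ.
have /choice [e he] : forall j, exists e, [/\ A e, ~ Q e & A (e * f j)].
  move=> j; have [a [c [ha hc nc ->]]] := hf j; exists c; split=> //.
  by rewrite mulrC divfK //; apply: (prime_neq0 hA hQ).
exists (\prod_j e j).
have : A (\prod_j e j) /\ ~ Q (\prod_j e j).
  elim/big_ind: _ => [|x y [hx nx] [hy ny]|j _]; last by case: (he j).
    by split=> //; apply: sub1.
  by split; [apply: subM|move=> /(QM _ _ hx hy) []].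
case=> h1 h2; split=> // j; rewrite (bigD1 j) //= mulrAC; apply: subM => //; first by case: (he j).
elim/big_ind: _ => [|x y hx hy|i _]; [exact: sub1|exact: subM|by case: (he i)].
Qed.

Definition powers (x : F) : F -> Prop := fun c => exists k, c = x ^+ k.

Lemma powers_mult A x : is_subring A -> A x -> x != 0 -> mult A (powers x).
Proof.
move=> hA hx x0; split.
- by move=> _ [k ->]; apply: subX.
- by exists 0%N.
- by move=> _ _ [k ->] [l ->]; exists (k + l)%N; rewrite exprD.
- by move=> [k /esym/eqP]; rewrite expf_eq0 (negbTE x0) andbF.
Qed.

Section LocallyPrincipal.
Variables (R I : F -> Prop) (x : F).
Hypotheses (hR : is_subring R) (hNR : noetherian R) (hI : is_ideal R I) (hx : R x) (x0 : x != 0)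
  (xP : prime_elt R x) (Isat : forall z, R z -> I (x * z) -> I z) (Inz : exists z, I z /\ z != 0).
Variable s : nat.
Hypotheses (Ipd : pd (@zid (sr hR)) s.+1 (@vin _ (up hR I) 1))
  (Iloc : forall Q, is_prime_ideal R Q -> ~ Q x -> exists c, (exists t, [/\ R t, ~ Q t & I (t * c)]) /\
    forall z, I z -> exists t, localize R Q t /\ z = c * t).

Let B := fracs R (powers x).
Let hM := powers_mult hR hx x0.
Let hB : is_subring B := fracs_subring hR hM.
Let D := sr hB.
Let RB : incl R B := fracs_sub hM.

Definition extended : F -> Prop := fun z => B z /\ exists k, I (x ^+ k * z).

Lemma extended_ideal : is_ideal B extended.
Proof.
have [IR i0 iD iM] := hI.
split.
- by move=> z [].
- by split; [apply: sub0|exists 0%N; rewrite mulr0].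
- move=> y z [hy [k hk]] [hz [l hl]]; split; first exact: subD.
  exists (k + l)%N; rewrite mulrDr exprD; apply: iD; last by rewrite -mulrA; apply: iM => //; apply: subX.
  by rewrite mulrAC mulrC; apply: iM => //; apply: subX.
- move=> a z ha [hz [k hk]]; split; first exact: subM.
  have [r [_ [hr [l ->] ->]]] := ha; exists (l + k)%N.
  rewrite (_ : _ * _ = r * (x ^+ k * z)); first exact: iM.
  by rewrite exprD; field; apply: expf_neq0.
Qed.

Lemma extended_ext : ext (sr_incl hB RB) (@vin _ (up hR I) 1) = @vin _ (up hB extended) 1.
Proof.
have [IR i0 iD iM] := hI.
apply: pred_ext => u.
  move=> [c [e [v [ce hv E]]]]; apply/vin1; split; first exact: sr_mem.
  have [r [_ [hr [k ->] he]]] := sr_mem e.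
  have ce' : val c * val e = 1 by move/(congr1 val): ce; rewrite valM val1.
  exists k; have : val c * val (u 0 0) = val (v 0 0).
    by move/matrixP/(_ 0 0)/(congr1 val): E; rewrite !mxE valM.
  move=> E'; rewrite (_ : _ * _ = r * val (v 0 0)); first by apply: iM => //; apply: hv.
  have xk0 : x ^+ k != 0 by apply: expf_neq0.
  have -> : r = x ^+ k * val e by rewrite he mulrC divfK.
  by rewrite -E' !mulrA -(mulrA _ (val e)) (mulrC (val e)) ce' mulr1.
move=> /vin1 [_ [k hk]].
have hxk : R (x ^+ k) by apply: subX.
have hxi : B (x ^+ k)^-1 by apply: fracs_inv => //; exists k.
exists (mk hR hxk), (mk hB hxi), (mk hR (IR _ hk))%:M; split.
- by apply: val_inj; rewrite valM val1 val_sr_incl !val_mk mulfV // expf_neq0.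
- by apply/vin_const.
- by apply/rowP => i; rewrite ord1 !mxE eqxx mulr1n; apply: val_inj; rewrite valM !val_sr_incl !val_mk.
Qed.

(** After x is inverted, I becomes locally principal everywhere, hence invertible; its finite
    resolution makes it stably free, and the determinant gives a generator over B. Since x is prime
    and I is saturated for x, removing the powers of x from this generator yields one over R. *)
Lemma locally_principal : exists c, I c /\ forall z, I z -> exists t, R t /\ z = c * t.
Proof.
have [IR i0 iD iM] := hI.
have h1 := pd_ext (@sr_incl_inj _ _ _ hR hB RB) (@fracs_denominator _ _ _ hR hM hB) Ipd.
have [r [w [Kw hw]]] := h1; rewrite extended_ext in Kw => {h1}.
pose wf := map_mx val w : 'cV[F]_r.
have wE i : extended (wf i 0).
  have : @vin _ (up hB extended) 1 (row i w) by rewrite Kw; apply: span_row; apply: idl_zid.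
  by move/vin1; rewrite /up !mxE.
have genE z : extended z -> exists u : 'rV[D]_r, z%:M = map_mx val u *m wf.
  move=> hz; have hzB : B z by case: hz.
  have : @vin _ (up hB extended) 1 (mk hB hzB)%:M by apply/vin_const.
  rewrite Kw => /span_zid [u hu]; exists u; rewrite -map_mxM -hu.
  by apply/matrixP => i j; rewrite !ord1 !mxE.
have hBI z : I z -> extended z.
  by move=> hz; split; [apply/RB/IR|exists 0%N; rewrite mul1r].
(* H is the set of h in R that lie in I times the fractional ideal of all v with v I in B, so
   invertibility after inverting x means that H contains a power of x. Otherwise some prime Q
   contains H and misses x, and a generator c of I at Q produces an element t * t' of H outside
   Q. *)
pose H (h : sr hR) := exists v : 'rV[F]_r,
  (forall j z, I z -> B (z * v 0 j)) /\ v *m wf = (val h)%:M.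
have hH : idl H.
  split.
  - exists 0; split=> [j z hz|]; first by rewrite mxE mulr0; apply: sub0.
    by rewrite mul0mx val0 raddf0.
  - move=> h h' [v [hv e]] [v' [hv' e']]; exists (v + v'); split=> [j z hz|].
      by rewrite mxE mulrDr; apply: subD => //; [apply: hv|apply: hv'].
    by rewrite mulmxDl e e' valD raddfD.
  - move=> a h [v [hv e]]; exists (val a *: v); split=> [j z hz|].
      rewrite mxE mulrCA; apply: subM => //; last exact: hv.
      by apply: RB; apply: sr_mem.
    by rewrite -scalemxAl e scale_scalar_mx valM.
have [k [v [hv vw]]] : exists k, exists v : 'rV[F]_r,
    (forall j z, I z -> B (z * v 0 j)) /\ v *m wf = (x ^+ k)%:M.
  apply: contrapT => hno.
  have [|a b [k hk] [l hl]|a [k hk] [v [hv e]]|Q [hQ HQ MQ]] :=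
    @prm_disjoint _ H (fun a => exists k, val a = x ^+ k) (noeth_up hR hNR) hH.
  - by exists 0%N; rewrite val1.
  - by exists (k + l)%N; rewrite valM hk hl exprD.
  - by apply: hno; exists k, v; rewrite -hk.
  have hQF := prm_dn hQ; have [_ Q1 QM] := hQF.
  have nQx : ~ dn Q x.
    by move=> [a [ax Qa]]; apply: (MQ a) => //; exists 1%N.
  have [c [[t [ht nt Itc]] hc]] := Iloc hQF nQx.
  have hLQ := localize_subring hR hQF.
  have c0 : c != 0.
    have [z [hz z0]] := Inz; have [t' [_ e]] := hc z hz.
    by apply: contra_neq z0 => c0; rewrite e c0 mul0r.
  have /choice [f hf] : forall i, exists rho, localize R (dn Q) rho /\ wf i 0 = c * rho.
    move=> i; have [_ [k hk]] := wE i; have [rho [hrho e]] := hc _ hk.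
    have xk0 : x ^+ k != 0 by apply: expf_neq0.
    exists (rho / x ^+ k); split.
      apply: subM => //; exists 1, (x ^+ k); rewrite mul1r; split=> //; [exact: sub1|exact: subX|].
      rewrite -[x ^+ k](val_mk hR (subX hR k hx)) => /dnP h; apply: (MQ _ _ h).
      by exists k; rewrite val_mk.
    by rewrite mulrA -e mulrC mulKf.
  have [t' [ht' nt' hf']] := localize_denominator hR hQF (fun j => proj1 (hf j)).
  have [u hu] := genE _ (hBI _ Itc).
  have tt : H (mk hR (subM hR ht ht')).
    exists ((t' / c) *: map_mx val u); split=> [j z hz|].
      have [U hU] := genE _ (hBI _ hz).
      have -> : z = \sum_i val (U 0 i) * wf i 0.
        by move/matrixP/(_ 0 0): hU; rewrite !mxE eqxx mulr1n => ->; apply: eq_bigr => i _; rewrite mxE.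
      rewrite mxE mxE big_distrl /=; apply: sub_sum => // i.
      have [_ ->] := hf i.
      have a1 : B (sval (U 0 i)) := sr_mem _; have a2 : B (sval (u 0 j)) := sr_mem _.
      move: (sval (U 0 i)) (sval (u 0 j)) a1 a2 => p q a1 a2.
      rewrite (_ : _ * _ = p * (t' * f i) * q); last by field.
      by apply: subM => //; apply: subM => //; apply: RB.
    rewrite -scalemxAl -hu scale_scalar_mx val_mk; congr (_%:M).
    by field.
  have : dn Q (t * t') by exists (mk hR (subM hR ht ht')); split=> //; apply: HQ.
  by move/(QM _ _ ht ht') => [].
have xk0 : x ^+ k != 0 by apply: expf_neq0.
pose v1 := (x ^+ k)^-1 *: v.
have v1w : v1 *m wf = 1%:M by rewrite -scalemxAl vw scale_scalar_mx mulVf.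
have hxi l : B (x ^+ l)^-1 by apply: fracs_inv => //; exists l.
have v1B z j : extended z -> B (z * v1 0 j).
  move=> [_ [l hl]]; rewrite mxE (_ : z * _ = (x ^+ l)^-1 * (x ^+ k)^-1 * (x ^+ l * z * v 0 j)).
    exact: (subM hB (subM hB (hxi l) (hxi k)) (hv j _ hl)).
  by field; rewrite xk0 expf_neq0.
have hE0 i j : B (wf i 0 * v1 0 j) by apply: v1B.
(* E0 = w v1 is idempotent with image isomorphic to the extended ideal, and the kernel of w is the
   image of 1 - E0. *)
pose E0 : 'M[D]_r := \matrix_(i, j) mk hB (hE0 i j).
have E0F : map_mx val E0 = wf *m v1.
  by apply/matrixP => i j; rewrite [RHS]mxE big_ord1 mxE mxE.
have valinj p q (M N : 'M[D]_(p, q)) : map_mx val M = map_mx val N -> M = N.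
  by move=> /matrixP h; apply/matrixP => i j; apply: val_inj; have := h i j; rewrite !mxE.
have valmul p q l (M : 'M[D]_(p, q)) (N : 'M[D]_(q, l)) : map_mx val (M *m N) = map_mx val M *m map_mx val N.
  exact: map_mxM.
have EE : E0 *m E0 = E0.
  by apply: valinj; rewrite valmul E0F mulmxA -(mulmxA wf) v1w mulmx1.
have Ew : E0 *m w = w.
  by apply: valinj; rewrite valmul E0F -mulmxA v1w mulmx1.
have kerE : (fun u : 'rV_r => u *m (1%:M - E0) = u) = ker (@zid D) w.
  apply: pred_ext => u.
    rewrite mulmxBr mulmx1 => /eqP; rewrite subr_eq addrC -subr_eq subrr eq_sym => /eqP h.
    by apply/vin_zid; rewrite -Ew mulmxA h mul0mx.
  move=> /vin_zid h; suff -> : u *m (1%:M - E0) = u - u *m E0.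
    suff -> : u *m E0 = 0 by rewrite subr0.
    apply: valinj; rewrite valmul E0F mulmxA -valmul h; apply/matrixP => i j.
    by rewrite !mxE big1 // => l _; rewrite !mxE val0 mul0r.
  by rewrite mulmxBr mulmx1.
have G1 : (1%:M - E0) *m (1%:M - E0) = 1%:M - E0.
  by rewrite mulmxBr mulmx1 mulmxBl mul1mx EE subrr subr0.
have [|a [b hab]] := pd_stably_free (s := s) G1; first by rewrite kerE.
have [|||N [M [NM MN]]] := @stably_free_compl D r r 1%:M E0 a b; rewrite ?mul1mx ?mulmx1 //.
rewrite mul1mx in NM.
have [||||g [[hg [k' hk']] gI]] := @stably_free_principal _ _ hB _ _ _ _ wf v1 (map_mx val N) (map_mx val M)
    extended_ideal wE v1w v1B.
- by move=> i j; rewrite mxE; apply: sr_mem.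
- by move=> i j; rewrite mxE; apply: sr_mem.
- by rewrite -valmul -NM -E0F map_block_mx !map_mx0 map_mx1.
- by rewrite -valmul MN map_mx1.
have [z0 [hz0 nz0]] := Inz.
have g0 : g != 0.
  have [t [_ e]] := gI _ (hBI _ hz0).
  by apply: contra_neq nz0 => g0; rewrite e g0 mul0r.
have [_ _ x1 _] := xP.
(* g generates over B and x^k' g lies in I; what remains after removing all factors x still lies in
   I by saturation. *)
have [|e [g' [hg' ng' eg]]] := divide_out hNR hx x1 x0 (IR _ hk').
  by rewrite mulf_neq0 // expf_neq0.
have Ig' : I g'.
  move: hk'; rewrite eg; elim: e {eg} => [|e IH]; first by rewrite mul1r.
  move=> h; apply: IH; apply: Isat; first exact: (subM hR (subX hR e hx) hg').
  by rewrite mulrA -exprS.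
exists g'; split=> // z hz.
have [t [ht et]] := gI _ (hBI _ hz).
have [r0 [_ [hr0 [l ->] et']]] := ht.
have E : x ^+ (k' + l) * z = g' * (x ^+ e * r0).
  rewrite et et' exprD (_ : _ * _ = x ^+ k' * g * r0); last by field; rewrite expf_neq0.
  by rewrite eg mulrCA mulrA.
have [s' [hs' es]] := prime_pow_dvd hR xP ng' hg' (subM hR (subX hR e hx) hr0) (IR _ hz) E.
exists s'; split=> //; apply: (mulfI (expf_neq0 (k' + l) x0)).
by rewrite E es mulrCA.
Qed.
End LocallyPrincipal.

(** Induction on the dimension; in dimension 0 the ring is a field. A regular parameter x is prime,
    and at a prime Q that misses x the dimension drops, so the intersection of aR and bR is
    principal there. Its finite resolution comes from the syzygy theorem. *)
Theorem regular_gcd d R m : regular_local R m d -> gcd_prop R.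
Proof.
have [D] := ubnP d; elim: D d R m => // D IH d R m; rewrite ltnS => dD hreg.
have [hl hN hdim _] := hreg; have [hR hmi m1 hu] := hl.
have [z [sz mz hz]] := regular_up hR hreg.
have [hzr _] := hz z sz mz.
case: z sz mz hz hzr => [|x z] sz mz _ hzr.
  have inv_in a : R a -> a != 0 -> R a^-1.
    move=> ha a0; have [|_ [b [hb e]]] := hu a ha.
      move=> ma; have : up hR m (mk hR ha) by []; rewrite mz => /(congr1 val); rewrite val0 => e.
      by rewrite -[a]/(val (mk hR ha)) e eqxx in a0.
    by rewrite -[a^-1]mulr1 -e mulKf.
  move=> a b ha hb; have [a0|a0] := eqVneq a 0.
    exists 0; split=> [|y]; first exact: sub0.
    split=> [[r [s [hr hs -> _]]]|[t [ht ->]]]; first by exists r; rewrite a0.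
    by rewrite mul0r; exists 0, 0; rewrite !mulr0; split=> //; apply: sub0.
  exists b; split=> // y; split=> [[r [s [hr hs _ ->]]]|[t [ht ->]]]; first by exists s.
  by exists (a^-1 * (b * t)), t; split; [exact: (subM hR (inv_in _ ha a0) (subM hR hb ht))|by []|by rewrite mulVKf|by []].
have [xreg hzr'] := hzr.
have hn := loc_up hR hl; have hNC := noeth_up hR hN.
have hPx : prm (addg (@zid (sr hR)) x).
  apply: (rseq_prm hNC hn _ _ hzr'); first by apply: addg_idl; apply: idl_zid.
  by rewrite igen_addg //; apply: idl_zid.
have dvE a (ha : R a) : divides R (val x) a <-> addg (@zid (sr hR)) x (mk hR ha).
  split=> [[c [hc e]]|[c hc]].
    exists (mk hR hc); apply: val_inj; rewrite valB valM !val_mk e mulrC subrr val0 //.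
  exists (val c); split; first exact: sr_mem.
  by move/(congr1 val): hc; rewrite valB valM val0 val_mk => /eqP; rewrite subr_eq0 mulrC => /eqP.
have x0 : val x != 0.
  apply/eqP => e; have /xreg : zid (x * 1) by rewrite mulr1; apply: val_inj; rewrite val0.
  by move/(congr1 val); rewrite val1 val0 => /eqP; rewrite oner_eq0.
have hx : R (val x) by apply: sr_mem.
have xm : m (val x) by rewrite -[m _]/(up hR m x) mz; apply: igen_mem; [exact: idl_zid|rewrite mem_head].
have xP : prime_elt R (val x).
  split=> //.
    rewrite (dvE _ (sub1 hR)) => h; case: hPx => _ h1 _; apply: h1.
    by rewrite (_ : 1 = mk hR (sub1 hR)) //; apply: val_inj; rewrite val1.
  move=> a b ha hb; rewrite (dvE _ (subM hR ha hb)) (dvE _ ha) (dvE _ hb).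
  rewrite (_ : mk hR _ = mk hR ha * mk hR hb); last by apply: val_inj; rewrite valM.
  by case: hPx => _ _; apply.
apply: (gcd_reduce hN xP) => a b ha hb na nb.
have a0 : a != 0 by apply: contra_not_neq na => ->; exists 0; rewrite mulr0; split=> //; apply: sub0.
have b0 : b != 0 by apply: contra_not_neq nb => ->; exists 0; rewrite mulr0; split=> //; apply: sub0.
have hI := isect_ideal b hR ha.
have [c [Ic hc]] : exists c, isect R a b c /\ forall y, isect R a b y -> exists t, R t /\ y = c * t.
  apply: (@locally_principal R (isect R a b) (val x) hR hN hI hx x0 xP _ _ (size z)).
  - move=> y hy [r [s [hr hs er es]]]; have [_ _ _ xPr] := xP.
    have [|//|[r' [hr' er']]] := xPr a r ha hr; first by exists y.
    have [|//|[s' [hs' es']]] := xPr b s hb hs; first by exists y.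
    exists r', s'; split=> //; apply: (mulfI x0); first by rewrite er er' mulrCA.
    by rewrite es es' mulrCA.
  - by exists (a * b); split; [exists b, a; split=> //; exact: mulrC|rewrite mulf_neq0].
  - have hs : smod (@zid (sr hR)) (@vin _ (up hR (isect R a b)) 1).
      have hIi := idl_up hR hI.
      split=> [u u0 i|u v|e u]; [|exact: vinD|exact: vinZ].
      by rewrite u0; apply: idl0.
    exact: res_pd (syzygy_theorem hNC hn (idl_zid _) mz hzr hs).
  - move=> Q hQ nQx.
    have [d' [hreg' hd']] := regular_localization hreg hQ.
    have [|c [hc hcP]] := IH d' _ _ _ hreg' _ _ (localize_sub hR hQ ha) (localize_sub hR hQ hb).
      by apply: leq_trans dD; apply: hd' => h; apply/nQx/h.
    have [Q0 Q1 QM] := hQ.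
    have /hcP [r [s [hr hs er es]]] : exists t, localize R Q t /\ c = c * t.
      by exists 1; rewrite mulr1; split=> //; apply: sub1; apply: localize_subring.
    exists c; split.
      have [r0 [e [hr0 he ne E]]] := hr; have [s0 [f [hs0 hf nf E']]] := hs.
      have e0 := prime_neq0 hR hQ he ne; have f0 := prime_neq0 hR hQ hf nf.
      exists (e * f); split; [exact: subM|by move=> /(QM _ _ he hf) []|].
      exists (f * r0), (e * s0); split; [exact: subM|exact: subM| |].
        by rewrite er E; field.
      by rewrite es E'; field.
    move=> y [r' [s' [hr' hs' er' es']]]; apply/hcP; exists r', s'.
    by split=> //; apply: localize_sub.
have cR : R c by case: hI => IR _ _ _; apply: IR.
exists c; split=> // y; split; first exact: hc.
by move=> [t [ht ->]]; rewrite mulrC; case: hI => _ _ _ iM; apply: iM.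
Qed.
End Factoriality.

Import Order.TTheory.

(** * Unique factorization, and the valuation of a prime element *)

Section UniqueFactorization.
Variable F : fieldType.
Implicit Types (A B M P V W : F -> Prop).

Lemma gcd_fracs A M : is_subring A -> mult A M -> gcd_prop A -> gcd_prop (fracs A M).
Proof.
move=> hA hM H a b [a0 [c [ha0 hc ea]]] [b0 [e [hb0 he eb]]].
have hB := fracs_subring hA hM; have [MA _ MM _] := hM.
have nz g : M g -> g != 0 by exact: (mult_neq0 hM).
have c0 := nz _ hc; have e0 := nz _ he.
have [g [hg hgP]] := H a0 b0 ha0 hb0.
exists g; split; first exact: (fracs_sub hM).
move=> z; split.
  move=> [r [s [[p [f [hp hf er]]] [q [h [hq hh es]]] zr zs]]].
  have f0 := nz _ hf; have h0 := nz _ hh.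
  have /hgP [t [ht et]] : isect A a0 b0 (c * f * (e * h) * z).
    exists (p * (e * h)), (q * (c * f)); split.
    - by apply: subM => //; apply: subM => //; apply: MA.
    - by apply: subM => //; apply: subM => //; apply: MA.
    - by rewrite zr ea er; field; rewrite ?c0 ?e0 ?f0 ?h0.
    - by rewrite zs eb es; field; rewrite ?c0 ?e0 ?f0 ?h0.
  exists (t / (c * f * (e * h))); split.
    by exists t, (c * f * (e * h)); split=> //; exact: (MM _ _ (MM _ _ hc hf) (MM _ _ he hh)).
  by rewrite mulrA -et; field; rewrite c0 f0 e0 h0.
move=> [t [ht ->]].
have /hgP [r [s [hr hs er es]]] : exists t', A t' /\ g = g * t' by exists 1; rewrite mulr1; split=> //; apply: sub1.
exists (c * r * t), (e * s * t); split.
- by apply: subM => //; apply: (fracs_sub hM); apply: subM => //; apply: MA.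
- by apply: subM => //; apply: (fracs_sub hM); apply: subM => //; apply: MA.
- by rewrite ea er; field.
- by rewrite eb es; field.
Qed.

Section GcdDomain.
Variable A : F -> Prop.
Hypotheses (hN : noetherian A) (hG : gcd_prop A).

Let hA : is_subring A. Proof. by case: hN. Qed.

Lemma unitM a b : is_unit A a -> is_unit A b -> is_unit A (a * b).
Proof.
move=> [ha [a' [ha' ea]]] [hb [b' [hb' eb]]]; split; first exact: subM.
by exists (a' * b'); split; [exact: subM|rewrite mulrACA ea eb mulr1].
Qed.

(** Let c = a c'' be the least common multiple of p and a, and p a = c t, so that p = c'' t. If c''
    is a unit, a is a multiple of c and so of p; if t is a unit, p a divides every common multiple
    of p and a, in particular a b. *)
Lemma irreducible_prime p : irreducible_elt A p -> prime_elt A p.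
Proof.
move=> [hp p0 np irr]; split=> //.
  by move=> [c [hc e]]; apply: np; split=> //; exists c.
move=> a b ha hb [u [hu eu]].
have [->|a0] := eqVneq a 0; first by left; exists 0; rewrite mulr0; split=> //; apply: sub0.
have [c [hc hcP]] := hG hp ha.
have /hcP [t [ht et]] : isect A p a (p * a) by exists a, p; split=> //; exact: mulrC.
have /hcP [c' [c'' [hc' hc'' e' e'']]] : exists t', A t' /\ c = c * t'.
  by exists 1; rewrite mulr1; split=> //; apply: sub1.
have ep : p = c'' * t by apply: (mulIf a0); rewrite et e''; ring.
case: (irr _ _ hc'' ht ep) => [[_ [w [hw cw]]]|[_ [w [hw tw]]]].
  left; exists (c' * w); split; first exact: subM.
  by rewrite mulrA -e' e'' -mulrA cw mulr1.
right; have /hcP [y [hy ey]] : isect A p a (a * b) by exists u, b.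
exists (w * y); split; first exact: subM.
apply: (mulfI a0); rewrite ey e'' {1}ep (_ : c'' * t * (w * y) = c'' * (t * w) * y); last by ring.
by rewrite tw mulr1 mulrA.
Qed.

Lemma irreducible_factorization a : A a -> a != 0 -> ~ is_unit A a ->
  exists s : seq F, (forall y, y \in s -> irreducible_elt A y) /\ a = \prod_(y <- s) y.
Proof.
move=> ha a0 na; apply: contrapT => hno.
pose bad a := [/\ a != 0, ~ is_unit A a &
  ~ exists s : seq F, (forall y, y \in s -> irreducible_elt A y) /\ a = \prod_(y <- s) y].
have [||I [[b [-> [b0 nb hb]]] Imax]] :=
  @noeth_max _ (fun I => exists b : sr hA, I = addg (@zid (sr hA)) b /\ bad (val b)) (noeth_up hA hN).
- by move=> I [b [-> _]]; apply: addg_idl; apply: idl_zid.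
- by exists (addg (@zid _) (mk hA ha)), (mk hA ha).
have bad_div c e : A c -> A e -> val b = c * e -> ~ is_unit A c -> ~ is_unit A e ->
    exists s : seq F, (forall y, y \in s -> irreducible_elt A y) /\ c = \prod_(y <- s) y.
  move=> hc he ebe nc ne; apply: contrapT => h; apply: ne.
  have c0 : c != 0 by apply: contra_neq b0 => c0; rewrite ebe c0 mul0r.
  have : addg (@zid _) b (mk hA hc).
    apply: (Imax (addg (@zid _) (mk hA hc))); last by apply: addg_mem; apply: idl_zid.
      by exists (mk hA hc); split.
    apply: addg_min; [by apply: addg_idl; apply: idl_zid|by apply: addg_sub|].
    exists (mk hA he); apply: val_inj; rewrite valB valM ebe !val_mk mulrC subrr val0 //.
  move=> [g /(congr1 val)]; rewrite valB valM val0 val_mk ebe => /eqP; rewrite subr_eq0 => /eqP e1.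
  split=> //; exists (val g); split; first exact: sr_mem.
  by apply: (mulfI c0); rewrite mulr1 {2}e1; ring.
apply: hb; have [hirr|nirr] := pselect (irreducible_elt A (val b)).
  by exists [:: val b]; split=> [y|]; [rewrite inE => /eqP ->|rewrite big_seq1].
have [c [e [hc he ebe nc ne]]] : exists c e, [/\ A c, A e, val b = c * e, ~ is_unit A c & ~ is_unit A e].
  apply: contrapT => h; apply: nirr; split=> //; first exact: sr_mem.
  move=> c e hc he ebe; apply: contrapT => /not_orP [nc ne]; apply: h; by exists c, e.
have [s1 [h1 e1]] := bad_div c e hc he ebe nc ne.
have [s2 [h2 e2]] := bad_div e c he hc (etrans ebe (mulrC _ _)) ne nc.
exists (s1 ++ s2); split; last by rewrite big_cat /= -e1 -e2.
by move=> y; rewrite mem_cat => /orP [/h1|/h2].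
Qed.

Lemma prime_dvd_prod p (t : seq F) : prime_elt A p -> (forall y, y \in t -> A y) ->
  divides A p (\prod_(y <- t) y) -> exists2 j, (j < size t)%N & divides A p (nth 0 t j).
Proof.
move=> pP; have [_ _ p1 pM] := pP; elim: t => [|y t IH] ht; first by rewrite big_nil => /p1.
rewrite big_cons => /pM [||h|h]; first by apply: ht; rewrite mem_head.
- rewrite big_seq; elim/big_ind: _ => [|u v|u ut]; [exact: sub1|exact: subM|].
  by apply: ht; rewrite inE ut orbT.
- by exists 0%N.
- have [|j jt hj] := IH _ h; first by move=> u ut; apply: ht; rewrite inE ut orbT.
  by exists j.+1.
Qed.

(** The unit u absorbs the cofactor left when a factor of s is cancelled against its associate in
    t. *)
Lemma factorization_unique (s t : seq F) u : is_unit A u ->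
  (forall y, y \in s -> irreducible_elt A y) -> (forall y, y \in t -> irreducible_elt A y) ->
  \prod_(y <- s) y = u * \prod_(y <- t) y ->
  size s = size t /\ exists f : nat -> nat,
    [/\ (forall i, (i < size s)%N -> (f i < size t)%N),
        (forall i j, (i < size s)%N -> (j < size s)%N -> f i = f j -> i = j)
      & (forall i, (i < size s)%N -> associated A (nth 0 s i) (nth 0 t (f i)))].
Proof.
elim: s t u => [|p s IH] t u hu hs ht.
  rewrite big_nil; case: t ht => [|y t] ht e; first by split=> //; exists id.
  have [hy y0 ny _] := ht y (mem_head _ _); case: ny; split=> //.
  exists (u * \prod_(z <- t) z); split; last by rewrite [RHS]e big_cons mulrCA.
  apply: subM => //; first by case: hu.
  rewrite big_seq; elim/big_ind: _ => [|a b|a at_]; [exact: sub1|exact: subM|].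
  by case: (ht a) => //; rewrite inE at_ orbT.
rewrite big_cons => e; have hpi := hs p (mem_head _ _).
have pP := irreducible_prime hpi; have [hp p0 np _] := hpi.
have hs' y : y \in s -> irreducible_elt A y by move=> ys; apply: hs; rewrite inE ys orbT.
have [hu1 [w [hw uw]]] := hu.
have [||j jt [c [hc ec]]] := prime_dvd_prod pP (t := t).
- by move=> y /ht [].
- exists (w * \prod_(y <- s) y); split; last by rewrite mulrCA e mulrA (mulrC w) uw mul1r.
  apply: subM => //; rewrite big_seq; elim/big_ind: _ => [|a b|a /hs' []] //; [exact: sub1|exact: subM].
have [_ tj0 ntj tjirr] := ht _ (mem_nth 0 jt).
have cu : is_unit A c by case: (tjirr p c hp hc ec).
pose t' := take j t ++ drop j.+1 t.
have tE : t = take j t ++ nth 0 t j :: drop j.+1 t by rewrite -drop_nth // cat_take_drop.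
have ht' y : y \in t' -> irreducible_elt A y.
  by rewrite mem_cat => /orP [] h; apply: ht; rewrite tE mem_cat ?h // inE h !orbT.
have [|sz [f [f1 f2 f3]]] := IH t' (u * c) (unitM hu cu) hs' ht'.
  apply: (mulfI p0); rewrite e {1}tE !big_cat big_cons /= ec; ring.
have szt : size t = (size t').+1.
  by rewrite {1}tE !size_cat /= addnS.
have nthE k : nth 0 t (bump j k) = nth 0 t' k.
  rewrite /bump [in LHS]tE !nth_cat size_takel; last exact: ltnW.
  case: (leqP j k) => jk; last by rewrite add0n jk.
  by rewrite add1n ltnNge (leq_trans jk (leqnSn k)) /= subSn //= ltnNge jk.
split; first by rewrite /= sz szt.
(* [bump j] turns indices of t', which lacks entry j, into indices of t. *)
exists (fun i => if i is i'.+1 then bump j (f i') else j); split.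
- case=> [_|i hi]; first exact: jt.
  rewrite szt /bump; case: (leqP j (f i)) => h; rewrite ?add1n ?add0n ltnS; first exact: f1.
  exact/ltnW/f1.
- case=> [|i] [|k] //= hi hk.
  + by move=> h; have := neq_bump j (f k); rewrite -h eqxx.
  + by move=> h; have := neq_bump j (f i); rewrite h eqxx.
  + by move=> /(can_inj (bumpK j)) /f2 ->.
- case=> [|i] hi /=; last by rewrite nthE; apply: f3.
  by exists c; split=> //; rewrite ec mulrC.
Qed.

Lemma gcd_UFD : is_UFD A.
Proof.
split=> //; split; first exact: irreducible_factorization.
move=> s t hs ht e; apply: (@factorization_unique s t 1) => //; last by rewrite mul1r.
by split; [exact: sub1|exists 1; rewrite mulr1; split=> //; apply: sub1].
Qed.

Section PrimeValuation.
Variable p : F.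
Hypotheses (pP : prime_elt A p) (hQ : quotient_field_is A).

Definition divs : F -> Prop := fun z => A z /\ divides A p z.

Lemma divs_prime : is_prime_ideal A divs.
Proof.
have [hp p0 p1 pM] := pP.
split; [split|by case|].
- by move=> z [].
- by split; [exact: sub0|exists 0; rewrite mulr0; split=> //; apply: sub0].
- move=> x y [hx [c [hc ex]]] [hy [e [he ey]]]; split; first exact: subD.
  by exists (c + e); rewrite ex ey mulrDr; split=> //; apply: subD.
- move=> a x ha [hx [c [hc ex]]]; split; first exact: subM.
  by exists (a * c); rewrite ex mulrCA; split=> //; apply: subM.
- by move=> a b ha hb [_ /(pM _ _ ha hb)] [h|h]; [left|right].
Qed.

Definition val_at z (n : int) := exists k l a b, [/\ A a /\ ~ divides A p a, A b /\ ~ divides A p b,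
  z = p ^+ k * a / (p ^+ l * b) & n = k%:Z - l%:Z].

Let nd0 a : ~ divides A p a -> a != 0.
Proof. by apply: contra_not_neq => ->; exists 0; rewrite mulr0; split=> //; apply: sub0. Qed.

Lemma val_at_ex z : z != 0 -> exists n, val_at z n.
Proof.
have [hp p0 p1 _] := pP.
move=> z0; have [a [b [ha hb b0 ez]]] := hQ z.
have a0 : a != 0 by apply: contra_neq z0 => a0; rewrite ez a0 mul0r.
have [k [a' [ha' na' ea]]] := divide_out hN hp p1 p0 ha a0.
have [l [b' [hb' nb' eb]]] := divide_out hN hp p1 p0 hb b0.
by exists (k%:Z - l%:Z), k, l, a', b'; rewrite ez ea eb.
Qed.

Lemma pow_eq k l a b : A a -> A b -> ~ divides A p a -> ~ divides A p b ->
  p ^+ k * a = p ^+ l * b -> k = l.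
Proof.
have [hp p0 p1 _] := pP.
wlog kl : k l a b / (k <= l)%N.
  move=> W ha hb na nb e; have [|/ltnW] := leqP k l => kl; first exact: W e.
  by apply/esym; apply: W kl hb ha nb na (esym e).
move=> ha hb na nb e; case: (ltngtP k l) kl => // lt _; case: na.
exists (p ^+ (l - k.+1) * b); split; first by apply: subM => //; apply: subX.
apply: (mulfI (expf_neq0 k p0)); rewrite e !mulrA -exprSr -exprD subnKC //.
Qed.

Lemma val_at_uniq z n n' : val_at z n -> val_at z n' -> n = n'.
Proof.
have [hp p0 p1 pM] := pP.
move=> [k [l [a [b [[ha na] [hb nb] ez ->]]]]] [k' [l' [a' [b' [[ha' na'] [hb' nb'] ez' ->]]]]].
have b0 := nd0 nb; have b0' := nd0 nb'.
have pl : p ^+ l != 0 by apply: expf_neq0.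
have pl' : p ^+ l' != 0 by apply: expf_neq0.
have nM x y : A x -> A y -> ~ divides A p x -> ~ divides A p y -> ~ divides A p (x * y).
  by move=> hx hy nx ny /(pM _ _ hx hy) [].
have e : p ^+ (k + l') * (a * b') = p ^+ (k' + l) * (a' * b).
  rewrite !exprD; have : p ^+ k * a / (p ^+ l * b) = p ^+ k' * a' / (p ^+ l' * b') by rewrite -ez.
  move/eqP; rewrite eqr_div ?mulf_neq0 // => /eqP e.
  by rewrite mulrACA e; ring.
have /(congr1 Posz) := pow_eq (subM hA ha hb') (subM hA ha' hb) (nM _ _ ha hb' na nb') (nM _ _ ha' hb na' nb) e.
rewrite !PoszD => h; apply/eqP; rewrite subr_eq addrAC eq_sym subr_eq; apply/eqP.
by rewrite h.
Qed.

Lemma prime_DVR : is_DVR (localize A divs).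
Proof.
have [hp p0 p1 pM] := pP.
have nM x y : A x -> A y -> ~ divides A p x -> ~ divides A p y -> ~ divides A p (x * y).
  by move=> hx hy nx ny /(pM _ _ hx hy) [].
have /choice [v hv] : forall z, exists n, z != 0 -> val_at z n.
  move=> z; have [->|z0] := eqVneq z 0; first by exists 0.
  by have [n hn] := val_at_ex z0; exists n.
have vE z n : z != 0 -> val_at z n -> v z = n by move=> /hv h; apply: val_at_uniq.
have vM x y : x != 0 -> y != 0 -> v (x * y) = v x + v y.
  move=> x0 y0; apply: vE; first by rewrite mulf_neq0.
  have [k [l [a [b [[ha na] [hb nb] ex ->]]]]] := hv x x0.
  have [k' [l' [a' [b' [[ha' na'] [hb' nb'] ey ->]]]]] := hv y y0.
  have b0 := nd0 nb; have b0' := nd0 nb'.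
  exists (k + k')%N, (l + l')%N, (a * a'), (b * b'); split.
  - by split; [exact: subM|exact: nM].
  - by split; [exact: subM|exact: nM].
  - by rewrite ex ey !exprD; field; rewrite !expf_neq0 // b0 b0'.
  - by rewrite !PoszD; ring.
have hL := localize_subring hA divs_prime.
have VP z : localize A divs z <-> z = 0 \/ z != 0 /\ 0 <= v z.
  split.
    move=> [a [c [ha hc nc e]]]; have [->|z0] := eqVneq z 0; [by left|right; split=> //].
    have a0 : a != 0 by apply: contra_neq z0 => a0; rewrite e a0 mul0r.
    have [k [a' [ha' na' ea]]] := divide_out hN hp p1 p0 ha a0.
    have nc' : ~ divides A p c by move=> h; apply: nc.
    rewrite (vE z (k%:Z)) //; exists k, 0%N, a', c; split=> //; first by rewrite e ea mul1r.
    by rewrite subr0.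
  case=> [->|[z0 vz]]; first exact: sub0.
  have [k [l [a [b [[ha na] [hb nb] ez e]]]]] := hv z z0.
  have lk : (l <= k)%N by rewrite e subr_ge0 lez_nat in vz.
  exists (p ^+ (k - l) * a), b; split=> //; first by apply: subM => //; apply: subX.
    by case.
  rewrite ez -{1}(subnKC lk) exprD; field; rewrite expf_neq0 // nd0 //.
exists v; split=> //.
- move=> x y x0 y0 xy0.
  have key x1 y1 : x1 != 0 -> y1 != 0 -> x1 + y1 != 0 -> v x1 <= v y1 -> v x1 <= v (x1 + y1).
    move=> x10 y10 xy10 le.
    have q0 : y1 / x1 != 0 by rewrite mulf_neq0 ?invr_eq0.
    have vq : v y1 = v x1 + v (y1 / x1) by rewrite -vM // mulrC divfK.
    have /VP h : y1 / x1 = 0 \/ y1 / x1 != 0 /\ 0 <= v (y1 / x1).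
      by right; split=> //; rewrite vq -lerBlDl subrr in le.
    have E : x1 + y1 = x1 * (1 + y1 / x1) by rewrite mulrDr mulr1 mulrC divfK.
    have s0 : 1 + y1 / x1 != 0 by apply: contra_neq xy10 => s0; rewrite E s0 mulr0.
    have /VP [s0'|[_ h']] : localize A divs (1 + y1 / x1) by apply: subD => //; apply: sub1.
      by rewrite s0' eqxx in s0.
    by rewrite E vM // lerDl.
  by have [le|/ltW le] := lerP (v x) (v y); [left; apply: key|right; rewrite addrC; apply: key => //; rewrite addrC].
- exists p; split=> //; apply: vE => //; exists 1%N, 0%N, 1, 1.
  have h1 := sub1 hA; split=> //; first by rewrite expr0 expr1 !mulr1 divr1.
Qed.
End PrimeValuation.
End GcdDomain.

(** If z in W has negative value, then y / z^k has nonnegative value for k = |v y|, so W would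
    contain every y. *)
Lemma DVR_maximal V W : is_DVR V -> is_subring W -> incl V W -> (exists z, ~ W z) -> incl W V.
Proof.
move=> [v [vM _ _ VP]] hW VW [y ny] z hz; apply: contrapT => nz; apply: ny.
have z0 : z != 0 by apply/eqP => z0; apply: nz; apply/VP; left.
have [->|y0] := eqVneq y 0; first exact: sub0.
have vz : v z < 0.
  by rewrite ltNge; apply/negP => h; apply: nz; apply/VP; right.
have v1 : v 1 = 0.
  by apply: (addrI (v 1)); rewrite -vM ?oner_neq0 // mulr1 addr0.
have vX k x : x != 0 -> v (x ^+ k) = v x *+ k.
  move=> x0; elim: k => [|k IH]; first by rewrite expr0 mulr0n.
  by rewrite exprS vM ?expf_neq0 // IH mulrS.
have vV x : x != 0 -> v x^-1 = - v x.
  by move=> x0; apply/eqP; rewrite -addr_eq0 -vM ?invr_eq0 // mulVf // v1.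
pose k := `|v y|%N.
rewrite -(divfK (expf_neq0 k z0) y); apply: subM => //; last exact: subX.
apply/VW/VP; right; split; first by rewrite mulf_neq0 ?invr_eq0 ?expf_neq0.
rewrite vM ?invr_eq0 ?expf_neq0 // vV ?expf_neq0 // vX //.
have h1 : v z <= -1 by rewrite -ltzD1 addNr.
have h2 : v z *+ k <= - k%:Z by rewrite -[k%:Z]natz -mulNrn; apply: ler_wMn2r.
rewrite subr_ge0; apply: le_trans h2 _; rewrite lerNl /k abszE -normrN; exact: ler_norm.
Qed.
End UniqueFactorization.

(** * Local quadratic transforms *)

Section PolynomialStep.
Variables (F : fieldType) (D D' p0 p0' : F -> Prop) (t : F).
Hypotheses (hD : is_subring D) (hD' : is_subring D').

Definition coefs (c : F -> Prop) (f : {poly F}) := forall i, c f`_i.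

Hypotheses (D'E : forall z, D' z <-> exists f, coefs D f /\ z = f.[t])
  (indep : forall f, coefs D f -> p0' f.[t] -> coefs p0 f)
  (p0'E : forall f, coefs p0 f -> p0' f.[t]) (hp0 : is_prime_ideal D p0).

(** The hypotheses say that D' = D[t] with t transcendental modulo p0', so that D'/p0' is the
    polynomial ring over D/p0; [extp c] is the extension of c to D'. *)
Definition extp (c : F -> Prop) : F -> Prop := fun z => exists f, coefs c f /\ z = f.[t].

Lemma coefs_sub c e f : incl c e -> coefs c f -> coefs e f.
Proof. by move=> ce hf i; apply: ce. Qed.

Lemma coefsD c f g : is_ideal D c -> coefs c f -> coefs c g -> coefs c (f + g).
Proof. by move=> [_ _ cD _] hf hg i; rewrite coefD; apply: cD. Qed.

Lemma coefsN c f : is_ideal D c -> coefs c f -> coefs c (- f).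
Proof.
move=> [cD' _ _ cM] hf i; rewrite coefN -mulN1r; apply: cM => //.
by apply: subN => //; apply: sub1.
Qed.

Lemma coefsM c f g : is_ideal D c -> coefs D f -> coefs c g -> coefs c (f * g).
Proof.
move=> [_ c0 cD cM] hf hg i; rewrite coefM; elim/big_ind: _ => // j _; exact: cM.
Qed.

Lemma ideal_whole : is_ideal D D.
Proof. by split=> //; [exact: sub0|move=> x y; apply: subD|move=> x y; apply: subM]. Qed.

Lemma coefsC c a : is_ideal D c -> c a -> coefs c a%:P.
Proof. by move=> [_ c0 _ _] ha i; rewrite coefC; case: ifP. Qed.

Lemma coefsXn k : coefs D 'X^k.
Proof. by move=> i; rewrite coefXn; case: eqP => _; [exact: sub1|exact: sub0]. Qed.

(** Gauss's argument, on the first coefficients of f and g that lie outside c. *)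
Lemma coefs_prime c f g : is_prime_ideal D c -> coefs D f -> coefs D g -> coefs c (f * g) ->
  coefs c f \/ coefs c g.
Proof.
move=> [[cD c0 cA cM] c1 cP] hf hg hfg; apply: contrapT => /not_orP [nf ng].
have least (h : {poly F}) : ~ coefs c h -> exists i, ~ c h`_i /\ forall j, (j < i)%N -> c h`_j.
  move=> nh; have [i hi] : exists i, ~ c h`_i.
    by apply: contrapT => e; apply: nh => i; apply: contrapT => e'; apply: e; exists i.
  elim/ltn_ind: i hi => i IH hi.
  have [[j [ji hj]]|h'] := pselect (exists j, (j < i)%N /\ ~ c h`_j); first exact: IH hj.
  by exists i; split=> // j ji; apply: contrapT => hj; apply: h'; exists j.
have [i [ni hi]] := least f nf; have [j [nj hj]] := least g ng.
have := hfg (i + j)%N; rewrite coefM.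
have ilt : (i < (i + j).+1)%N by rewrite ltnS leq_addr.
rewrite (bigD1 (Ordinal ilt)) //= addKn => h.
have cN z : c z -> c (- z) by move=> hz; rewrite -mulN1r; apply: cM => //; apply: subN => //; apply: sub1.
have : c (f`_i * g`_j).
  rewrite -(addrK (\sum_(k < (i + j).+1 | k != Ordinal ilt) f`_k * g`_(i + j - k)) (f`_i * g`_j)).
  apply: (cA) => //; apply: (cN); elim/big_ind: _ => [//|x y hx hy|k nk]; first exact: cA.
  case: (ltngtP k i) => [ki|ik|e]; last by case/eqP: nk; apply: val_inj.
    by rewrite mulrC; apply: cM => //; apply: hi.
  apply: cM => //; apply: hj; rewrite ltn_subLR; last by rewrite -ltnS.
  by rewrite ltn_add2r.
by move=> /(cP _ _ (hf i) (hg j)) [].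
Qed.

Lemma coefs0 c : is_ideal D c -> coefs c 0.
Proof. by move=> [_ c0 _ _] i; rewrite coef0. Qed.

Lemma extp_coefs c f : is_ideal D c -> incl p0 c -> coefs D f -> extp c f.[t] -> coefs c f.
Proof.
move=> hc pc hf [g [hg e]].
have gD : coefs D g by case: hc => cD _ _ _; apply: coefs_sub hg.
have h : coefs p0 (f - g).
  apply: indep; first by apply: (coefsD ideal_whole hf); apply: (coefsN ideal_whole).
  rewrite hornerD hornerN e subrr -(horner0 t); apply: p0'E; apply: coefs0; by case: hp0.
rewrite -(subrK g f); apply: (coefsD hc) => //; exact: coefs_sub h.
Qed.

Lemma extp_prime c : is_prime_ideal D c -> incl p0 c -> is_prime_ideal D' (extp c).
Proof.
move=> hc pc; have [ci c1 _] := hc; have [cD c0 _ _] := ci; split; [split|..].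
- by move=> _ [f [hf ->]]; apply/D'E; exists f; split=> //; apply: coefs_sub hf.
- by exists 0; rewrite horner0; split=> //; apply: coefs0.
- move=> _ _ [f [hf ->]] [g [hg ->]]; exists (f + g); rewrite hornerD; split=> //; exact: coefsD.
- move=> _ _ /D'E [f [hf ->]] [g [hg ->]]; exists (f * g); rewrite hornerM; split=> //; exact: coefsM.
- move=> h; apply: c1; have := @extp_coefs c 1%:P ci pc.
  rewrite hornerC => /(_ (coefsC ideal_whole (sub1 hD)) h 0%N); by rewrite coefC eqxx.
- move=> _ _ /D'E [f [hf ->]] /D'E [g [hg ->]]; rewrite -hornerM => /(extp_coefs ci pc) h.
  have [|hc'|hc'] := coefs_prime hc hf hg; first by apply: h; apply: (coefsM ideal_whole).
  + by left; exists f.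
  + by right; exists g.
Qed.

Lemma D_D' : incl D D'.
Proof.
move=> z hz; apply/D'E; exists z%:P; rewrite hornerC; split=> //; exact: (coefsC ideal_whole).
Qed.

Lemma t_D' : D' t.
Proof.
apply/D'E; exists 'X; rewrite hornerX; split=> //; rewrite -['X]expr1; exact: coefsXn.
Qed.

Variable q : F -> Prop.
Hypotheses (hq : is_prime_ideal D' q) (p0q : incl p0' q).
Let qD := fun z => D z /\ q z.

Lemma qD_prime : is_prime_ideal D qD.
Proof.
have [[_ q0 qA qM] q1 qP] := hq; split; [split|by case|].
- by move=> z [].
- by split=> //; apply: sub0.
- by move=> x y [hx ix] [hy iy]; split; [apply: subD|apply: qA].
- by move=> a x ha [hx ix]; split; [apply: subM|apply: qM => //; apply: D_D'].
- by move=> a b ha hb [_ /qP []]; try exact: D_D'; by [left|right].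
Qed.

Lemma p0_qD : incl p0 qD.
Proof.
move=> z hz; have zD : D z by case: hp0 => -[h _ _ _] _ _; apply: h.
split=> //; apply: p0q; rewrite -(hornerC z t); apply: p0'E; apply: coefsC => //; by case: hp0.
Qed.

Lemma extp_p0 : extp p0 = p0'.
Proof.
apply: pred_ext => z; first by move=> [f [hf ->]]; apply: p0'E.
move=> hz; have /D'E [f [hf e]] : D' z by case: hq => -[h _ _ _] _ _; apply/h/p0q.
by exists f; split=> //; apply: indep; rewrite -?e.
Qed.

Lemma extp_qD : incl (extp qD) q.
Proof.
have [[_ q0 qA qM] q1 qP] := hq.
move=> _ [f [hf ->]]; rewrite horner_coef; elim/big_ind: _ => // i _.
rewrite mulrC; apply: qM; last by case: (hf i).
by apply: subX => //; apply: t_D'.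
Qed.

Lemma extp_chain c h : prime_chain D c h -> incl p0 (c 0%N) -> prime_chain D' (fun i => extp (c i)) h.
Proof.
move=> [h1 h2] pc; have pci i : (i <= h)%N -> incl p0 (c i).
  elim: i => [|i IH] // hi; have [h3 _] := h2 i hi.
  by move=> z /(IH (ltnW hi)) /h3.
split=> i hi; first exact: extp_prime (h1 i hi) (pci i hi).
have [h3 h4] := h2 i hi; split; first by move=> _ [f [hf ->]]; exists f; split=> //; apply: coefs_sub hf.
move=> H; apply: h4 => z hz; have [ci1 _ _] := h1 _ hi; have [ci _ _] := h1 i (ltnW hi).
have zD : D z by case: ci1 => cD _ _ _; apply: cD.
have : extp (c i) z%:P.[t].
  apply: H; rewrite hornerC; exists z%:P; rewrite hornerC; split=> //; exact: coefsC ci1 hz.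
by move=> /(extp_coefs ci (pci i (ltnW hi)) (coefsC ideal_whole zD)) /(_ 0%N); rewrite coefC eqxx.
Qed.

Lemma extp_chain_rcons c h : prime_chain D c h -> c 0%N = p0 -> c h = qD -> ~ incl q (extp qD) ->
  exists c', [/\ prime_chain D' c' h.+1, c' 0%N = p0' & c' h.+1 = q].
Proof.
move=> hc c0 ch nq; have [|h1 h2] := @extp_chain c h hc; first by rewrite c0.
exists (fun k => if (k <= h)%N then extp (c k) else q).
split; rewrite ?leq0n ?ltnn ?c0 ?extp_p0 //; split=> k hk; first by case: ifP => // kh; apply: h1.
rewrite ltnS in hk; rewrite hk; case: ifP => [kh|/negbT]; first exact: h2.
rewrite -ltnNge ltnS => hk'; have -> : k = h by apply/eqP; rewrite eqn_leq hk.
by rewrite ch; split=> //; apply: extp_qD.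
Qed.

Lemma extp_chain_same c h : prime_chain D c h -> c 0%N = p0 -> c h = qD -> incl q (extp qD) ->
  exists c', [/\ prime_chain D' c' h, c' 0%N = p0' & c' h = q].
Proof.
move=> hc c0 ch nq; exists (fun k => extp (c k)); rewrite c0 ch extp_p0; split=> //.
  by apply: extp_chain; rewrite ?c0.
by apply: pred_ext => //; apply: extp_qD.
Qed.

Variable R' : F -> Prop.
Hypotheses (hR' : is_subring R') (D'R' : incl D' R') (Rinv : forall z, D' z -> ~ q z -> R' z^-1).

Lemma extp_in I f : is_ideal R' I -> incl qD I -> coefs qD f -> I f.[t].
Proof.
move=> [_ i0 iA iM] qI hf; rewrite horner_coef; elim/big_ind: _ => // i _.
by rewrite mulrC; apply: iM; [apply: subX => //; apply/D'R'/t_D'|apply/qI/hf].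
Qed.

(** If t is in q, then every element of q has its constant coefficient in q. *)
Lemma step_var I : q t -> is_ideal R' I -> I t -> incl qD I -> incl q I.
Proof.
move=> qt hI It qI z hz; have [_ _ iA iM] := hI; have [[qD' q0 qA qM] q1 qP] := hq.
have /D'E [f [hf e]] : D' z by apply: qD'.
have /D'E h0 : exists g, coefs D g /\ \sum_(i < (size f).-1) f`_i.+1 * t ^+ i = g.[t].
  exists (\poly_(i < (size f).-1) f`_i.+1); split.
    by move=> i; rewrite coef_poly; case: ifP => // _; apply: sub0.
  by rewrite horner_poly.
have ez : z = f`_0 + t * \sum_(i < (size f).-1) f`_i.+1 * t ^+ i.
  rewrite e horner_coef; case: (size f) (nth_default 0 (leqnn (size f))) => [->|k _].
    by rewrite !big_ord0 mulr0 addr0.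
  rewrite big_ord_recl expr0 mulr1 big_distrr /=; congr (_ + _).
  by apply: eq_bigr => i _; rewrite /bump /= add1n exprS mulrCA.
have f0q : q f`_0.
  have -> : f`_0 = z + (- \sum_(i < (size f).-1) f`_i.+1 * t ^+ i) * t by rewrite {1}ez mulNr mulrC addrK.
  by apply: qA => //; apply: qM => //; apply: subN.
rewrite ez; apply: iA; first by apply: qI.
by rewrite mulrC; apply: iM => //; apply: D'R'.
Qed.

(** The fibre over [qD] is a polynomial ring over a field, where a nonzero prime has one generator:
    the polynomial f of least degree with value in q that is not in the extension of [qD]. Its
    leading coefficient is outside q, hence invertible in R', so division by f is possible there. *)
Lemma step_general : ~ incl q (extp qD) -> exists f, q f /\
  forall I, is_ideal R' I -> I f -> incl qD I -> incl q I.
Proof.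
move=> nq; have [[qD' q0 qA qM] q1 qP] := hq.
pose Phi (f : {poly F}) := [/\ coefs D f, q f.[t] & ~ coefs qD f].
have [f [Pf fmin]] : exists f, Phi f /\ forall g, Phi g -> (size f <= size g)%N.
  have [f0 P0] : exists f, Phi f.
    apply: contrapT => h; apply: nq => z hz; have /D'E [f [hf e]] : D' z by apply: qD'.
    exists f; split=> //; apply: contrapT => nf; apply: h; exists f; split=> //; by rewrite -e.
  have [N] := ubnP (size f0); elim: N f0 P0 => // N IH f0 P0; rewrite ltnS => le.
  have [[g [Pg lt]]|h] := pselect (exists g, Phi g /\ (size g < size f0)%N).
    by apply: (IH g Pg); apply: leq_trans le.
  exists f0; split=> // g Pg; rewrite leqNgt; apply/negP => lt; apply: h; by exists g.
have [hf qf nf] := Pf.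
have lf0 : (0 < size f)%N.
  rewrite lt0n size_poly_eq0; apply/eqP => f0; apply: nf; rewrite f0; apply: coefs0; by case: qD_prime.
have qDi : is_ideal D qD by case: qD_prime.
have lfn : ~ q (lead_coef f).
  move=> ql; have Dl : D (lead_coef f) by apply: hf.
  pose g := f - (lead_coef f)%:P * 'X^((size f).-1).
  have hgc : coefs qD ((lead_coef f)%:P * 'X^((size f).-1)).
    by rewrite mulrC; apply: coefsM => //; [exact: coefsXn|exact: coefsC].
  have Pg : Phi g.
    split.
    - by apply: (coefsD ideal_whole hf); apply: (coefsN ideal_whole); move=> i; case: (hgc i).
    - rewrite hornerD hornerN; apply: qA => //; rewrite -mulN1r; apply: qM.
        by apply: subN => //; apply: sub1.
      by apply: extp_qD; exists ((lead_coef f)%:P * 'X^((size f).-1)).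
    - by move=> h; apply: nf; rewrite -(subrK ((lead_coef f)%:P * 'X^((size f).-1)) f); apply: coefsD.
  have := fmin g Pg; rewrite leqNgt => /negP; apply.
  rewrite -(prednK lf0) ltnS; apply/leq_sizeP => i hi.
  rewrite coefB coefCM coefXn; move: hi; rewrite leq_eqVlt => /orP [/eqP <-|hi].
    by rewrite eqxx mulr1 subrr.
  by rewrite gtn_eqF // mulr0 subr0 nth_default // -(prednK lf0).
exists f.[t]; split=> // I hI If qI; have [IR i0 iA iM] := hI.
have key : forall N (g : {poly F}), (size g < N)%N -> coefs D g -> q g.[t] -> I g.[t].
  elim=> // N IH g; rewrite ltnS => le hg qg.
  have [gf|fg] := ltnP (size g) (size f).
    apply: extp_in => //; apply: contrapT => ng.
    by have := fmin g (And3 hg qg ng); rewrite leqNgt gf.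
  have lg0 : (0 < size g)%N by apply: leq_trans fg.
  pose k := (size g - size f)%N.
  (* Pseudo-division: the leading terms cancel, and the factor [lead_coef f] is removed afterwards
     in R'. *)
  pose g' := (lead_coef f)%:P * g - (lead_coef g)%:P * 'X^k * f.
  have hlf : D (lead_coef f) by apply: hf.
  have hlg : D (lead_coef g) by apply: hg.
  have Dm a b : coefs D a -> coefs D b -> coefs D (a * b) by apply: (coefsM ideal_whole).
  have Dc a : D a -> coefs D a%:P by apply: (coefsC ideal_whole).
  have E : g'.[t] = lead_coef f * g.[t] - lead_coef g * t ^+ k * f.[t].
    by rewrite /g' hornerD hornerN !hornerM !hornerC hornerXn.
  have hkt : D' (lead_coef g * t ^+ k).
    by apply: subM => //; [exact: D_D'|apply: subX => //; exact: t_D'].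
  have Ig' : I g'.[t].
    apply: IH.
    - apply: leq_trans le; rewrite -(prednK lg0) ltnS; apply/leq_sizeP => i hi.
      rewrite coefB coefCM -mulrA coefCM coefXnM.
      have ki : (k <= i)%N by apply: leq_trans hi; rewrite /k leq_subLR -(prednK lf0) addSnnS prednK // leq_addl.
      rewrite ltnNge ki /=; move: hi; rewrite leq_eqVlt => /orP [/eqP <-|hi].
        have -> : ((size g).-1 - k = (size f).-1)%N.
          by rewrite /k -!subn1 subnAC subKn.
        by rewrite -!lead_coefE mulrC subrr.
      rewrite nth_default ?mulr0; last by rewrite -(prednK lg0).
      rewrite nth_default ?mulr0 ?subr0 // /k; rewrite leq_subRL; last exact: leq_trans ki _.
      by rewrite subnK // -(prednK lg0).
    - apply: (coefsD ideal_whole); first by apply: Dm => //; apply: Dc.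
      apply: (coefsN ideal_whole); apply: (Dm) => //; apply: (Dm); [exact: Dc|exact: coefsXn].
    - rewrite E; apply: qA; first by apply: qM => //; apply: D_D'.
      by rewrite -mulNr; apply: qM => //; apply: subN.
  have -> : g.[t] = (lead_coef f)^-1 * (g'.[t] + lead_coef g * t ^+ k * f.[t]).
    rewrite E subrK mulKf //; apply/eqP => e; apply: lfn; by rewrite e.
  apply: (iM); first by apply: Rinv => //; apply: D_D'.
  by apply: iA => //; apply: iM => //; apply: D'R'.
move=> z hz; have /D'E [g [hg e]] : D' z by apply: qD'.
by rewrite e; apply: (key (size g).+1); rewrite -?e.
Qed.
End PolynomialStep.

(** * The blowup ring, built by adjoining one fraction at a time *)

Section Blowup.
Variables (F : fieldType) (A : F -> Prop) (hA : is_subring A).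
Local Notation C := (sr hA).
Variables (n : C -> Prop) (x : C).
Hypotheses (hn : loc n) (x0 : x != 0).
Implicit Types (u s : seq C) (J : C -> Prop).
Local Notation X := (val x).

Let X0 : X != 0.
Proof. by apply: contra_neq x0 => e; apply: val_inj; rewrite e val0. Qed.

Let Xk k : X ^+ k != 0. Proof. exact: expf_neq0. Qed.

Let valX k : val (x ^+ k) = X ^+ k. Proof. exact: rmorphXn. Qed.

(* gr top u is A[y/x : y in u], and gr n u its ideal generated by n. *)
Definition gr J u : F -> Prop := fun z => exists k a, jpow J (u ++ [:: x]) k a /\ z = val a / X ^+ k.

Definition good_coords u := rrev (u ++ [:: x]) /\ forall y, y \in u ++ [:: x] -> n y.

Lemma good_coords_behead y u : good_coords (y :: u) -> good_coords u.
Proof. by move=> [[_ h1] h2]; split=> // z hz; apply: h2; rewrite inE hz orbT. Qed.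

Lemma good_coords_x u : good_coords u -> n x.
Proof. by move=> [_]; apply; rewrite mem_cat mem_head orbT. Qed.

Lemma xpow_mem u k : jpow (@top C) (u ++ [:: x]) k (x ^+ k).
Proof.
elim: k => [|k IH]; first by rewrite jpow0.
by rewrite exprS; apply: jpow_mem => //; rewrite mem_cat mem_head orbT.
Qed.

Lemma x_notin u : good_coords u -> ~ jpow n (u ++ [:: x]) 1 x.
Proof.
elim: u => [|y u IH] hu.
  move=> [z0 [z' [e0 hz' e]]]; rewrite e0 add0r in e.
  have [hi n1 _] := hn; apply: n1; rewrite (_ : 1 = z') //.
  apply: val_inj; apply: (mulfI X0); rewrite val1 mulr1 -valM -e //.
move=> h; have hu' := good_coords_behead hu; have [hu1 hu2] := hu; apply: (IH hu').
have := @rrev_cancel _ n y (u ++ [:: x]) 0 x 0 hu1 (loc_idl hn) hu2.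
rewrite mulr0 addr0 => /(_ _ h) [] //; have := xpow_mem u 1; by rewrite expr1.
Qed.

Lemma good_coords_val u i j a b : good_coords u -> jpow (@top C) (u ++ [:: x]) i a -> jpow (@top C) (u ++ [:: x]) j b ->
  jpow n (u ++ [:: x]) (i + j) (a * b) -> jpow n (u ++ [:: x]) i a \/ jpow n (u ++ [:: x]) j b.
Proof. move=> [h1 h2]; exact: rrev_valuation h1 (loc_prm hn) h2. Qed.

Lemma xpow_notin u k : good_coords u -> ~ jpow n (u ++ [:: x]) k (x ^+ k).
Proof.
move=> hu; elim: k => [|k IH]; first by rewrite jpow0 expr0; case: hn.
rewrite exprS -add1n => h.
have hx : jpow (@top C) (u ++ [:: x]) 1 x by have := xpow_mem u 1; rewrite expr1.
by case: (good_coords_val hu hx (xpow_mem u k) h) => // /x_notin; apply.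
Qed.

Lemma cancel_xpow u k l a : good_coords u -> jpow (@top C) (u ++ [:: x]) k a ->
  jpow n (u ++ [:: x]) (k + l) (a * x ^+ l) -> jpow n (u ++ [:: x]) k a.
Proof. by move=> hu ha /(good_coords_val hu ha (xpow_mem u l)) [] // /xpow_notin; case. Qed.

(** Membership does not depend on the fraction chosen: x lies outside n I for I = (u, x), and the
    graded ring is a domain, so powers of x can be cancelled. *)
Lemma grE u k a : good_coords u -> jpow (@top C) (u ++ [:: x]) k a -> gr n u (val a / X ^+ k) ->
  jpow n (u ++ [:: x]) k a.
Proof.
move=> hu ha [l [c [hc e]]]; apply: (@cancel_xpow u k l) => //.
have -> : a * x ^+ l = x ^+ k * c.
  by apply: val_inj; rewrite !valM !valX mulrC [RHS]mulrC; apply/eqP; rewrite mulrC -eqr_div // e.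
by rewrite addnC; apply: jpow_mul => //; apply: xpow_mem.
Qed.

Lemma gr_frac J u k a : jpow J (u ++ [:: x]) k a -> gr J u (val a / X ^+ k).
Proof. by move=> h; exists k, a. Qed.

Lemma gr_raise J u k l a : idl J -> jpow J (u ++ [:: x]) k a ->
  jpow J (u ++ [:: x]) (k + l) (x ^+ l * a) /\ val (x ^+ l * a) / X ^+ (k + l) = val a / X ^+ k.
Proof.
move=> hJ ha; split; first by apply: jpow_mul => //; apply: xpow_mem.
by rewrite valM valX exprD; field; rewrite !Xk.
Qed.

Lemma gr_add J u y z : idl J -> gr J u y -> gr J u z -> gr J u (y + z).
Proof.
move=> hJ [k [a [ha ->]]] [l [b [hb ->]]].
have [h1 <-] := gr_raise l hJ ha; have [h2 <-] := gr_raise k hJ hb.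
rewrite (addnC l) in h2 *; rewrite -mulrDl -valD; apply: gr_frac; apply: idlD => //; exact: jpow_idl.
Qed.

Lemma gr_mul J u y z : idl J -> gr (@top C) u y -> gr J u z -> gr J u (y * z).
Proof.
move=> hJ [k [a [ha ->]]] [l [b [hb ->]]].
have -> : val a / X ^+ k * (val b / X ^+ l) = val (a * b) / X ^+ (l + k).
  by rewrite valM exprD; field; rewrite !Xk.
by apply: gr_frac; apply: jpow_mul.
Qed.

Lemma gr_A J u a : J a -> gr J u (val a).
Proof. by move=> ha; exists 0%N, a; rewrite jpow0 divr1. Qed.

Lemma gr_subring u : is_subring (gr (@top C) u).
Proof.
have ht : idl (@top C) := idl_top C.
split.
- by rewrite -(val0 hA); apply: gr_A.
- by rewrite -(val1 hA); apply: gr_A.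
- move=> y z hy hz; apply: gr_add => //; rewrite -mulN1r; apply: gr_mul => //.
  by rewrite (_ : -1 = val (-1 : C)); [apply: gr_A|rewrite -[-1]sub0r -[-1 in RHS]sub0r valB val0 val1].
- by move=> y z; apply: gr_mul.
Qed.

Lemma gr_sub J u : incl (gr J u) (gr (@top C) u).
Proof. by move=> z [k [a [ha ->]]]; exists k, a; split=> //; apply: jpow_mono ha. Qed.

Lemma gr_prime u : good_coords u -> is_prime_ideal (gr (@top C) u) (gr n u).
Proof.
move=> hu; have hi := loc_idl hn; split; [split|..].
- exact: gr_sub.
- by rewrite -(val0 hA); apply: gr_A; apply: idl0.
- by move=> y z; apply: gr_add.
- by move=> y z; apply: gr_mul.
- move=> h; have [_ n1 _] := hn; apply: n1; rewrite -(jpow0 n (u ++ [:: x])); apply: grE => //.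
  + by rewrite jpow0.
  + by rewrite divr1 val1.
- move=> _ _ [k [a [ha ->]]] [l [b [hb ->]]].
  have -> : val a / X ^+ k * (val b / X ^+ l) = val (a * b) / X ^+ (k + l).
    by rewrite valM exprD; field; rewrite !Xk.
  move=> /grE h; have /(good_coords_val hu ha hb) : jpow n (u ++ [:: x]) (k + l) (a * b).
    by apply: h => //; rewrite addnC; apply: jpow_mul => //; apply: idl_top.
  by case=> h'; [left|right]; apply: gr_frac.
Qed.

Lemma gr_cons J y u : idl J -> incl (gr J u) (gr J (y :: u)).
Proof. by move=> hJ z [k [a [ha ->]]]; exists k, a; split=> //; apply: jpow_cons. Qed.

Lemma gr_quot y u : y \in u ++ [:: x] -> gr (@top C) u (val y / X).
Proof.
move=> yu; exists 1%N, y; rewrite expr1; split=> //.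
by rewrite -[y]mulr1; apply: jpow_mem => //; rewrite jpow0.
Qed.

Lemma jpow_expand J y s k a : jpow J (y :: s) k a -> exists z : nat -> C,
  (forall i, (i <= k)%N -> jpow J s (k - i) (z i)) /\ a = \sum_(i < k.+1) z i * y ^+ i.
Proof.
elim: k a => [|k IH] a.
  rewrite jpow0 => ha; exists (fun=> a); rewrite big_ord_recl big_ord0 addr0 mulr1; split=> // i _.
  by rewrite sub0n jpow0.
move=> /jpowS [z0 [z' [h0 /IH [z [hz ->]] ->]]].
exists (fun i => if i is i'.+1 then z i' else z0); split; first by case.
rewrite [RHS]big_ord_recl mulr1 big_distrr /=; congr (_ + _); apply: eq_bigr => i _.
by rewrite /bump /= add1n exprS mulrCA.
Qed.

Lemma jpow_collect J y s k (z : nat -> C) : idl J -> (forall i, (i <= k)%N -> jpow J s (k - i) (z i)) ->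
  jpow J (y :: s) k (\sum_(i < k.+1) z i * y ^+ i).
Proof.
move=> hJ; elim: k z => [|k IH] z hz.
  by rewrite big_ord_recl big_ord0 addr0 mulr1; have := hz 0%N (leqnn _); rewrite !jpow0.
apply/jpowS; exists (z 0%N), (\sum_(i < k.+1) z i.+1 * y ^+ i); split.
- exact: (hz 0%N).
- by apply: (IH (z \o S)) => i hi; rewrite /= -subSS; apply: hz.
- rewrite big_ord_recl mulr1 big_distrr /=; congr (_ + _); apply: eq_bigr => i _.
  by rewrite /bump /= add1n exprS mulrCA.
Qed.

Lemma gr_poly y u z : gr (@top C) (y :: u) z <->
  exists f, coefs (gr (@top C) u) f /\ z = f.[val y / X].
Proof.
have hB := gr_subring (y :: u); split.
  move=> [k [a [/jpow_expand [w [hw ->]] ->]]].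
  exists (\poly_(i < k.+1) (val (w i) / X ^+ (k - i))); split.
    move=> i; rewrite coef_poly ltnS; case: ifP => hi; last by apply: sub0; apply: gr_subring.
    by apply: gr_frac; apply: hw.
  rewrite horner_poly (_ : val (\sum_i _) = \sum_(i < k.+1) val (w i * y ^+ i)); last exact: rmorph_sum.
  rewrite mulr_suml; apply: eq_bigr => i _.
  have ik : (i <= k)%N by rewrite -ltnS.
  rewrite valM (_ : val (y ^+ i) = val y ^+ i); last exact: rmorphXn.
  have -> : X ^+ k = X ^+ (k - i) * X ^+ i by rewrite -exprD subnK.
  by rewrite exprMn exprVn; field; rewrite !Xk.
move=> [f [hf ->]]; rewrite horner_coef; apply: sub_sum => // i; apply: subM => //.
  by apply: gr_cons; [exact: idl_top|exact: hf].
by apply: subX => //; apply: gr_quot; rewrite mem_head.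
Qed.

Lemma gr_n_poly y u f : good_coords (y :: u) -> coefs (gr n u) f -> gr n (y :: u) f.[val y / X].
Proof.
move=> hu hf; have [[_ i0 iA iM] _ _] := gr_prime hu.
rewrite horner_coef; elim/big_ind: _ => // i _; rewrite mulrC; apply: iM.
  by apply: subX; [exact: gr_subring|apply: gr_quot; rewrite mem_head].
by apply: gr_cons; [exact: loc_idl|exact: hf].
Qed.

(** y/x is transcendental modulo the ideal generated by n: after denominators are cleared, a
    polynomial relation becomes a form in y over the remaining coordinates, whose coefficients
    [rrev_coef] reads off. *)
Lemma gr_indep y u f : good_coords (y :: u) -> coefs (gr (@top C) u) f -> gr n (y :: u) f.[val y / X] ->
  coefs (gr n u) f.
Proof.
move=> hyu hf hn'; have hu := good_coords_behead hyu; have ht : idl (@top C) := idl_top C.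
have hi := loc_idl hn.
have [k [a ha]] : exists k (a : nat -> C), forall i, jpow (@top C) (u ++ [:: x]) k (a i) /\ f`_i = val (a i) / X ^+ k.
  have : exists k, forall i, (i < size f)%N -> exists a, jpow (@top C) (u ++ [:: x]) k a /\ f`_i = val a / X ^+ k.
    elim: (size f) => [|N [k hk]]; first by exists 0%N.
    have [l [b [hb eb]]] := hf N; exists (k + l)%N => i; rewrite ltnS leq_eqVlt => /orP [/eqP ->|/hk [c [hc ec]]].
      have [h1 h2] := gr_raise k ht hb; exists (x ^+ k * b); rewrite addnC; split=> //; by rewrite h2.
    have [h1 h2] := gr_raise l ht hc; exists (x ^+ l * c); split=> //; by rewrite h2.
  move=> [k hk]; exists k.
  suff /choice [a ha] : forall i, exists a, jpow (@top C) (u ++ [:: x]) k a /\ f`_i = val a / X ^+ k by exists a.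
  move=> i; have [/hk //|hi'] := ltnP i (size f); exists 0; rewrite val0 mul0r nth_default //; split=> //.
  by apply: idl0; apply: jpow_idl.
(* x^k is a common denominator of the coefficients; a factor x^(N - i) on the i-th one makes all
   terms homogeneous of degree k + N. Coefficients beyond the degree of f are 0. *)
pose N := size f; pose M := (k + N)%N.
pose z i := if (i <= N)%N then a i * x ^+ (N - i) else 0.
have hz i : (i <= M)%N -> jpow (@top C) (u ++ [:: x]) (M - i) (z i).
  move=> _; rewrite /z; case: leqP => iN; last by apply: idl0; apply: jpow_idl.
  rewrite /M -addnBA // mulrC; apply: jpow_mul => //; last exact: xpow_mem.
  by case: (ha i).
have key : jpow n (y :: (u ++ [:: x])) M (\sum_(i < M.+1) z i * y ^+ i).
  apply: (@grE (y :: u)) => //; first exact: jpow_collect.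
  rewrite (_ : _ / _ = f.[val y / X]) //.
  rewrite (_ : val (\sum_i _) = \sum_(i < M.+1) val (z i * y ^+ i)); last exact: rmorph_sum.
  rewrite mulr_suml (@horner_coef_wide _ M.+1); last by rewrite leqW // leq_addl.
  apply: eq_bigr => i _; rewrite valM (_ : val (y ^+ i) = val y ^+ i); last exact: rmorphXn.
  have [_ ->] := ha i; rewrite /z; case: leqP => iN.
    rewrite valM valX (_ : X ^+ M = X ^+ k * (X ^+ (N - i) * X ^+ i)); last by rewrite -exprD subnK // -exprD.
    by rewrite exprMn exprVn; field; rewrite !Xk.
  have : f`_i = 0 by rewrite nth_default // ltnW.
  case: (ha i) => _ -> => e; rewrite val0 !mul0r e mul0r //.
have [h1 h2] := hyu; move=> i; have := rrev_coef h1 hi h2 hz key.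
have gn0 : gr n u 0 by case: (gr_prime hu) => -[].
have [iN|iN] := leqP i N; last by move=> _; rewrite nth_default; [exact: gn0|exact: ltnW].
move=> /(_ i (leq_trans iN (leq_addl _ _))); rewrite /z iN /M -addnBA //.
have [h3 ->] := ha i; move=> /(cancel_xpow hu h3) h4; exact: gr_frac.
Qed.

Lemma gr_nil J z : idl J -> gr J [::] z <-> exists a, J a /\ z = val a.
Proof.
move=> hJ; split; last by move=> [a [ha ->]]; apply: gr_A.
move=> [k [a [ha ->]]]; elim: k a ha => [|k IH] a; first by rewrite jpow0 => ha; exists a; rewrite divr1.
move=> /jpowS [z0 [z' [e0 /IH hz' ->]]]; rewrite e0 add0r valM exprS.
by rewrite (_ : _ / _ = val z' / X ^+ k) //; field; rewrite Xk.
Qed.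
End Blowup.

(** * Regular systems of parameters after a quadratic transform *)

Section QuadraticTransform.
Variable F : fieldType.
Implicit Types (A B R m P : F -> Prop).

(* e is part of a regular system of parameters. *)
Definition rsp A m d (e : seq F) := exists f, size (e ++ f) = d /\ set_eq m (ideal_gen A (in_seq (e ++ f))).

(** Steinitz exchange modulo n: as Q contains J and n times J + (f), an element x outside Q has a
    unit coefficient on some member of f, which it can replace. *)
Lemma exchange (C : comNzRingType) (n J Q : C -> Prop) (f : seq C) (x : C) : loc n -> idl J -> idl Q -> incl J Q ->
  (forall a y, n a -> igen J f y -> Q (a * y)) -> igen J f x -> ~ Q x ->
  exists f', size f = (size f').+1 /\ igen J f = igen J (x :: f').
Proof.
move=> hn hJ hQ JQ; elim: f x => [|y f IH] x nQ; first by move=> /JQ.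
move=> [c hg] nx; have hI := igen_idl f hJ.
have yI : igen J (y :: f) y by apply: addg_mem.
have fI t z : igen J f z -> igen J (t :: f) z by apply: addg_sub.
have [hc|nc] := pselect (n c).
  have [||f' [sf fE]] := IH (x - c * y) _ hg.
  - by move=> a z ha hz; apply: nQ => //; apply: fI.
  - move=> h; apply: nx; apply: (idlBr hQ h); exact: nQ.
  exists (y :: f'); split; first by rewrite /= sf.
  have h1 : idl (igen J (x :: y :: f')) by apply: igen_idl.
  have h2 : idl (igen J (y :: f)) by apply: igen_idl.
  have hg' : igen J (x :: y :: f') (x - c * y).
    apply: idlB => //; first by apply: igen_mem => //; rewrite mem_head.
    by apply: idlM => //; apply: igen_mem => //; rewrite !inE eqxx orbT.
  have f'f z : z \in f' -> igen J f z by move=> hz; rewrite fE; apply: igen_mem => //; rewrite inE hz orbT.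
  have H : incl (igen J f) (igen J (x :: y :: f')).
    rewrite fE; apply: igen_min => //; first exact: igen_sub.
    move=> z; rewrite inE => /orP [/eqP -> //|hz].
    by apply: igen_mem => //; rewrite !inE hz !orbT.
  apply: pred_ext.
    by apply: addg_min => //; apply: igen_mem => //; rewrite !inE eqxx orbT.
  apply: igen_min => //; first exact: igen_sub.
  move=> z; rewrite !inE => /orP [/eqP ->|/orP [/eqP -> //|/f'f]]; last exact: fI.
  by exists c.
have [b cb] : exists b, c * b = 1 by case: hn => _ _; apply.
exists f; split=> //; apply: pred_ext; apply: addg_min => //; try exact: addg_idl; try exact: addg_sub.
  have -> : y = b * (x - (x - c * y)) by rewrite subKr mulrA (mulrC b) cb mul1r.
  apply: idlM; first exact: addg_idl.
  by apply: idlB; [exact: addg_idl|exact: addg_mem|exact: fI].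
by exists c.
Qed.

Section Setup.
Variables (A m : F -> Prop) (hA : is_subring A).
Local Notation C := (sr hA).
Local Notation n := (up hA m).
Variables (x : C) (ys : seq C).
Local Notation X := (val x).
Hypotheses (hl : local_ring A m) (hN : noetherian A) (ms : n = igen (@zid C) (ys ++ [:: x])) (hok : good_coords n x ys)
  (x0 : x != 0).
Let hn : loc n := loc_up hA hl.
Let ht : idl (@top C) := idl_top C.
Local Notation B := (gr x (@top C) ys).

Let X0 : X != 0.
Proof. by apply: contra_neq x0 => e; apply: val_inj; rewrite e val0. Qed.

Lemma blowup_gr : blowup A m X = B.
Proof.
apply: pred_ext => z.
  apply; [exact: gr_subring|by move=> a ha; rewrite -[a](val_mk hA ha); apply: gr_A|].
  move=> a ha; have aA : A a by case: hl => _ [h _ _ _] _ _; apply: h.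
  have : n (mk hA aA) by []; rewrite ms => h; exists 1%N, (mk hA aA); rewrite expr1; split=> //.
  rewrite -[mk hA aA]mulr1; apply: jpow_mul_gen => //; by rewrite jpow0.
move=> [k [a [ha ->]]] R hR AR mR.
have hXR : R X^-1 -> R X^-1 by [].
move: ha; suff H u : {subset u <= ys ++ [:: x]} -> forall k a, jpow (@top C) u k a -> R (val a / X ^+ k).
  by apply: H.
elim: u => [|y u IHu] us {}k {}a; case: k => [|k].
- by rewrite divr1 => _; apply: AR; apply: sr_mem.
- by move=> ->; rewrite val0 mul0r; apply: sub0.
- by rewrite divr1 => _; apply: AR; apply: sr_mem.
have {}IHu : forall k a, jpow (@top C) u k a -> R (val a / X ^+ k).
  by apply: IHu => w hw; apply: us; rewrite inE hw orbT.
have yR : R (val y / X).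
  apply: mR; rewrite -[m _]/(n y) ms; apply: igen_mem; [exact: idl_zid|by apply: us; rewrite mem_head].
elim: k a => [|k IH] a /jpowS [z0 [z' [h0 h' ->]]]; rewrite valD mulrDl valM; apply: subD => //; try exact: IHu.
  by rewrite expr1 mulrAC; apply: subM => //; apply: AR; apply: sr_mem.
rewrite exprS (_ : _ / _ = val y / X * (val z' / X ^+ k.+1)); first by apply: subM => //; exact: IH.
by rewrite exprS; field; rewrite X0 expf_neq0.
Qed.

Let hB : is_subring B := gr_subring x0 ys.

(** The maximal ideal becomes principal in the blowup ring, since each generator y is X times
    y/X. *)
Lemma grn_x z : gr x n ys z <-> exists w, B w /\ z = X * w.
Proof.
split.
  move=> [k [a [ha ->]]]; exists (val a / X ^+ k.+1); split; last by rewrite exprS; field; rewrite X0 expf_neq0.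
  apply: gr_frac; apply: jpow_unshift; by rewrite -ms.
move=> [_ [[k [a [ha ->]]] ->]]; exists k, (x * a); rewrite valM mulrA; split=> //.
by apply: jpow_scale => //; exact: (good_coords_x hok).
Qed.

Lemma m_grn : incl m (gr x n ys).
Proof.
move=> a ha; have aA : A a by case: hl => _ [h _ _ _] _ _; apply: h.
by rewrite -(val_mk hA aA); apply: gr_A.
Qed.

Lemma gr_suffix J v u : idl J -> incl (gr x J u) (gr x J (v ++ u)).
Proof. by move=> hJ; elim: v => [|y v IH] z //= /IH; apply: gr_cons. Qed.

Section Center.
Variable q : F -> Prop.
Hypotheses (hq : is_prime_ideal B q) (mq : incl m q).
Local Notation R' := (localize B q).

Let hR' : is_subring R' := localize_subring hB hq.

Lemma X_q : q X.
Proof. by apply: mq; rewrite -[m _]/(n x); apply: (good_coords_x hok). Qed.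

Lemma grn_q : incl (gr x n ys) q.
Proof.
move=> _ /grn_x [w [hw ->]]; rewrite mulrC; case: hq => -[_ _ _ qM] _ _; apply: qM => //; exact: X_q.
Qed.

Definition qat u : F -> Prop := fun z => gr x (@top C) u z /\ q z.

(* The invariant of the induction that adjoins the fractions y/x one at a time: a chain of size g primes from the
   ideal generated by n up to the contraction of q, which x and g generate locally at q. *)
Definition center_gens u (g : seq F) := (forall y, y \in g -> q y) /\
  (exists c, [/\ prime_chain (gr x (@top C) u) c (size g), c 0%N = gr x n u & c (size g) = qat u]) /\
  forall I, is_ideal R' I -> I X -> (forall y, y \in g -> I y) -> incl (qat u) I.

Lemma center_nil : center_gens [::] [::].
Proof.
have hi := loc_idl hn.
have E : qat [::] = gr x n [::].
  apply: pred_ext => z.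
    move=> [/(gr_nil x0 _ ht) [a [_ ->]] qa]; apply: gr_A.
    have hnq : ~ up hA q 1 by rewrite /up val1; case: hq.
    apply: (@loc_max _ n (up hA q) hn) => //.
    have [[_ q0 qA qM] _ _] := hq; split; [by rewrite /up val0|by move=> b c; rewrite /up valD; apply: qA|].
    by move=> b c; rewrite /up valM; apply: qM; apply: gr_A.
  move=> /(gr_nil x0 _ hi) [a [ha ->]]; split; [exact: gr_A|exact: mq].
split=> //; split.
  exists (fun=> gr x n [::]); split=> //; split=> // k _.
  apply: gr_prime => //; move: hok; elim: (ys) => // y u IH /good_coords_behead; exact: IH.
move=> I [_ _ _ iM] IX _; rewrite E => z /(gr_nil x0 _ hi) [a [ha ->]].
have /grn_x [w [hw ->]] := m_grn ha.
by rewrite mulrC; apply: iM => //; apply: (localize_sub hB hq).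
Qed.

Section Step.
Variables (v : seq C) (y : C) (u : seq C).
Hypothesis (ysE : ys = v ++ y :: u).

Let hyu : good_coords n x (y :: u).
Proof. by have := hok; rewrite ysE; elim: (v) => //= z w IH /good_coords_behead; exact: IH. Qed.

Let hu : good_coords n x u := good_coords_behead hyu.
Let yuB : incl (gr x (@top C) (y :: u)) B.
Proof. by rewrite ysE; apply: gr_suffix. Qed.

Let hD : is_subring (gr x (@top C) u) := gr_subring x0 u.
Let hD' : is_subring (gr x (@top C) (y :: u)) := gr_subring x0 (y :: u).
Let DE := gr_poly x0 y u.
Let ind := fun f => @gr_indep _ _ _ _ _ hn x0 y u f hyu.
Let p0E := fun f => @gr_n_poly _ _ _ _ _ hn x0 y u f hyu.
Let hp0 := gr_prime hn x0 hu.

Let hq' : is_prime_ideal (gr x (@top C) (y :: u)) (qat (y :: u)).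
Proof.
have [[_ q0 qA qM] q1 qP] := hq; split; [split|by case|].
- by move=> z [].
- by split=> //; apply: sub0.
- by move=> a b [ha qa] [hb qb]; split; [apply: subD|apply: qA].
- by move=> a b ha [hb qb]; split; [apply: subM|apply: qM => //; apply: yuB].
- by move=> a b ha hb [_ /qP [||h|h]]; try exact: yuB; [left|right].
Qed.

Let p0q : incl (gr x n (y :: u)) (qat (y :: u)).
Proof.
move=> z hz; split; first exact: gr_sub hz.
apply: grn_q; rewrite ysE; apply: gr_suffix => //; exact: loc_idl.
Qed.

Let qE : (fun z => gr x (@top C) u z /\ qat (y :: u) z) = qat u.
Proof.
apply: pred_ext => z; first by move=> [h1 [_ h2]].
by move=> [h1 h2]; split=> //; split=> //; apply: gr_cons.
Qed.

Let DR : incl (gr x (@top C) (y :: u)) R'.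
Proof. by move=> z /yuB; apply: (localize_sub hB hq). Qed.

Let Rinv z : gr x (@top C) (y :: u) z -> ~ qat (y :: u) z -> R' z^-1.
Proof.
move=> hz nz; exists 1, z; rewrite mul1r; split=> //; [exact: sub1|exact: yuB|].
by move=> h; apply: nz.
Qed.

(** A fraction y/X that lies in q is itself the new generator; this keeps strict transforms among
    the parameters. *)
Lemma center_var g : q (val y / X) -> center_gens u g -> center_gens (y :: u) (val y / X :: g).
Proof.
move=> qy [gq [[c [hc c0 ch]] gI]]; split; first by move=> z; rewrite inE => /orP [/eqP ->|/gq].
have qat_y : qat (y :: u) (val y / X) by split=> //; apply: gr_quot; rewrite mem_head.
split.
  apply: (extp_chain_rcons hD hD' DE ind p0E hp0 hq' p0q hc c0); rewrite qE // => h.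
  have [[_ q0 qA qM] q1 qP] := hq.
  (* y/X is in q but not in the extension of its contraction, because the polynomial that represents
     it has coefficient 1; so the chain of primes grows. *)
  have hX : coefs (gr x (@top C) u) 'X by rewrite -['X]expr1; apply: coefsXn.
  have pq : incl (gr x n u) (qat u).
    by move=> z hz; rewrite -qE; apply: (p0_qD p0E hp0 p0q).
  have hqu : is_prime_ideal (gr x (@top C) u) (qat u) by rewrite -qE; apply: (qD_prime hD DE hq').
  have := @extp_coefs _ _ _ _ _ hD ind p0E hp0 (qat u) 'X _ pq hX.
  rewrite hornerX => /(_ _ (h _ qat_y) 1%N); rewrite coefX eqxx => -[|_ //]; by case: hqu.
move=> I hI IX Ig; apply: (step_var hD hD' DE hq' DR qat_y hI); first by apply: Ig; rewrite mem_head.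
by rewrite qE; apply: gI => // z zg; apply: Ig; rewrite inE zg orbT.
Qed.

(** A general fraction contributes one generator or none, according to whether q is larger than the
    extension of its contraction. *)
Lemma center_step g : center_gens u g ->
  center_gens (y :: u) g \/ exists f, center_gens (y :: u) (f :: g).
Proof.
move=> [gq [[c [hc c0 ch]] gI]].
have [h|nh] := pselect (incl (qat (y :: u)) (extp (val y / X) (qat u))).
  left; split=> //; split.
    by apply: (extp_chain_same hD hD' DE ind p0E hp0 hq' p0q hc c0); rewrite qE.
  move=> I hI IX Ig z /h [f [hf ->]].
  apply: (extp_in hD DE hR' DR hI _ hf); exact: (gI I hI IX Ig).
right; rewrite -qE in nh.
have [f [qf fI]] := step_general hD hD' DE hq' hR' DR Rinv nh.
exists f; split; first by move=> z; rewrite inE => /orP [/eqP ->|/gq //]; case: qf.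
split.
  apply: (extp_chain_rcons hD hD' DE ind p0E hp0 hq' p0q hc c0); by rewrite -?qE // qE ch.
move=> I hI IX Ig; apply: fI => //; first by apply: Ig; rewrite mem_head.
by rewrite qE; apply: gI => // z zg; apply: Ig; rewrite inE zg orbT.
Qed.
End Step.
End Center.
End Setup.
End QuadraticTransform.

Section LocalizedPrimes.
Variables (F : fieldType) (A Q : F -> Prop) (hA : is_subring A) (hQ : is_prime_ideal A Q).

Definition extend (P : F -> Prop) : F -> Prop := fun z => exists p c, [/\ P p, A c, ~ Q c & z = p / c].

Lemma extend_num P a c : is_prime_ideal A P -> incl P Q -> A a -> A c -> ~ Q c -> extend P (a / c) -> P a.
Proof.
move=> [[PA _ _ pM] p1 pP] PQ ha hc nc [p [e [hp he ne E]]].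
have c0 := prime_neq0 hA hQ hc nc; have e0 := prime_neq0 hA hQ he ne.
have : P (a * e).
  have -> : a * e = c * p by apply/eqP; rewrite mulrC [c * _]mulrC; move/eqP: E; rewrite eqr_div // mulrC.
  exact: pM.
by case/(pP _ _ ha he) => // /PQ.
Qed.

Lemma extend_prime P : is_prime_ideal A P -> incl P Q -> is_prime_ideal (localize A Q) (extend P).
Proof.
move=> hP PQ; have [[PA p0 pD pM] p1 pP] := hP; have [_ _ qP] := hQ.
have nz c : A c -> ~ Q c -> c != 0 := prime_neq0 hA hQ (c := c).
have nM a b : A a -> A b -> ~ Q a -> ~ Q b -> ~ Q (a * b) by move=> ha hb na nb /(qP _ _ ha hb) [].
have Q1 : ~ Q 1 by case: hQ.
split; [split|..].
- by move=> _ [p [c [hp hc nc ->]]]; exists p, c; split=> //; apply: PA.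
- by exists 0, 1; rewrite mul0r; split=> //; apply: sub1.
- move=> _ _ [p [c [hp hc nc ->]]] [r [e [hr he ne ->]]]; exists (e * p + c * r), (c * e); split.
  + by apply: pD; apply: pM.
  + exact: subM.
  + exact: nM.
  + by field; rewrite !nz.
- move=> _ _ [a [c [ha hc nc ->]]] [r [e [hr he ne ->]]]; exists (a * r), (c * e); split.
  + exact: pM.
  + exact: subM.
  + exact: nM.
  + by field; rewrite !nz.
- by move=> h; apply: p1; apply: (@extend_num P 1 1) => //; rewrite ?divr1 //; apply: sub1.
- move=> _ _ [a [c [ha hc nc ->]]] [b [e [hb he ne ->]]] h.
  have : P (a * b).
    apply: (@extend_num P _ (c * e)) => //; [exact: subM|exact: subM|exact: nM|].
    by rewrite -mulf_div.
  by case/(pP _ _ ha hb) => h'; [left; exists a, c|right; exists b, e].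
Qed.

Lemma extend_chain c h : prime_chain A c h -> incl (c h) Q ->
  prime_chain (localize A Q) (fun i => extend (c i)) h.
Proof.
move=> [h1 h2] cQ.
have ciQ i : (i <= h)%N -> incl (c i) Q.
  move=> hi; rewrite -(subKn hi); elim: (h - i)%N (leq_subr i h) => [|j IH] hj; first by rewrite subn0.
  have hlt : (h - j.+1 < h)%N by rewrite subnS prednK ?subn_gt0 ?leq_subr // (leq_trans _ (leq_subr _ _)) //.
  have [h3 _] := h2 _ hlt; move=> z /h3; rewrite subnS prednK ?subn_gt0 //; apply: IH; exact: ltnW.
split=> i hi; first by apply: extend_prime; [exact: h1|exact: ciQ].
have [h3 h4] := h2 i hi; split; first by move=> _ [p [e [hp he ne ->]]]; exists p, e; split=> //; apply: h3.
have Q1 : ~ Q 1 by case: hQ.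
move=> H; apply: h4 => z hz; have zA : A z by case: (h1 _ hi) => -[cA _ _ _] _ _; apply: cA.
apply: (@extend_num (c i) z 1) => //; [exact: h1 (ltnW hi)|exact: ciQ (ltnW hi)|exact: sub1|].
by apply: H; exists z, 1; rewrite divr1; split=> //; apply: sub1.
Qed.
End LocalizedPrimes.

Section BlowupFacts.
Variables (F : fieldType) (A m : F -> Prop) (X : F).

Lemma blowup_subring : is_subring A -> is_subring (blowup A m X).
Proof.
move=> hA; split.
- by move=> B [h0 _ _ _].
- by move=> B [_ h1 _ _].
- by move=> x y hx hy B hB AB mB; have [_ _ hs _] := hB; apply: hs; [apply: hx|apply: hy].
- by move=> x y hx hy B hB AB mB; have [_ _ _ hs] := hB; apply: hs; [apply: hx|apply: hy].
Qed.

Lemma blowup_sub : incl A (blowup A m X).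
Proof. by move=> z hz B _ AB _; apply: AB. Qed.

Lemma blowup_quot a : m a -> blowup A m X (a / X).
Proof. by move=> ha B _ _ mB; apply: mB. Qed.
End BlowupFacts.

Lemma max_uniq (F : fieldType) (A m m' : F -> Prop) : local_ring A m -> local_ring A m' -> m = m'.
Proof.
move=> [hA hm m1 hu] [_ hm' m1' hu'].
have key (I J : F -> Prop) : is_ideal A I -> ~ I 1 -> (forall a, A a -> ~ J a -> is_unit A a) -> incl I J.
  move=> [IA _ _ iM] I1 h a ha; apply: contrapT => na; apply: I1.
  by have [_ [b [hb <-]]] := h a (IA _ ha) na; rewrite mulrC; apply: iM.
by apply: pred_ext; apply: key.
Qed.

Section QuadraticTransformResult.
Variables (F : fieldType) (A m : F -> Prop) (d : nat) (X : F) (q R' m' : F -> Prop) (d' : nat).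
Hypotheses (hreg : regular_local A m d) (mX : m X) (X0 : X != 0).
Local Notation B := (blowup A m X).
Hypotheses (hq : is_prime_ideal B q) (mq : incl m q) (hR' : R' = localize B q) (hreg' : regular_local R' m' d').

Let hA : is_subring A. Proof. by case: hreg => -[]. Qed.
Let hl : local_ring A m. Proof. by case: hreg. Qed.
Let mA : incl m A. Proof. by case: hl => _ []. Qed.
Let hB : is_subring B := blowup_subring m X hA.
Let BR : incl B R'. Proof. by rewrite hR'; apply: localize_sub. Qed.
Let hRs : is_subring R'. Proof. by case: hreg' => -[]. Qed.
Let m'E : m' = localize_max B q.
Proof. by apply: (@max_uniq _ R'); [case: hreg'|rewrite hR'; exact: localize_local]. Qed.

Lemma qt_m'q z : B z -> m' z -> q z.
Proof.
rewrite m'E => hz h; apply: (localize_max_num (c := 1) hB hq) => //; rewrite ?divr1 //; [exact: sub1|by case: hq].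
Qed.

Lemma qt_qm' z : q z -> m' z.
Proof. by rewrite m'E => h; exists z, 1; rewrite divr1; split=> //; [exact: sub1|case: hq]. Qed.

Lemma qt_sub : incl A R'.
Proof. by move=> z hz; apply: BR; apply: blowup_sub. Qed.

Lemma qt_max_sub : incl m m'.
Proof. by move=> z hz; apply/qt_qm'/mq. Qed.

Lemma qt_divides a : m a -> divides R' X a.
Proof.
move=> ha; exists (a / X); split; first by apply: BR; apply: blowup_quot.
by rewrite mulrC divfK.
Qed.

(** The elements w of m with w/X in q form an ideal that contains e and m^2 but not X. So X can be
    exchanged for one of the other parameters, and e survives among the coordinates of the
    blowup. *)
Lemma qt_gens e : rsp A m d e -> (forall y, y \in e -> m' (y / X)) ->
  exists (x : sr hA) es f, [/\ val x = X, map val es = e, good_coords (up hA m) x (f ++ es), size (f ++ es) = d.-1 /\ (0 < d)%N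
    & up hA m = igen (@zid (sr hA)) ((f ++ es) ++ [:: x])].
Proof.
move=> [f [sf mf]] hm'; have [z [zd mz hz]] := regular_up hA hreg.
have [t [et mt]] := ideal_gen_lift hA mA mf.
have hn := loc_up hA hl; have hi := loc_idl hn.
pose es := take (size e) t; pose fs := drop (size e) t.
have te : t = es ++ fs by rewrite cat_take_drop.
have esE : map val es = e by rewrite map_take et take_size_cat.
have fsE : map val fs = f by rewrite map_drop et drop_size_cat.
pose x : sr hA := mk hA (mA mX).
have vx : val x = X by apply: val_mk.
pose Q w := up hA m w /\ q (val w / X).
have [[qB q0 qD qM] q1 qP] := hq.
have hQ : idl Q.
  split; first by split; [exact: (idl0 hi)|rewrite val0 mul0r].
    by move=> a b [ha qa] [hb qb]; split; [exact: (idlD hi)|rewrite valD mulrDl; apply: qD].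
  move=> a b [hb qb]; split; first exact: idlM.
  by rewrite valM -mulrA; apply: (qM) => //; apply: blowup_sub; apply: sr_mem.
have mE : up hA m = igen (igen (@zid _) es) fs.
  rewrite mt te -igen_cat; apply: igen_eqmem; [exact: idl_zid|by move=> w; rewrite !mem_cat orbC].
have esQ : forall y, y \in es -> Q y.
  move=> y hy; split; first by rewrite mt te; apply: igen_mem; [exact: idl_zid|rewrite mem_cat hy].
  have ye : val y \in e by rewrite -esE map_f.
  apply: qt_m'q; last exact: hm'.
  apply: blowup_quot; rewrite -[m _]/(up hA m y) mt te; apply: igen_mem; [exact: idl_zid|by rewrite mem_cat hy].
have [|||||f' [sf' fE]] := @exchange _ (up hA m) (igen (@zid _) es) Q fs x hn _ hQ.
- by apply: igen_idl; apply: idl_zid.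
- apply: igen_min => //; exact: zid_incl.
- move=> a y ha; rewrite -mE => hy; split; first exact: idlM.
  by rewrite valM -mulrA mulrC; apply: qM; [exact: blowup_quot|exact: mq].
- by rewrite -mE /up vx.
- by move=> [_]; rewrite vx divff.
have sz : size (f' ++ es) = d.-1.
  by rewrite -sf size_cat -esE -fsE !size_cat !size_map sf' addnS addnC.
have d0 : (0 < d)%N by rewrite -sf size_cat -fsE size_map sf' addnS.
have mE' : up hA m = igen (@zid _) ((f' ++ es) ++ [:: x]).
  rewrite mE fE -igen_cat; apply: igen_eqmem; [exact: idl_zid|].
  by move=> w; rewrite !(mem_cat, inE) [RHS]orbC orbA.
exists x, es, f'; split=> //; split.
  by have [|//] := hz ((f' ++ es) ++ [:: x]) _ mE'; rewrite size_cat sz addn1 prednK.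
by move=> y hy; rewrite mE'; apply: igen_mem => //; apply: idl_zid.
Qed.

Section Coordinates.
Variables (x : sr hA) (us : seq (sr hA)).
Local Notation n := (up hA m).
Hypotheses (xX : val x = X) (hok : good_coords n x us) (ms : n = igen (@zid (sr hA)) (us ++ [:: x])).

Let x0 : x != 0.
Proof. by apply: contra_neq X0 => e; rewrite -xX e val0. Qed.

Let BE : B = gr x (@top _) us.
Proof. by rewrite -xX; apply: blowup_gr. Qed.

Let hn : loc n := loc_up hA hl.

Let p := gr x n us.

Let pX z : p z <-> exists w, B w /\ z = X * w.
Proof. by rewrite BE -xX; apply: grn_x. Qed.

Let p_prime : is_prime_ideal B p.
Proof. by rewrite BE; apply: gr_prime. Qed.

Let pq : incl p q.
Proof. by move=> z /pX [w [hw ->]]; rewrite mulrC; case: hq => -[_ _ _ qM] _ _; apply: qM => //; apply: mq. Qed.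

Lemma coord_divides z : B z -> divides R' X z -> p z.
Proof.
move=> hz [c]; rewrite hR' => -[[b [e [hb he ne ->]]] ez].
have [_ p1 pP] := p_prime.
have : p (z * e).
  apply/pX; exists b; split=> //; rewrite ez -mulrA divfK //; exact: (prime_neq0 hB hq).
by move=> /(pP _ _ hz he) [] // /pq.
Qed.

Lemma coord_prime : prime_elt R' X.
Proof.
have [_ p1 pP] := p_prime; have [_ q1 qP] := hq.
have XB : B X by apply: blowup_sub; apply: mA.
split=> //; first exact: BR.
  by move=> /(coord_divides (sub1 hB)).
move=> a0 b0; rewrite {1 2}hR' => -[a [c [ha hc nc ->]]] [b [e [hb he ne ->]]] [w [hw ew]] {a0 b0}.
have c0 := prime_neq0 hB hq hc nc; have e0 := prime_neq0 hB hq he ne.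
have key u v : B u -> B v -> ~ q v -> p u -> divides R' X (u / v).
  move=> hu hv nv /pX [t [ht ->]]; exists (t / v); rewrite mulrA; split=> //.
  by rewrite hR'; exists t, v.
have : p (a * b).
  apply: coord_divides; first exact: (subM hB ha hb).
  exists (w * (c * e)); split; first by apply: (subM hRs hw); apply: BR; exact: (subM hB hc he).
  rewrite mulrA -ew; by field; rewrite c0 e0.
by move=> /(pP _ _ ha hb) [] h; [left|right]; apply: key.
Qed.

(** This identifies the order in A with the exponent of X in R'. If b is in m^k and b/X^k is
    divisible by X in R', then b/X^k is in the prime XB, so b is in m m^k. *)
Lemma coord_pow k a : A a -> ideal_pow A m k a <-> divides R' (X ^+ k) a.
Proof.
move=> ha; rewrite -(val_mk hA ha); move: (mk hA ha) => b {a ha}.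
have hm : is_ideal A m by case: hl.
rewrite (ideal_powP k b hm ms); have vX j : val x ^+ j = X ^+ j by rewrite xX.
split.
  move=> /gr_frac; rewrite -BE xX => h; exists (val b / X ^+ k); split; first exact: BR.
  by rewrite mulrC divfK // expf_neq0.
elim: k => [|k IH]; first by rewrite jpow0.
move=> [c [hc ec]].
have h : jpow (@top _) (us ++ [:: x]) k b.
  apply: IH; exists (X * c); split; first by apply: subM => //; apply: BR; apply: blowup_sub; apply: mA.
  by rewrite mulrA -exprSr.
apply: jpow_unshift; rewrite -ms; apply: (grE hn x0) => //; apply: coord_divides.
  by rewrite BE; apply: gr_frac.
exists c; split=> //; rewrite ec xX exprS; field; by rewrite expf_neq0.
Qed.

Lemma coord_frac z : R' z -> exists b c l u, [/\ A b, A c, z = b / c, c != 0 & c = X ^+ l * u /\ is_unit R' u].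
Proof.
move=> hz; have [b0 [e [hb he ne ->]]] : localize B q z by rewrite -hR'.
have e0 := prime_neq0 hB hq he ne.
have := hb; have := he; rewrite BE => -[j [g [_ eg]]] [i [b [_ ->]]].
have g0 : val g != 0 by apply: contra_neq e0 => g0; rewrite eg g0 mul0r.
exists (val b * X ^+ j), (val g * X ^+ i), (i + j)%N, e.
have AX k : A (X ^+ k) by apply: subX => //; apply: mA.
split; first by apply: subM => //; apply: sr_mem.
- by apply: subM => //; apply: sr_mem.
- rewrite eg xX; field; by rewrite !expf_neq0 // g0.
- by rewrite mulf_neq0 // expf_neq0.
- split; first by rewrite eg xX exprD; field; rewrite expf_neq0.
  split; first exact: BR.
  exists e^-1; rewrite divff //; split=> //; rewrite hR'; exists 1, e; rewrite mul1r; split=> //; exact: sub1.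
Qed.

Lemma coord_order_val : order_val_ring A m = localize R' (divs R' X).
Proof.
have [Xp _ X1 XP] := coord_prime; have hN' : noetherian R' by case: hreg'.
have Ru u : is_unit R' u -> R' u by case.
apply: pred_ext => z.
  move=> [a [b [ha hb b0 -> hab]]].
  have [k [b' [hb' nb' eb]]] := divide_out hN' Xp X1 X0 (qt_sub hb) b0.
  have [a' [ha' ea]] : divides R' (X ^+ k) a.
    by apply/(coord_pow _ ha); apply: hab; apply/(coord_pow _ hb); exists b'.
  exists a', b'; split=> //; first by move=> [].
  have b'0 : b' != 0 by apply: contra_neq b0 => e; rewrite eb e mulr0.
  by rewrite ea eb; field; rewrite expf_neq0 // b'0.
move=> [a [b [ha hb nb ->]]].
have {}nb : ~ divides R' X b by move=> h; apply: nb.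
have b0 : b != 0 by apply/eqP => e; apply: nb; exists 0; rewrite mulr0; split=> //; apply: sub0.
have [a1 [c1 [l1 [u1 [ha1 hc1 ea c10 [ec1 hu1]]]]]] := coord_frac ha.
have [a2 [c2 [l2 [u2 [ha2 hc2 eb c20 [ec2 hu2]]]]]] := coord_frac hb.
have a20 : a2 != 0 by apply: contra_neq b0 => e; rewrite eb e mul0r.
exists (a1 * c2), (a2 * c1); split; try exact: subM.
- by rewrite mulf_neq0.
- by rewrite ea eb; field; rewrite c10 c20 a20.
- move=> k /(coord_pow _ (subM hA ha2 hc1)) [w [hw ew]]; apply/(coord_pow _ (subM hA ha1 hc2)).
  have E : X ^+ (l1 + l2) * (u1 * u2) = c1 * c2 by rewrite exprD mulrACA -ec1 -ec2.
  have eac : a1 * c2 = a * X ^+ (l1 + l2) * (u1 * u2) by rewrite -mulrA E ea; field.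
  have ebc : a2 * c1 = b * X ^+ (l1 + l2) * (u1 * u2) by rewrite -mulrA E eb; field.
  have [_ [v1 [hv1 e1]]] := hu1; have [_ [v2 [hv2 e2]]] := hu2.
  have [s' [hs' es']] : exists s', R' s' /\ X ^+ (l1 + l2) = X ^+ k * s'.
    apply: (@prime_pow_dvd _ R' X k b _ (w * (v1 * v2))) => //.
    - exact: subX.
    - by apply: subM => //; apply: subM.
    - by rewrite mulrA -ew ebc -mulrA (mulrACA u1) e1 e2 !mulr1.
  exists (a * s' * (u1 * u2)); split.
  by apply: (subM hRs (subM hRs ha hs')); apply: (subM hRs); apply: Ru.
  by rewrite eac es'; ring.
Qed.
End Coordinates.

(** The members y of e give the generators y/X, and each further coordinate gives at most one,
    whence d' <= d. There are exactly d' - 1 generators besides X: together with X they generate m',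
    and the primes attached to them, extended to R' and preceded by 0, form a chain of the same
    length. *)
Lemma qt_rsp e : rsp A m d e -> (forall y, y \in e -> m' (y / X)) ->
  (d' <= d)%N /\ rsp R' m' d' (X :: map (fun y => y / X) e).
Proof.
move=> he em'; have [x [es [f [xX ese hok [sz d0] ms]]]] := qt_gens he em'.
have x0 : x != 0 by apply: contra_neq X0 => e0; rewrite -xX e0 val0.
set us := f ++ es in hok sz ms.
have BE : B = gr x (@top _) us by rewrite -xX; apply: blowup_gr.
have hqg : is_prime_ideal (gr x (@top _) us) q by rewrite -BE.
have H1 w u : es = w ++ u -> center_gens m x us q u [seq val y / val x | y <- u].
  elim: u w => [|y u IH] w esE; first exact: (center_nil hl ms hok x0 hqg mq).
  apply: (center_var hl ms hok x0 hqg mq (v := f ++ w)); first by rewrite /us esE catA.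
    rewrite xX; apply: qt_m'q; last by apply: em'; rewrite -ese map_f // esE mem_cat mem_head orbT.
    apply: blowup_quot; rewrite -[m _]/(up hA m y) ms; apply: igen_mem; first exact: idl_zid.
    by rewrite /us esE !mem_cat mem_head !orbT.
  by apply: (IH (rcons w y)); rewrite cat_rcons.
have H2 w u : f = w ++ u -> exists g, (size g <= size u)%N /\
    center_gens m x us q (u ++ es) (g ++ [seq val y / val x | y <- es]).
  elim: u w => [|y u IH] w fE; first by exists [::]; split=> //; apply: (H1 [::]).
  have [|g [sg hg]] := IH (rcons w y); first by rewrite cat_rcons.
  have [|h|[a h]] := center_step hl ms hok x0 hqg mq (v := w) (y := y) (u := u ++ es) _ hg.
  - by rewrite /us fE -catA.
  - by exists g; split=> //; apply: leqW.
  - by exists (a :: g).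
have [g [sg []]] := H2 [::] f erefl; rewrite -/us.
have -> : [seq val y / val x | y <- es] = [seq y / X | y <- e] by rewrite -ese -map_comp xX.
set G := _ ++ _ => Gq [[c [hc c0 ch]] gI].
have {}gI I : is_ideal R' I -> I X -> (forall y, y \in G -> I y) -> incl q I.
  rewrite hR' BE -xX => h1 h2 h3 z hz; apply: (gI I h1 h2 h3); split=> //.
  by case: hqg => -[qB _ _ _] _ _; apply: qB.
have mid : is_ideal R' m' by case: hreg' => -[].
have XGm y : y \in X :: G -> m' y by rewrite inE => /orP [/eqP ->|/Gq]; [apply: qt_max_sub|apply: qt_qm'].
have m'gen s : s =i X :: G -> set_eq m' (ideal_gen R' (in_seq s)).
  move=> sG z; split; last by apply; [|move=> y hy; apply: XGm; rewrite -sG].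
  rewrite m'E => -[p [b [hp hb nb ->]]] I hI sI.
  have [IR _ _ iM] := hI; rewrite mulrC; apply: iM.
    by rewrite hR'; exists 1, b; rewrite mul1r; split=> //; exact: sub1.
  by apply: (gI I hI) => // [|y hy]; apply: sI; rewrite /in_seq sG inE ?eqxx ?hy ?orbT.
have ch' : c (size G) = q.
  rewrite ch; apply: pred_ext => z; [by case|split=> //].
  by case: hqg => -[qB _ _ _] _ _; apply: qB.
have chain' : prime_chain R' (fun k => if k is k'.+1 then extend B q (c k') else (fun z => z = 0)) (size G).+1.
  have hcB : prime_chain B c (size G) by rewrite BE.
  have [|h1 h2] := extend_chain hB hq hcB; first by rewrite ch'.
  rewrite -hR' in h1; split=> -[|k] hk.
  - split; [split=> //|exact/eqP/oner_neq0|].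
    + by move=> z ->; apply: sub0.
    + by move=> a b -> ->; rewrite addr0.
    + by move=> a b _ ->; rewrite mulr0.
    + by move=> a b _ _ /eqP; rewrite mulf_eq0 => /orP [] /eqP; [left|right].
  - exact: h1.
  - split; first by move=> z ->; case: (h1 0%N isT) => -[].
    move=> h; move/eqP: X0; apply; apply: h; exists X, 1; rewrite divr1 c0.
    by split; [exact: m_grn|exact: sub1|case: hq|].
  - exact: h2.
have m'R : incl m' R' by case: mid.
have hG : (size G).+1 = d'.
  apply/eqP; rewrite eqn_leq; apply/andP; split.
    have [s [sd ms' _]] := regular_up hRs hreg'; rewrite -sd.
    exact: (chain_le_dim hreg' ms' chain').
  have [t [et mt]] := ideal_gen_lift hRs m'R (m'gen (X :: G) (fun=> erefl)).
  have [_ _ [[c' hc'] _] _] := hreg'.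
  by have := chain_le_dim hreg' mt hc'; rewrite -(size_map val t) et.
have sG : size G = (size g + size e)%N by rewrite size_cat size_map.
split.
  rewrite -hG sG -(prednK d0) ltnS -sz /us size_cat -(size_map val es) ese.
  by rewrite leq_add2r.
exists g; split; first by rewrite /= size_cat size_map -hG sG addnC.
apply: m'gen => z; by rewrite cat_cons !(inE, mem_cat) [_ || (z \in g)]orbC.
Qed.
End QuadraticTransformResult.

(** * One step of the sequence, and how it moves a divisor *)

Section Steps.
Variable F : fieldType.
Implicit Types (A m V W : F -> Prop).

(** The interface between one transform and the study of the sequence; the blowup ring and its prime
    q no longer appear. *)
Record qt_step A m d X A' m' d' : Prop := QTStep {
  step_reg : regular_local A m d;
  step_reg' : regular_local A' m' d';
  step_mX : m X;
  step_sub : incl A A';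
  step_max : incl m m';
  step_div : forall a, m a -> divides A' X a;
  step_prime : prime_elt A' X;
  step_val : order_val_ring A m = localize A' (divs A' X);
  step_frac : forall z, A' z -> exists b c l u,
    [/\ A b, A c, z = b / c, c != 0 & c = X ^+ l * u /\ is_unit A' u];
  step_rsp : forall e, rsp A m d e -> (forall y, y \in e -> m' (y / X)) ->
    (d' <= d)%N /\ rsp A' m' d' (X :: map (fun y => y / X) e) }.

Lemma rsp_nil A m d : regular_local A m d -> rsp A m d [::].
Proof. by move=> [_ _ _ [s [hs ms]]]; exists s. Qed.

Lemma qt_step_ex A m d A' m' d' : regular_local A m d -> regular_local A' m' d' ->
  local_quadratic_transform A m A' -> exists X, qt_step A m d X A' m' d'.
Proof.
move=> hreg hreg' [X [mX nX [q [hq mq eA']]]]; exists X.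
have [hl hN _ _] := hreg; have [hA hm _ _] := hl.
have {}eA' : A' = localize (blowup A m X) q by apply: pred_ext => z /eA'.
have X0 : X != 0.
  by apply/eqP => X0; apply: nX; rewrite X0 => I [_ I0 _ _] _.
have [x [es [f [xX _ hok _ ms]]]] := qt_gens hreg mX X0 hq mq eA' hreg' (rsp_nil hreg) (fun y h => False_ind _ (notF h)).
split=> //.
- exact: qt_sub hreg hq eA'.
- exact: (qt_max_sub hreg hq mq eA' hreg').
- exact: (qt_divides hreg X0 hq eA').
- exact: (coord_prime mX X0 hq mq eA' hreg' xX hok ms).
- exact: (coord_order_val mX X0 hq mq eA' hreg' xX hok ms).
- exact: (coord_frac mX X0 hq eA' xX ms).
- exact: (qt_rsp hreg mX X0 hq mq eA' hreg').
Qed.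

Section SystemsOfGenerators.
Variables (A m : F -> Prop) (d : nat).
Hypothesis hreg : regular_local A m d.

Let hA : is_subring A. Proof. by case: hreg => -[]. Qed.
Let hm : is_ideal A m. Proof. by case: hreg => -[]. Qed.
Let mA : incl m A. Proof. by case: hm. Qed.

Lemma gens_mem s y : set_eq m (ideal_gen A (in_seq s)) -> y \in s -> m y.
Proof. by move=> ms ys; apply/ms => I _; apply. Qed.

Lemma gens_ext s t : s =i t -> set_eq m (ideal_gen A (in_seq s)) -> set_eq m (ideal_gen A (in_seq t)).
Proof.
move=> st; suff -> : in_seq s = in_seq t by [].
by apply: pred_ext => z; rewrite /in_seq st.
Qed.

Lemma gens_dim s : set_eq m (ideal_gen A (in_seq s)) -> (d <= size s)%N.
Proof.
move=> ms; have [t [et mt]] := ideal_gen_lift hA mA ms.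
have [_ _ [[c hc] _] _] := hreg.
by have := chain_le_dim hreg mt hc; rewrite -(size_map val t) et.
Qed.

Lemma rsp_mem e y : rsp A m d e -> y \in e -> m y.
Proof. by move=> [f [_ hf]] ye; apply: (gens_mem hf); rewrite mem_cat ye. Qed.

Lemma rsp_swap p r l : rsp A m d (p :: r :: l) -> rsp A m d (r :: p :: l).
Proof.
move=> [f [sf hf]]; exists f; split=> //; apply: gens_ext hf => z.
by rewrite !cat_cons !inE orbCA.
Qed.

Lemma rsp_behead p l : rsp A m d (p :: l) -> rsp A m d l.
Proof.
move=> [f [sf hf]]; exists (p :: f); split; first by rewrite -sf !size_cat /= addnS.
by apply: gens_ext hf => z; rewrite cat_cons !(inE, mem_cat) orbCA.
Qed.

(** Otherwise r could be omitted, leaving fewer than d generators of m. *)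
Lemma rsp_ndvd p r l : rsp A m d (p :: r :: l) -> ~ divides A p r.
Proof.
move=> [f [sf hf]] [c [hc ec]]; suff /gens_dim : set_eq m (ideal_gen A (in_seq (p :: l ++ f))).
  by rewrite -sf /= ltnn.
move=> z; split; last first.
  apply; [exact: hm|move=> y]; rewrite /in_seq inE => /orP [/eqP ->|hy]; apply: (gens_mem hf).
    by rewrite mem_head.
  by rewrite !cat_cons !inE hy !orbT.
move=> /hf h I hI sI; apply: h => // y; rewrite /in_seq !cat_cons !inE => /orP [/eqP ->|/orP [/eqP ->|hy]].
- by apply: sI; rewrite /in_seq mem_head.
- have [_ _ _ iM] := hI; rewrite ec mulrC; apply: iM => //; apply: sI; by rewrite /in_seq mem_head.
- by apply: sI; rewrite /in_seq inE hy orbT.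
Qed.

Lemma max_not_principal p : (1 < d)%N -> m p -> exists y, m y /\ ~ divides A p y.
Proof.
move=> d2 mp; apply: contrapT => h; suff /gens_dim : set_eq m (ideal_gen A (in_seq [:: p])).
  by rewrite leqNgt d2.
move=> z; split; last by apply; [exact: hm|move=> y]; rewrite /in_seq inE => /eqP ->.
move=> mz I hI sI; have [c [hc ->]] : divides A p z by apply: contrapT => nz; apply: h; exists z.
by have [_ _ _ iM] := hI; rewrite mulrC; apply: iM => //; apply: sI; rewrite /in_seq mem_head.
Qed.

(** The remaining parameters form a regular sequence modulo p that generates the maximal ideal, so
    (p) is prime. *)
Lemma rsp_prime p l : rsp A m d (p :: l) -> prime_elt A p.
Proof.
move=> hr; have mp : m p by apply: (rsp_mem hr); rewrite mem_head.
have [f [sf hf]] := hr; have [t [et mt]] := ideal_gen_lift hA mA hf.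
have [z [sz mz hz]] := regular_up hA hreg.
have [|hs _] := hz t _ mt; first by rewrite -sf -(size_map val t) et.
case: t et mt hs => [//|p' t] [ep _] mt; have [hl hN _ _] := hreg.
have hn := loc_up hA hl => hs.
have {}ep : val p' = p by [].
have z0 := idl_zid (sr hA).
have zp : prm (@zid (sr hA)) by apply: (rseq_prm (noeth_up hA hN) hn z0 mt hs).
have pp : prm (addg (@zid (sr hA)) p').
  case: hs => _ hs; apply: (rseq_prm (noeth_up hA hN) hn (addg_idl p' z0) _ hs).
  by rewrite igen_addg.
have dvd a (ha : A a) : divides A p a <-> addg (@zid (sr hA)) p' (mk hA ha).
  split.
    move=> [c [hc ec]]; exists (mk hA hc); apply/eqP; rewrite subr_eq0; apply/eqP.
    by apply: val_inj; rewrite valM !val_mk ec ep mulrC.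
  move=> [c /eqP]; rewrite subr_eq0 => /eqP/(congr1 val); rewrite val_mk valM => ->.
  by exists (val c); rewrite ep mulrC; split=> //; apply: sr_mem.
have [_ p1 pM] := pp; split; first exact: mA.
- apply/eqP => e0; case: hs => /(_ 1) h1 _; case: zp => _ n1 _; apply: n1; apply: h1.
  by apply: val_inj; rewrite valM ep e0 mul0r val0.
- move=> /(dvd _ (sub1 hA)) h'; apply: p1; suff <- : mk hA (sub1 hA) = 1 by [].
  by apply: val_inj; rewrite val1 val_mk.
- move=> a b ha hb /(dvd _ (subM hA ha hb)).
  have -> : mk hA (subM hA ha hb) = mk hA ha * mk hA hb by apply: val_inj; rewrite valM !val_mk.
  by case/pM => h'; [left|right]; apply/dvd; exact: h'.
Qed.
Lemma max_nonunit a : m a -> A a^-1 -> a != 0 -> False.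
Proof.
have [[_ [_ _ _ mM] m1 _] _ _ _] := hreg.
by move=> ma a' a0; apply: m1; rewrite -(mulVf a0); apply: mM.
Qed.

Lemma nonmax_unit a : A a -> ~ m a -> A a^-1.
Proof.
have [[_ _ _ hu] _ _ _] := hreg; move=> ha na; have [_ [b [hb ab]]] := hu a ha na.
have a0 : a != 0 by apply: contra_neq (@oner_neq0 F) => e; rewrite -ab e mul0r.
by rewrite -[a^-1]mulr1 -ab mulKf.
Qed.
End SystemsOfGenerators.

Lemma quotient_field_incl A A' : incl A A' -> quotient_field_is A -> quotient_field_is A'.
Proof. by move=> AA hA z; have [a [b [ha hb b0 ->]]] := hA z; exists a, b; split=> //; apply: AA. Qed.

Lemma localize_divs_inv A p z : is_subring A -> A z -> ~ divides A p z -> localize A (divs A p) z^-1.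
Proof. by move=> hA hz nz; exists 1, z; rewrite mul1r; split=> //; [exact: sub1|case]. Qed.

Lemma localize_divsP A p a b : is_subring A -> prime_elt A p -> A a -> A b -> b != 0 ->
  localize A (divs A p) (a / b) -> divides A p b -> divides A p a.
Proof.
move=> hA [hp p0 p1 pM] ha hb b0 [u [v [hu hv nv E]]] [c [hc ec]].
have nv' : ~ divides A p v by move=> h; apply: nv.
have v0 : v != 0 by apply/eqP => e; apply: nv'; exists 0; rewrite mulr0; split=> //; apply: sub0.
have : divides A p (a * v).
  exists (c * u); split; first exact: subM.
  by move/eqP: E; rewrite eqr_div // => /eqP ->; rewrite ec; ring.
by case/(pM _ _ ha hv).
Qed.

Section OneStep.
Variables (A m : F -> Prop) (d : nat) (X : F) (A' m' : F -> Prop) (d' : nat).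
Hypotheses (hs : qt_step A m d X A' m' d') (d2 : (1 < d)%N) (hQ : quotient_field_is A).

(** V is the local ring of a regular hypersurface with equation p. *)
Definition tracked B n e V p := rsp B n e [:: p] /\ V = localize B (divs B p).

Let hreg := step_reg hs.
Let hreg' := step_reg' hs.
Let hA : is_subring A. Proof. by case: hreg => -[]. Qed.
Let hA' : is_subring A'. Proof. by case: hreg' => -[]. Qed.
Let mA : incl m A. Proof. by case: hreg => -[_ []]. Qed.
Let hQ' : quotient_field_is A' := quotient_field_incl (step_sub hs) hQ.

Lemma step_X0 : X != 0.
Proof. by case: (step_prime hs). Qed.

Lemma step_quot a : m a -> A' (a / X).
Proof. by move=> /(step_div hs) [c [hc ->]]; rewrite mulrAC divff ?mul1r //; exact: step_X0. Qed.

Lemma step_dim : (d' <= d)%N.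
Proof. by have [] := step_rsp hs (rsp_nil hreg) (fun y h => False_ind _ (notF h)). Qed.

Lemma step_fresh : tracked A' m' d' (order_val_ring A m) X.
Proof.
split; last exact: step_val hs.
by have [] := step_rsp hs (rsp_nil hreg) (fun y h => False_ind _ (notF h)).
Qed.

Lemma step_DVR : is_DVR (order_val_ring A m).
Proof. by rewrite (step_val hs); apply: prime_DVR => //; [case: hreg'|exact: (step_prime hs)]. Qed.

(** Were p/X a unit of A', every y in m would have y/p in A' and so in V, which makes p a divisor of
    y in A; but m is not principal in dimension at least 2. *)
Lemma track_in V p : tracked A m d V p -> incl A' V -> m' (p / X).
Proof.
move=> [hr ->] AV; have hp := rsp_prime hreg hr; have [pA p0 _ _] := hp.
have mp : m p by apply: (rsp_mem hr); rewrite mem_head.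
have [y [my ny]] := max_not_principal hreg d2 mp.
apply: contrapT => n'; apply: ny.
have h1 : A' (y / p).
  have -> : y / p = y / X * (p / X)^-1 by field; rewrite step_X0 p0.
  by apply: (subM hA' (step_quot my)); apply: (nonmax_unit hreg') => //; apply: step_quot.
apply: (localize_divsP hA hp (mA my) pA p0 (AV _ h1)).
by exists 1; rewrite mulr1; split=> //; apply: sub1.
Qed.

(** An element b of A not divisible by p is not divisible by p/X in A': a quotient has a denominator
    X^l u in A, and p divides neither this denominator nor X. So V is contained in the localization
    at p/X, and maximality of discrete valuation rings gives equality. *)
Lemma track_next V p : tracked A m d V p -> is_DVR V -> m' (p / X) -> tracked A' m' d' V (p / X).
Proof.
move=> [hr eV] hV mp'; have hp := rsp_prime hreg hr; have [pA p0 _ _] := hp.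
have mp : m p by apply: (rsp_mem hr); rewrite mem_head.
have [|_ hr'] := step_rsp hs hr; first by move=> y; rewrite inE => /eqP ->.
have hr1 := rsp_behead hr'; split=> //.
have hp' := rsp_prime hreg' hr1; have [p'A p'0 p'1 pM'] := hp'.
have nX : ~ divides A' (p / X) X by apply: (rsp_ndvd hreg'); exact: rsp_swap hr'.
have hN' : noetherian A' by case: hreg'.
have X0 := step_X0.
set W := localize A' _.
have hW : is_DVR W by apply: prime_DVR.
have hWs : is_subring W by apply: localize_subring => //; apply: divs_prime.
have AW : incl A' W by apply: localize_sub => //; apply: divs_prime.
have unitX l u : is_unit A' u -> ~ divides A' (p / X) (X ^+ l * u).
  move=> [hu [w [hw uw]]]; have hXA : A' X by case: (step_prime hs).
  move=> /(pM' _ _ (subX hA' _ hXA) hu) [].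
    elim: l => [|l IH]; first by rewrite expr0.
    by rewrite exprS => /(pM' _ _ hXA (subX hA' _ hXA)) [].
  move=> [c [hc ec]]; apply: p'1; exists (c * w); split; first exact: subM.
  by rewrite mulrA -ec uw.
have nd b : A b -> ~ divides A p b -> ~ divides A' (p / X) b.
  move=> hb nb [c [hc ec]].
  have [b1 [b2 [l [u [hb1 hb2 eb b20 [eu hu]]]]]] := step_frac hs hc.
  have [_ _ _ pM] := hp.
  have nb2 : ~ divides A p b2.
    move=> [t [ht et]]; apply: (unitX l u hu); rewrite -eu et; exists (X * t); split; last by field.
    by apply: subM => //; [case: (step_prime hs)|exact: (step_sub hs)].
  have nXA : ~ divides A p X.
    move=> [t [ht et]]; apply: (p'1); exists t; split; first exact: (step_sub hs).
    by apply: (mulfI X0); rewrite mulr1 {1}et; field.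
  have h : divides A p (b * (b2 * X)).
    by exists b1; split=> //; rewrite ec eb; field; rewrite X0 b20.
  have mXA : A X by apply/mA/(step_mX hs).
  by case: (pM _ _ hb (subM hA hb2 mXA) h) => // /(pM _ _ hb2 mXA) [].
have VW : incl V W.
  rewrite eV => _ [a [b [ha hb nb ->]]]; apply: (subM hWs); first by apply/AW/(step_sub hs).
  apply: localize_divs_inv => //; first exact: (step_sub hs).
  by apply: nd => // h; apply: nb.
apply: pred_ext => //; apply: (DVR_maximal hV hWs VW).
exists (p / X)^-1; rewrite -[_^-1]mul1r => h; apply: p'1.
apply: (localize_divsP hA' hp' (sub1 hA') p'A p'0 h); exists 1; rewrite mulr1; split=> //; exact: sub1.
Qed.

(** If e had d members, it would generate m, and the ideal of all a with a/X in m' would contain X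
    itself. *)
Lemma track_size e : rsp A m d e -> (forall y, y \in e -> m' (y / X)) -> (size e < d)%N.
Proof.
move=> [f [sf hf]] em; rewrite ltnNge; apply/negP => le.
have f0 : f = [::].
  by apply/eqP; rewrite -size_eq0 -leqn0 -(leq_add2l (size e)) addn0 -size_cat sf.
have X0 := step_X0; have [[_ [mA' m0 mD mM] m1 _] _ _ _] := hreg'.
pose I a := A a /\ m' (a / X).
suff [_] : I X by rewrite divff.
rewrite f0 cats0 in hf; have := hf X => -[/(_ (step_mX hs)) h _]; apply: h.
- split.
  + by move=> z [].
  + by split; [exact: sub0|rewrite mul0r].
  + by move=> a b [ha h1] [hb h2]; split; [exact: subD|rewrite mulrDl; apply: mD].
  + move=> a b ha [hb h2]; split; [exact: subM|rewrite -mulrA; apply: mM => //; exact: (step_sub hs)].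
- by move=> y hy; split; [apply/mA/(gens_mem hf)|exact: em].
Qed.
End OneStep.
End Steps.

(** * Overrings of the union of a sequence of quadratic transforms *)

Section Overrings.
Variable F : fieldType.
Implicit Types (A B Q V W T : F -> Prop).

(** Shared by Noetherian rings with a proper ideal Q and by discrete valuation rings, so that one
    argument treats both kinds of overring. *)
Definition no_descent A Q := forall y b : nat -> F, (forall k, Q (y k)) -> (forall k, A (b k)) ->
  (forall k, b k = y k * b k.+1) -> b 0%N = 0.

Lemma noeth_no_descent A Q : noetherian A -> is_ideal A Q -> ~ Q 1 -> no_descent A Q.
Proof.
move=> hN [QA _ _ qM] Q1 y b hy hb e; have [hA _] := hN.
pose a k := mk hA (hb k).
have [|k [c /eqP]] := @ascending_seq_stable _ (noeth_up hA hN) (@zid (sr hA)) a (idl_zid _).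
  move=> k; exists (mk hA (QA _ (hy k))); apply/eqP; rewrite subr_eq0; apply/eqP.
  by apply: val_inj; rewrite valM !val_mk.
rewrite subr_eq0 => /eqP/(congr1 val); rewrite valM !val_mk => ek.
have bk : b k.+1 = 0.
  apply: contrapT => /eqP b0; apply: Q1; suff -> : 1 = val c * y k by apply: qM => //; apply: sr_mem.
  by apply: (mulIf b0); rewrite mul1r -mulrA -e.
by elim: k.+1 bk => // j IH ej; apply: IH; rewrite e ej mulr0.
Qed.

Lemma DVR_max V : is_DVR V -> [/\ is_subring V, (forall z, V z \/ V z^-1) &
  exists Q, [/\ is_prime_ideal V Q, no_descent V Q & forall z, V z -> z != 0 -> Q z \/ V z^-1]].
Proof.
move=> [v [vM vD _ vP]].
have v1 : v 1 = 0.
  have := vM 1 1 (oner_neq0 _) (oner_neq0 _); rewrite mulr1 => /eqP.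
  by rewrite -subr_eq0 opprD addNKr oppr_eq0 => /eqP.
have vN1 : v (-1) = 0.
  have h : (-1 : F) != 0 by rewrite oppr_eq0 oner_neq0.
  have := vM _ _ h h; rewrite mulrNN mulr1 v1 -mulr2n => /esym/eqP; by rewrite mulrn_eq0 => /eqP.
have vV z : z != 0 -> v z^-1 = - v z.
  by move=> z0; apply/eqP; rewrite -addr_eq0 -vM ?invr_eq0 // mulVf // v1.
have hVM x y : V x -> V y -> V (x * y).
  move=> /vP [->|[x0 hx]]; first by rewrite mul0r => _; apply/vP; left.
  move=> /vP [->|[y0 hy]]; first by rewrite mulr0; apply/vP; left.
  by apply/vP; right; rewrite mulf_neq0 // vM // addr_ge0.
have hVD x y : V x -> V y -> V (x + y).
  move=> /vP [->|[x0 hx]]; first by rewrite add0r.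
  move=> /vP [->|[y0 hy]]; first by rewrite addr0; move=> *; apply/vP; right.
  apply/vP; have [e|n0] := eqVneq (x + y) 0; [by left|right; split=> //].
  by case: (vD _ _ x0 y0 n0); apply: le_trans.
have hV : is_subring V.
  split=> //; [by apply/vP; left|by apply/vP; right; rewrite oner_neq0 v1|].
  move=> x y hx hy; apply: hVD => //; rewrite -mulN1r; apply: hVM => //.
  by apply/vP; right; rewrite oppr_eq0 oner_neq0 vN1.
split=> //.
  move=> z; have [->|z0] := eqVneq z 0; first by left; apply/vP; left.
  have [h|h] := leP 0 (v z); [by left; apply/vP; right|right; apply/vP; right].
  by rewrite invr_eq0 z0 vV // oppr_ge0 ltW.
pose Q z := z = 0 \/ z != 0 /\ 0 < v z; exists Q.
have QV : incl Q V by move=> z [->|[z0 hz]]; apply/vP; [left|right; rewrite z0 ltW].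
have QD x y : Q x -> Q y -> Q (x + y).
  move=> [->|[x0 hx]]; first by rewrite add0r.
  move=> [->|[y0 hy]]; first by rewrite addr0 => *; right.
  have [e|n0] := eqVneq (x + y) 0; [by left|right; split=> //].
  by case: (vD _ _ x0 y0 n0); apply: lt_le_trans.
have QM a x : V a -> Q x -> Q (a * x).
  move=> /vP [->|[a0 ha]]; first by rewrite mul0r => _; left.
  move=> [->|[x0 hx]]; first by rewrite mulr0; left.
  by right; rewrite mulf_neq0 // vM // ltr_wpDl.
have Q1 : ~ Q 1 by move=> [/eqP|[_]]; [rewrite oner_eq0|rewrite v1 ltxx].
have QP z : V z -> z != 0 -> Q z \/ V z^-1.
  move=> /vP [->|[z0 hz] _]; first by rewrite eqxx.
  have [h|h] := ltP 0 (v z); [by left; right|right; apply/vP; right].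
  by rewrite invr_eq0 z0 vV // oppr_ge0.
split=> //.
  split=> //; first by split=> //; left.
  move=> a b ha hb hab; have [->|a0] := eqVneq a 0; first by left; left.
  have [|va] := QP a ha a0; [by left|right].
  by rewrite -(mulKf a0 b); apply: QM.
move=> y b hy hb e; apply: contrapT => /eqP b0.
have bn k : b k != 0.
  by elim: k => // k; apply: contra_neq => ek; rewrite e ek mulr0.
have yv k : y k != 0 /\ 0 < v (y k).
  by case: (hy k) => // yk; move: (bn k); rewrite e yk mul0r eqxx.
have vb k : v (b k) + k%:Z <= v (b 0%N).
  elim: k => [|k IH]; first by rewrite addr0.
  have [y0 yp] := yv k; apply: le_trans IH; rewrite [b k]e vM //.
  by rewrite intS addrCA -addrA lerD2r -gtz0_ge1.
have vb0 k : 0 <= v (b k) by have /vP [e0|[]] := hb k; [move: (bn k); rewrite e0 eqxx|].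
have := vb `|v (b 0%N)|.+1; rewrite intS gez0_abs // addrA -[leRHS]add0r lerD2r leNgt.
by rewrite ltr_wpDl.
Qed.

(** Factor the denominator and cancel the primes that divide the numerator; the first prime that
    does not divide it excludes z. *)
Lemma exclude_prime T z : noetherian T -> gcd_prop T -> quotient_field_is T -> ~ T z ->
  exists p, prime_elt T p /\ ~ localize T (divs T p) z.
Proof.
move=> hN hG hQ nz; have [hT _] := hN; have [a [b [ha hb b0 ez]]] := hQ z.
have [bu|nb] := pselect (is_unit T b).
  have [_ [c [hc bc]]] := bu; exfalso; apply: nz; rewrite ez (_ : b^-1 = c); first exact: subM.
  by apply: (mulfI b0); rewrite divff // bc.
have [s [hirr eb]] := irreducible_factorization hN hb b0 nb.
rewrite {}eb in ez hb b0 nb; clear b0 nb hb; elim: s a ha hirr ez => [|p s IH] a ha hirr ez.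
  by exfalso; apply: nz; rewrite ez big_nil divr1.
have hp : prime_elt T p by apply: irreducible_prime => //; apply: hirr; rewrite mem_head.
have [pT p0 p1 pM] := hp; rewrite big_cons in ez.
have Ts t : (forall y, y \in t -> irreducible_elt T y) -> T (\prod_(y <- t) y) /\ \prod_(y <- t) y != 0.
  elim: t => [_|y t IHt ht]; first by rewrite big_nil oner_neq0; split=> //; exact: sub1.
  rewrite big_cons; have [h1 h2] := IHt (fun w hw => ht w (@mem_behead _ (y :: t) w hw)).
  have [hy y0 _ _] := ht y (mem_head _ _); by split; [exact: subM|exact: mulf_neq0].
have [h1 h2] := Ts s (fun w hw => hirr w (@mem_behead _ (p :: s) w hw)).
have [[a' [ha' ea]]|na] := pselect (divides T p a).
  apply: (IH a' ha'); first by move=> w hw; apply: hirr; rewrite inE hw orbT.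
  by rewrite ez ea; field; rewrite p0 h2.
exists p; split=> // h; apply: na; rewrite ez in h.
by apply: (localize_divsP hT hp ha _ _ h); [exact: subM|rewrite mulf_neq0|exists (\prod_(y <- s) y)].
Qed.

Lemma localize_fracs A M P : is_subring A -> mult A M -> is_prime_ideal (fracs A M) P ->
  is_prime_ideal A (fun z => A z /\ P z) /\ localize (fracs A M) P = localize A (fun z => A z /\ P z).
Proof.
move=> hA hM hP; have hB := fracs_subring hA hM; have AB := fracs_sub hM (A := A).
have [[PB P0 PD PM] P1 PP] := hP.
have hP' : is_prime_ideal A (fun z => A z /\ P z).
  split; [split|by case|].
  - by move=> z [].
  - by split=> //; exact: sub0.
  - by move=> y z [hy py] [hz pz]; split; [exact: subD|exact: PD].
  - by move=> y z hy [hz pz]; split; [exact: subM|apply: PM => //; exact: AB].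
  - by move=> a b ha hb [_ /PP []]; try exact: AB; [left|right].
split=> //; apply: pred_ext => z.
  move=> [_ [_ [[a [c [ha hc ->]]] [b [e [hb he ->]]] nb ->]]].
  have c0 := mult_neq0 hM hc; have e0 := mult_neq0 hM he.
  have [MA _ _ _] := hM; have [cA eA] := (MA _ hc, MA _ he).
  have nP y : M y -> ~ P y.
    by move=> hy py; apply: P1; rewrite -(mulVf (mult_neq0 hM hy)); apply: PM => //; exact: fracs_inv.
  have nb' : ~ P b by move=> pb; apply: nb; rewrite mulrC; apply: PM => //; exact: fracs_inv.
  have b0 : b != 0 by apply/eqP => b0; apply: nb'; rewrite b0.
  exists (a * e), (b * c); split; [exact: subM|exact: subM| |by field; rewrite c0 e0 b0].
  by move=> [_ /(PP _ _ (AB _ hb) (AB _ cA)) [] //]; apply: nP.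
move=> [a [c [ha hc nc ->]]]; exists a, c; split=> //; try exact: AB.
by move=> pc; apply: nc.
Qed.

Lemma fracs_regular A M m d : regular_local A m d -> mult A M -> regular_ring (fracs A M).
Proof.
move=> hreg hM; have [hl hN _ _] := hreg; have [hA _ _ _] := hl.
have hB := fracs_subring hA hM; split; first exact: fracs_noeth.
move=> P hP; have [hP' E] := localize_fracs hA hM hP.
have [d' [h _]] := regular_localization hreg hP'; exists d'; rewrite E.
suff <- : localize_max A (fun z => A z /\ P z) = localize_max (fracs A M) P by [].
apply: (@max_uniq _ (localize (fracs A M) P)); last exact: localize_local.
by rewrite E; exact: localize_local.
Qed.

Lemma prime_above A x : noetherian A -> A x -> x != 0 -> ~ A x^-1 -> exists Q, is_prime_ideal A Q /\ Q x.
Proof.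
move=> hN hx x0 nx; have [hA _] := hN; pose x' := mk hA hx.
have z0 := idl_zid (sr hA).
have [|||P [hP IP _]] := @prm_disjoint _ (addg (@zid (sr hA)) x') (fun a => a = 1) (noeth_up hA hN) (addg_idl x' z0).
- by [].
- by move=> a b -> ->; rewrite mulr1.
- move=> _ -> [c /eqP]; rewrite subr_eq0 => /eqP/(congr1 val); rewrite val1 valM val_mk => e.
  by apply: nx; rewrite -[x^-1]mul1r e mulfK //; exact: sr_mem.
exists (dn P); split; first exact: prm_dn.
exists x'; split; first exact: val_mk.
by apply: IP; apply: addg_mem.
Qed.

Lemma height_one_principal A P : noetherian A -> gcd_prop A -> height A P 1 ->
  exists p, prime_elt A p /\ P = divs A p.
Proof.
move=> hN hG [[c [[c1 c2] cP]] nc]; have [hA _] := hN.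
have {}cP : c 1%N = P by apply: pred_ext => z /cP.
have hP : is_prime_ideal A P by rewrite -cP; exact: c1.
have [[PA P0 _ PM] P1 PP] := hP.
have [a [Pa a0]] : exists a, P a /\ a != 0.
  apply: contrapT => h; have [_] := c2 0%N isT; apply; rewrite cP => z Pz.
  have -> : z = 0 by apply: contrapT => /eqP z0; apply: h; exists z.
  by case: (c1 0%N isT) => -[].
have na : ~ is_unit A a by move=> [_ [b [hb ab]]]; apply: P1; rewrite -ab mulrC; exact: PM.
have [s [hirr es]] := irreducible_factorization hN (PA _ Pa) a0 na.
have [p [ps Pp]] : exists p, p \in s /\ P p.
  rewrite es in Pa; elim: s hirr Pa {es} => [|p s IH] hirr; first by rewrite big_nil.
  rewrite big_cons => h; have hs : A (\prod_(y <- s) y).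
    rewrite big_seq; elim/big_ind: _ => [||y ys]; [exact: sub1|by move=> *; exact: subM|].
    by case: (hirr y) => //; rewrite inE ys orbT.
  have pA : A p by case: (hirr p (mem_head _ _)).
  case: (PP _ _ pA hs h) => [h'|/IH [|q [qs Pq]]]; first by exists p; rewrite mem_head.
    by move=> y ys; apply: hirr; rewrite inE ys orbT.
  by exists q; rewrite inE qs orbT.
have hp : prime_elt A p by apply: irreducible_prime => //; exact: hirr.
exists p; split=> //; have hD := divs_prime hN hp; have [pA p0 _ _] := hp.
have DP : incl (divs A p) P by move=> _ [_ [t [ht ->]]]; rewrite mulrC; exact: PM.
apply: pred_ext => //; apply: contrapT => nPD; apply: nc.
exists (fun k => if k is k'.+1 then if k' is 0%N then divs A p else P else (fun z => z = 0)).
split=> //; split=> -[|[|k]] // _.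
- split; [split=> //|exact/eqP/oner_neq0|].
  + by move=> z ->; exact: sub0.
  + by move=> x y -> ->; rewrite addr0.
  + by move=> x y _ ->; rewrite mulr0.
  + by move=> x y _ _ /eqP; rewrite mulf_eq0 => /orP [] /eqP; [left|right].
- split; first by move=> z ->; case: hD => -[].
  move=> h; move/eqP: p0; apply; apply: h; split=> //; exists 1; rewrite mulr1; split=> //; exact: sub1.
Qed.

(* Every element of W has a denominator in A that is a unit of W; for a local overring W of A this says that
   W is the localization of A at the center of W. *)
Definition fractions_in A W := forall z, W z -> exists b c, [/\ A b, A c, c != 0, W c^-1 & z = b / c].

(** P is the center of W on A. If c 1 is strictly between c 0 and P, take a in c 1 outside c 0 and b
    in P outside c 1. As a cannot be divided by b forever, some b^k / a is in W = A_P, and clearing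
    the denominator puts b in c 1. *)
Lemma DVR_center A W : is_subring A -> quotient_field_is A -> is_DVR W -> incl A W -> (exists z, ~ W z) -> fractions_in A W ->
  exists P, height A P 1 /\ W = localize A P.
Proof.
move=> hA hF hW AW [z0 nz0] hf; have [hWs WV [Q [hQ wf QP]]] := DVR_max hW.
have [[QW Q0 QD QM] Q1 QPr] := hQ.
pose P z := A z /\ Q z; exists P.
have ninv a : Q a -> a != 0 -> ~ W a^-1.
  by move=> Qa a0 ha; apply: Q1; rewrite -(mulVf a0); exact: QM.
have hP : is_prime_ideal A P.
  split; [split|by case|].
  - by move=> z [].
  - by split=> //; exact: sub0.
  - by move=> y z [hy qy] [hz qz]; split; [exact: subD|exact: QD].
  - by move=> y z hy [hz qz]; split; [exact: subM|apply: QM => //; exact: AW].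
  - by move=> a b ha hb [_ /QPr []]; try exact: AW; [left|right].
have WE : W = localize A P.
  apply: pred_ext => z.
    move=> /hf [b [c [hb hc c0 hci ->]]]; exists b, c; split=> // -[_ Qc]; exact: (ninv c).
  move=> [b [c [hb hc nc ->]]]; have c0 := prime_neq0 hA hP hc nc.
  apply: subM => //; first exact: AW.
  by case: (QP c (AW _ hc) c0) => // Qc; case: nc.
split=> //; split.
  exists (fun k => if k is 0%N then (fun z => z = 0) else P); split=> //; split=> -[|k] // _.
  - split; [split=> //|exact/eqP/oner_neq0|].
    + by move=> z ->; exact: sub0.
    + by move=> x y -> ->; rewrite addr0.
    + by move=> x y _ ->; rewrite mulr0.
    + by move=> x y _ _ /eqP; rewrite mulf_eq0 => /orP [] /eqP; [left|right].
  - split; first by move=> z ->; case: hP => -[].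
    move=> h; apply: nz0; have [a [b [ha hb b0 ->]]] := hF z0.
    by rewrite WE; exists a, b; split=> // /h e; rewrite e eqxx in b0.
move=> [c [[c1 c2] cP]].
have {}cP : c 2%N = P by apply: pred_ext => z /cP.
have [s0 n0] := c2 0%N isT; have [s1 n1] := c2 1%N isT; rewrite cP in s1 n1.
have [a [ca nca]] : exists a, c 1%N a /\ ~ c 0%N a.
  by apply: contrapT => h; apply: n0 => z hz; apply: contrapT => nz; apply: h; exists z.
have [b [Pb ncb]] : exists b, P b /\ ~ c 1%N b.
  by apply: contrapT => h; apply: n1 => z hz; apply: contrapT => nz; apply: h; exists z.
have [[_ _ _ cM] _ cPr] := c1 1%N isT; have [[c0A c00 _ _] _ _] := c1 0%N isT.
have a0 : a != 0 by apply/eqP => e; apply: nca; rewrite e.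
have b0 : b != 0 by apply/eqP => e; apply: ncb; rewrite e; exact: s0.
have [k hk] : exists k, W (b ^+ k / a).
  apply: contrapT => h; move/eqP: a0; apply; have := wf (fun=> b) (fun k => a / b ^+ k).
  rewrite divr1; apply=> k; first by case: Pb.
    case: (WV (a / b ^+ k)) => //; rewrite invf_div => hk; by case: h; exists k.
  by rewrite exprS; field; rewrite expf_neq0.
rewrite WE in hk; have [r [t [hr ht nt E]]] := hk.
have t0 := prime_neq0 hA hP ht nt.
have bA : A b by case: Pb.
have : c 1%N (b ^+ k * t).
  have -> : b ^+ k * t = r * a by apply/eqP; rewrite -eqr_div //; apply/eqP.
  exact: cM.
case/(cPr _ _ (subX hA _ bA) ht) => [|/s1 //].
elim: k {hk E} => [|k IH]; first by rewrite expr0 => h; have [[_ _]] := c1 1%N isT.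
by rewrite exprS => /(cPr _ _ bA (subX hA _ bA)) [].
Qed.
End Overrings.

(** * The sequence, its union S and the overring T *)

Section Sequence.
Variables (F : fieldType) (R m : nat -> F -> Prop) (D : nat -> nat) (X : nat -> F).
Hypotheses (hs : forall i, qt_step (R i) (m i) (D i) (X i) (R i.+1) (m i.+1) (D i.+1))
  (d2 : forall i, (1 < D i)%N) (hQ0 : quotient_field_is (R 0%N)).
Local Notation S := (seq_union R).
Local Notation N := (seq_union m).
Local Notation V := (fun i => order_val_ring (R i) (m i)).

Let hreg i : regular_local (R i) (m i) (D i) := step_reg (hs i).
Let hR i : is_subring (R i). Proof. by case: (hreg i) => -[]. Qed.
Let mR i : incl (m i) (R i). Proof. by case: (hreg i) => -[_ []]. Qed.
Let X0 i : X i != 0 := step_X0 (hs i).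

Lemma R_mono i j : (i <= j)%N -> incl (R i) (R j).
Proof.
move=> /subnK <-; elim: (j - i)%N => [|k IH] z hz //.
by rewrite addSn; apply: (step_sub (hs _)); apply: IH.
Qed.

Lemma m_mono i j : (i <= j)%N -> incl (m i) (m j).
Proof.
move=> /subnK <-; elim: (j - i)%N => [|k IH] z hz //.
by rewrite addSn; apply: (step_max (hs _)); apply: IH.
Qed.

Lemma R_S i : incl (R i) S. Proof. by move=> z hz; exists i. Qed.
Lemma m_N i : incl (m i) N. Proof. by move=> z hz; exists i. Qed.

Lemma S_subring : is_subring S.
Proof.
split; [by exists 0%N; apply: sub0|by exists 0%N; apply: sub1|..] => y z [i hy] [j hz]; exists (maxn i j).
  by apply: subB => //; [apply: R_mono hy; exact: leq_maxl|apply: R_mono hz; exact: leq_maxr].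
by apply: subM => //; [apply: R_mono hy; exact: leq_maxl|apply: R_mono hz; exact: leq_maxr].
Qed.

Lemma seq_quotient_field i : quotient_field_is (R i).
Proof. exact: quotient_field_incl (R_mono (leq0n i)) hQ0. Qed.

Lemma N_S : incl N S. Proof. by move=> z [i /mR hz]; exists i. Qed.

Lemma X_N i : N (X i). Proof. by exists i; exact: step_mX (hs i). Qed.

Lemma R_inv i a : R i a -> ~ m i a -> R i a^-1.
Proof. exact: (nonmax_unit (hreg i)). Qed.

Lemma N_nonunit a : N a -> S a^-1 -> a = 0.
Proof.
move=> [i ma] [j ha]; apply/eqP; apply: contrapT => /negP a0.
apply: (max_nonunit (hreg (maxn i j)) _ _ a0); first by apply: m_mono ma; exact: leq_maxl.
by apply: R_mono ha; exact: leq_maxr.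
Qed.

Lemma X_dvd i j : (i <= j)%N -> divides S (X j) (X i).
Proof.
move=> ij; have [|c [hc ->]] := step_div (hs j) (a := X i).
  by apply: m_mono ij _ _; exact: step_mX (hs i).
by exists c; split=> //; exists j.+1.
Qed.

Section Tracking.

(* The strict transform of X i in R L, for i < L; the value 0 for L <= i is junk. *)
Fixpoint strict_transform i L : F := if L is L'.+1 then if L' == i then X i else strict_transform i L' / X L' else 0.

Lemma strict_transformS i : strict_transform i i.+1 = X i. Proof. by rewrite /= eqxx. Qed.

Lemma strict_transform_step i L : (i < L)%N -> strict_transform i L.+1 = strict_transform i L / X L.
Proof. by move=> iL /=; rewrite gtn_eqF. Qed.

Let V_DVR i : is_DVR (V i) := step_DVR (hs i) (seq_quotient_field i).

Lemma V_tracked i L : (i < L)%N -> incl (R L) (V i) -> tracked (R L) (m L) (D L) (V i) (strict_transform i L).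
Proof.
elim: L => // L IH; rewrite ltnS leq_eqVlt => /orP [/eqP <- _|iL RV].
  by rewrite strict_transformS; exact: (step_fresh (hs i)).
have ht : tracked (R L) (m L) (D L) (V i) (strict_transform i L).
  by apply: IH => // z hz; apply: RV; exact: (step_sub (hs L)).
rewrite strict_transform_step //; apply: (track_next (hs L) (seq_quotient_field L) ht (V_DVR i)).
exact: (track_in (hs L) (d2 L) ht).
Qed.

(* At the last level L with R L inside V i, the strict transform of X i is X L times a unit of R L.+1. *)
Lemma V_escape i : ~ incl S (V i) -> exists n, divides S (X i) (X i.+1 ^+ n).
Proof.
move=> nS; have hS := S_subring.
have [L [iL [ht nt]]] : exists L, (i < L)%N /\
    tracked (R L) (m L) (D L) (V i) (strict_transform i L) /\ ~ m L.+1 (strict_transform i L.+1).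
  apply: contrapT => h; apply: nS => z [k hz].
  have key L : (i < L)%N -> tracked (R L) (m L) (D L) (V i) (strict_transform i L).
    elim: L => // L IH; rewrite ltnS leq_eqVlt => /orP [/eqP <-|iL].
      by rewrite strict_transformS; exact: (step_fresh (hs i)).
    rewrite strict_transform_step //; apply: (track_next (hs L) (seq_quotient_field L) (IH iL) (V_DVR i)).
    apply: contrapT => nt; apply: h; exists L; rewrite strict_transform_step //; split=> //; split=> //; exact: IH.
  have hL : (i < maxn i.+1 k)%N by exact: leq_maxl.
  have [hr ->] := key _ hL; apply: localize_sub => //.
    by apply: divs_prime; [case: (hreg (maxn i.+1 k))|exact: rsp_prime hr].
  by apply: R_mono hz; exact: leq_maxr.
(* The quotient of X i by its strict transform at level L' is the product of the X j with i < j <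
   L', and each of these divides X i.+1 in S. *)
have main L' : (i < L')%N -> incl (R L') (V i) -> strict_transform i L' != 0 /\ exists n s,
    S s /\ X i.+1 ^+ n = s * (X i / strict_transform i L').
  elim: L' => // L' IH; rewrite ltnS leq_eqVlt => /orP [/eqP <- _|iL' RV].
    by rewrite strict_transformS; split=> //; exists 0%N, 1; rewrite divff // mulr1; split=> //; exact: sub1.
  have [|t0 [n [s [hs' es]]]] := IH iL'; first by move=> z hz; apply: RV; exact: (step_sub (hs L')).
  rewrite strict_transform_step //; split; first by rewrite mulf_neq0 ?invr_eq0.
  have [c [hc ec]] := X_dvd iL'; exists n.+1, (s * c); split; first exact: subM.
  by rewrite exprSr es {1}ec; field; rewrite X0 t0.
have [hr eV] := ht.
have hp := rsp_prime (hreg L) hr.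
have [|t0 [n [s [hs' es]]]] := main L iL.
  by rewrite eV; apply: localize_sub => //; apply: divs_prime => //; case: (hreg L).
have ht' : m L (strict_transform i L) by apply: (rsp_mem hr); rewrite mem_head.
have hu : S (strict_transform i L.+1)^-1.
  exists L.+1; apply: R_inv => //; rewrite strict_transform_step //; exact: (step_quot (hs L)).
have [c [hc ec]] := X_dvd iL.
exists n.+1, (s * c * (strict_transform i L.+1)^-1); split; first by apply: subM => //; exact: subM.
rewrite strict_transform_step // exprSr es {1}ec; field; by rewrite X0 t0.
Qed.

Fixpoint inside L : seq nat :=
  if L is L'.+1 then if `[< incl S (V L') >] then L' :: inside L' else inside L' else [::].

Lemma mem_inside i L : i \in inside L = (i < L)%N && `[< incl S (V i) >].
Proof.
elim: L => //= L IH; rewrite ltnS leq_eqVlt; case: ifP => h; rewrite ?inE IH.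
  by have [->|_] //= := eqVneq i L; rewrite h.
by have [->|_] //= := eqVneq i L; rewrite h andbF.
Qed.

(** Strict transforms that belong to a V i containing S stay in the maximal ideals, so [step_rsp]
    carries all of them along; X L is kept in front of them only if V L contains S. *)
Lemma inside_rsp L : rsp (R L) (m L) (D L) [seq strict_transform i L | i <- inside L].
Proof.
elim: L => [|L IH]; first exact: rsp_nil (hreg 0).
have em y : y \in [seq strict_transform i L | i <- inside L] -> m L.+1 (y / X L).
  move=> /mapP [i]; rewrite mem_inside => /andP [iL /asboolP SV] ->.
  apply: (track_in (hs L) (d2 L) (V_tracked iL _)) => z hz; apply: SV; exact: R_S hz.
have [_ h] := step_rsp (hs L) IH em.
have E : [seq strict_transform i L.+1 | i <- inside L] = [seq y / X L | y <- [seq strict_transform i L | i <- inside L]].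
  rewrite -map_comp; apply/eq_in_map => i; rewrite mem_inside => /andP [iL _] /=; by rewrite gtn_eqF.
rewrite [inside L.+1]/=; case: ifP => _; last by rewrite E; exact: rsp_behead h.
by rewrite map_cons E strict_transformS.
Qed.

Lemma D_le L : (D L <= D 0)%N.
Proof. by elim: L => // L; apply: leq_trans; exact: step_dim (hs L). Qed.

Lemma inside_size L : (size (inside L) < D 0)%N.
Proof.
apply: leq_trans (D_le L); rewrite -(size_map (strict_transform^~ L)).
apply: (track_size (hs L)); first exact: inside_rsp.
move=> y /mapP [i]; rewrite mem_inside => /andP [iL /asboolP SV] ->.
apply: (track_in (hs L) (d2 L) (V_tracked iL _)) => z hz; apply: SV; exact: R_S hz.
Qed.

Lemma V_bound (s : seq nat) : (forall i, i \in s -> incl S (V i)) -> uniq s -> (size s < D 0)%N.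
Proof.
move=> sV us; apply: leq_ltn_trans (inside_size (\max_(i <- s) i).+1).
apply: uniq_leq_size => // i si; rewrite mem_inside ltnS; apply/andP; split; last by apply/asboolP; exact: sV.
exact: (leq_bigmax_seq (F := id)).
Qed.

Lemma V_eventually : exists j0, forall j, (j0 <= j)%N -> ~ incl S (V j).
Proof.
apply: contrapT => h.
have next j0 : exists j, (j0 <= j)%N /\ incl S (V j).
  apply: contrapT => h'; apply: h; exists j0 => j jj SV; apply: h'; by exists j.
have [L hL] : exists L, (D 0 <= size (inside L))%N.
  elim: (D 0) => [|k [L hL]]; first by exists 0%N.
  have [j [Lj SV]] := next L; exists j.+1; rewrite /= (introT (asboolP _) SV) ltnS.
  apply: leq_trans hL _; have [u1 u2] : uniq (inside L) /\ uniq (inside j).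
    suff H M : uniq (inside M) by [].
    elim: M => //= M IH; case: ifP => _ //=; by rewrite IH mem_inside ltnn.
  apply: uniq_leq_size => // i; rewrite !mem_inside => /andP [iL ->]; by rewrite (leq_trans iL Lj).
by have := inside_size L; rewrite ltnNge hL.
Qed.
End Tracking.

(* xS is N-primary. *)
Definition primary_gen x := [/\ N x, x != 0 & forall z, N z -> exists n, divides S x (z ^+ n)].

Lemma primary_ex : exists j0, forall j, (j0 <= j)%N -> primary_gen (X j).
Proof.
have hS := S_subring; have [j0 hj] := V_eventually; exists j0 => j jj; split=> //; first exact: X_N.
(* Beyond j0 no V i contains S, so each X i divides a power of the next one, and these
   divisibilities compose. *)
have key l : exists n, divides S (X j) (X (j + l) ^+ n).
  elim: l => [|l [n [c [hc ec]]]]; first by exists 1%N, 1; rewrite addn0 expr1 mulr1; split=> //; exact: sub1.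
  have [|n' [c' [hc' ec']]] := @V_escape (j + l)%N; first by apply: hj; apply: leq_trans jj (leq_addr _ _).
  exists (n' * n)%N, (c * c' ^+ n); split; first by apply: subM => //; apply: subX.
  by rewrite addnS exprM ec' exprMn ec mulrA.
move=> z [k hz]; have [|c [hc ->]] := step_div (hs (j + k)) (a := z).
  by apply: m_mono hz; exact: leq_addl.
have [n [c' [hc' ec']]] := key k; exists n, (c' * c ^+ n); split.
  by apply: subM => //; apply: subX => //; exists (j + k).+1.
by rewrite exprMn ec' mulrA.
Qed.

Lemma absorbed A Q : is_subring A -> incl S A -> is_ideal A Q -> ~ Q 1 -> incl N Q -> no_descent A Q -> incl A S.
Proof.
move=> hA SA [QA _ _ qM] Q1 NQ wf z hz; apply: contrapT => nz.
have [a [b [ha hb b0 ez]]] := hQ0 z.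
pose P k := \prod_(i < k) X i.
have PS k : P k.+1 = P k * X k by rewrite /P big_ord_recr.
have P0 k : P k != 0 by apply/prodf_neq0 => i _.
(* Neither quotient can be a unit before the next division. If b / P k is a unit of R k, then z is
   in R k; if z * (b / P k) is one, then 1 is in Q, because b / P k is in m k and hence in Q. *)
have key k : R k (b / P k) /\ R k (z * (b / P k)).
  elim: k => [|k [h1 h2]].
    by rewrite /P big_ord0 divr1 ez divfK.
  have bk0 : b / P k != 0 by rewrite mulf_neq0 ?invr_eq0.
  have mb : m k (b / P k).
    apply: contrapT => nm; apply: nz; rewrite -(mulfK bk0 z); exists k.
    by apply: subM => //; exact: R_inv.
  have ma : m k (z * (b / P k)).
    apply: contrapT => nm; apply: Q1.
    have za0 : z * (b / P k) != 0.
      by rewrite mulf_neq0 //; apply/eqP => e; apply: nz; rewrite e; exact: sub0 S_subring.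
    have zi : R k (z * (b / P k))^-1 by exact: R_inv.
    rewrite -(mulVf za0); apply: (qM); first by apply: SA; exists k.
    by apply: qM => //; apply: NQ; exists k.
  have e1 : b / P k.+1 = b / P k / X k by rewrite PS; field; rewrite P0 X0.
  by rewrite e1 [z * _]mulrA; split; exact: (step_quot (hs k)).
have := wf X (fun k => b / P k); rewrite /P big_ord0 divr1 => h.
move/eqP: b0; apply; apply: h => k.
- by apply: NQ; exists k; exact: step_mX (hs k).
- by apply: SA; exists k; case: (key k).
- by rewrite -/(P k) -/(P k.+1) PS; field; rewrite P0 X0.
Qed.

(** A prime Q of A containing x contains N, each element of which has a power in xS; then [absorbed]
    would give A = S. *)
Lemma primary_inv x A : primary_gen x -> is_subring A -> incl S A -> ~ incl A S ->
  (~ A x^-1 -> exists Q, [/\ is_prime_ideal A Q, Q x & no_descent A Q]) -> A x^-1.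
Proof.
move=> [Nx x0 hx] hA SA nAS h; apply: contrapT => nx; have [Q [[hQ Q1 QP] Qx wf]] := h nx.
have [_ _ _ qM] := hQ.
apply: nAS; apply: (absorbed hA SA hQ Q1 _ wf) => z Nz.
have [n [c [hc ec]]] := hx z Nz.
have : Q (z ^+ n) by rewrite ec mulrC; apply: qM => //; exact: SA.
have zA := SA _ (N_S Nz).
elim: n {ec} => [|n IH]; first by rewrite expr0.
by rewrite exprS => /(QP _ _ zA (subX hA _ zA)) [].
Qed.

Lemma DVR_inv x W : primary_gen x -> is_DVR W -> incl S W -> ~ incl W S -> W x^-1.
Proof.
move=> hx hW SW nWS; have [hWs _ [Q [hQ wf QP]]] := DVR_max hW.
apply: (primary_inv hx) => // nx; exists Q; split=> //.
have [Nx x0 _] := hx; by case: (QP x _ x0) => //; apply: SW; exact: N_S.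
Qed.

Lemma noeth_inv x A : primary_gen x -> noetherian A -> incl S A -> ~ incl A S -> A x^-1.
Proof.
move=> hx hN SA nAS; have [hA _] := hN; apply: (primary_inv hx) => // nx.
have [Nx x0 _] := hx; have [Q [hQ Qx]] := prime_above hN (SA _ (N_S Nx)) x0 nx.
exists Q; split=> //; have [hi Q1 _] := hQ; exact: noeth_no_descent.
Qed.

Section Invert.
Variable x : F.
Hypothesis hx : primary_gen x.
Local Notation T := (invert_elt S x).

Let Nx : N x. Proof. by case: hx. Qed.
Let x0 : x != 0. Proof. by case: hx. Qed.
Let Sx : S x := N_S Nx.
Let hS : is_subring S := S_subring.
Let hM : mult S (powers x) := powers_mult hS Sx x0.

Lemma invert_fracs : T = fracs S (powers x).
Proof.
apply: pred_ext => z; first by move=> [s [k [h ->]]]; exists s, (x ^+ k); split=> //; exists k.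
by move=> [s [_ [h [k ->] ->]]]; exists s, k.
Qed.

Lemma invert_subring : is_subring T.
Proof. by rewrite invert_fracs; exact: fracs_subring. Qed.

Lemma invert_sub : incl S T.
Proof. by rewrite invert_fracs; exact: fracs_sub. Qed.

Lemma invert_inv : T x^-1.
Proof. by exists 1, 1%N; rewrite mul1r; split=> //; exact: sub1. Qed.

Lemma invert_min A : is_subring A -> incl S A -> A x^-1 -> incl T A.
Proof. by move=> hA SA hx' _ [s [k [h ->]]]; rewrite -exprVn; apply: subM => //; [exact: SA|exact: subX]. Qed.

Lemma invert_unit y : S y -> divides S y x -> T y^-1.
Proof.
move=> hy [c [hc ec]]; have y0 : y != 0 by apply: contra_neq x0 => e; rewrite ec e mul0r.
have c0 : c != 0 by apply: contra_neq x0 => e; rewrite ec e mulr0.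
by rewrite (_ : y^-1 = c * x^-1); [exact: (subM invert_subring (invert_sub hc) invert_inv)|rewrite ec; field; rewrite y0 c0].
Qed.

Lemma invert_proper : ~ incl T S.
Proof. by move=> h; move/eqP: x0; apply; apply: (N_nonunit Nx); apply: h; exact: invert_inv. Qed.
End Invert.

Lemma invert_uniq x y : primary_gen x -> primary_gen y -> invert_elt S x = invert_elt S y.
Proof.
move=> hx hy; suff H u v : primary_gen u -> primary_gen v -> incl (invert_elt S u) (invert_elt S v).
  by apply: pred_ext; apply: H.
move=> hu hv; apply: invert_min; [exact: invert_subring|exact: invert_sub|].
have [Nu u0 hu'] := hu; have [Nv v0 _] := hv; have [n [c [hc ec]]] := hu' v Nv.
have c0 : c != 0 by apply/eqP => e; move/eqP: ec; rewrite e mulr0 expf_eq0 (negPf v0) andbF.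
exists c, n; split=> //; rewrite ec; field; by rewrite u0 c0.
Qed.

Section Localization.
Variable i : nat.
Hypothesis hi : primary_gen (X i).
Local Notation T := (invert_elt S (X i)).

Definition T_units : F -> Prop := fun c => [/\ R i c, c != 0 & T c^-1].

Let hT : is_subring T := invert_subring hi.
Let ST : incl S T := invert_sub hi.

Lemma T_units_mult : mult (R i) T_units.
Proof.
split; [by move=> z []|split|move=> a b [ha a0 a1] [hb b0 b1]; split|by move=> [_ /eqP]].
- exact: sub1.
- exact: oner_neq0.
- by rewrite invr1; exact: sub1.
- exact: subM.
- exact: mulf_neq0.
- by rewrite invfM; exact: subM.
Qed.

(** Climbs the sequence from R i: an element of the next ring has a denominator X^l u with u a unit
    there and X a divisor of X i in S, so the denominator is invertible in T. *)
Lemma T_fracs : T = fracs (R i) T_units.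
Proof.
have hM := T_units_mult; have hF := fracs_subring (hR i) hM.
have RF := fracs_sub hM.
have inv_in z : fracs (R i) T_units z -> z != 0 -> T z^-1 -> fracs (R i) T_units z^-1.
  move=> [a [c [ha [hc c0 c1] ez]]] z0 hz.
  have a0 : a != 0 by apply: contra_neq z0 => e; rewrite ez e mul0r.
  exists c, a; split=> //; last by rewrite ez invf_div.
  split=> //; rewrite (_ : a^-1 = z^-1 * c^-1); first exact: subM.
  by rewrite ez; field; rewrite c0 a0.
apply: pred_ext; last first.
  by move=> _ [a [c [ha [hc c0 c1] ->]]]; apply: subM => //; apply: ST; exists i.
apply: invert_min => //; last first.
  apply: fracs_inv => //; split=> //; [exact: mR (step_mX (hs i))|exact: invert_inv].
have key k : incl (R (i + k)%N) (fracs (R i) T_units).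
  elim: k => [|k IH] z; first by rewrite addn0; exact: RF.
  rewrite addnS => /(step_frac (hs (i + k)%N)) [b [c [l [u [hb hc -> c0 [ec hu]]]]]].
  apply: subM => //; first exact: IH.
  apply: inv_in => //; first exact: IH.
  rewrite ec invfM -exprVn; apply: subM => //.
    apply: subX => //; apply: (invert_unit hi); first exact: N_S (X_N _).
    apply: X_dvd; exact: leq_addr.
  have [hu' [w [hw uw]]] := hu; have u0 : u != 0 by apply: contra_neq c0 => e; rewrite ec e mulr0.
  rewrite (_ : u^-1 = w); first by apply: ST; exists (i + k).+1.
  by apply: (mulfI u0); rewrite divff // uw.
by move=> z [k hz]; apply: (key k); apply: R_mono hz; exact: leq_addl.
Qed.

Lemma T_localization : is_localization_of (R i) T.
Proof. by have [h1 h2 h3 h4] := T_units_mult; exists T_units; split=> // z; rewrite T_fracs. Qed.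

Lemma T_noeth : noetherian T.
Proof. by rewrite T_fracs; apply: fracs_noeth => //; [exact: T_units_mult|case: (hreg i)]. Qed.

Lemma T_regular : regular_ring T.
Proof. by rewrite T_fracs; apply: fracs_regular (hreg i) _; exact: T_units_mult. Qed.

Lemma T_gcd : gcd_prop T.
Proof. by rewrite T_fracs; apply: gcd_fracs => //; [exact: T_units_mult|exact: regular_gcd (hreg i)]. Qed.

Lemma T_quotient_field : quotient_field_is T.
Proof. by apply: (quotient_field_incl _ (seq_quotient_field i)) => z hz; apply: ST; exists i. Qed.

Lemma T_UFD : is_UFD T.
Proof. by apply: gcd_UFD; [exact: T_noeth|exact: T_gcd]. Qed.

Lemma hull_invert : dvr_hull S = T.
Proof.
apply: pred_ext => z.
  move=> hz; apply: contrapT => nz; have hN := T_noeth.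
  have [p [hp np]] := exclude_prime hN T_gcd T_quotient_field nz.
  have TW : incl T (localize T (divs T p)) by apply: localize_sub => //; exact: divs_prime.
  apply: np; apply: hz.
  - apply: prime_DVR => //; exact: T_quotient_field.
  - by move=> w hw; apply/TW/ST.
  - by move=> h; apply: (invert_proper hi) => w /TW; exact: h.
move=> hz V hV SV nV; apply: invert_min hz => //; first by case: (DVR_max hV).
exact: (DVR_inv hi).
Qed.

Lemma T_minimal : minimal_proper_noeth_overring S T /\
  forall A, minimal_proper_noeth_overring S A -> set_eq A T.
Proof.
have TA A : proper_noeth_overring S A -> incl T A.
  move=> [[hA SA] nA hN]; apply: invert_min => //; exact: (noeth_inv hi).
have hP : proper_noeth_overring S T by split; [split|exact: invert_proper|exact: T_noeth].
split; first by split=> // B hB BT z; split; [exact: BT|exact: TA].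
by move=> A [hA Amin] z; have h := Amin T hP (TA _ hA) z; split=> /h.
Qed.
End Localization.

(** Since m i is not principal, some y in it is not divisible by p; its inverse is in the
    localization but not in S. *)
Lemma prime_loc_proper i p : prime_elt (R i) p -> ~ incl (localize (R i) (divs (R i) p)) S.
Proof.
move=> hp h; have [pR p0 p1 _] := hp.
have mp : m i p.
  apply: contrapT => nm; apply: p1; exists p^-1; rewrite divff //; split=> //; exact: R_inv.
have [y [my ny]] := max_not_principal (hreg i) (d2 i) mp.
have y0 : y != 0 by apply/eqP => e; apply: ny; exists 0; rewrite e mulr0; split=> //; exact: sub0.
move/eqP: y0; apply; apply: (N_nonunit (m_N my)); apply: h; apply: localize_divs_inv => //; exact: mR.
Qed.

Lemma V_proper i : ~ incl (V i) S.
Proof. by rewrite /= (step_val (hs i)); apply: prime_loc_proper; exact: step_prime (hs i). Qed.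

Lemma height_one_DVR P : height (R 0%N) P 1 ->
  is_DVR (localize (R 0%N) P) /\ ~ incl (localize (R 0%N) P) S.
Proof.
have hN : noetherian (R 0%N) by case: (hreg 0).
move=> /(height_one_principal hN (regular_gcd (hreg 0))) [p [hp ->]].
by split; [exact: prime_DVR|exact: prime_loc_proper].
Qed.

(** If X j is a unit of W, the denominators X j ^ l u of elements of R j.+1 are units of W, and
    fractions descend to R j. Otherwise no denominator that is a unit of W is divisible by X j, so W
    is contained in V j and equals it by maximality. *)
Lemma descend W j : is_DVR W -> incl S W -> (exists z, ~ W z) -> fractions_in (R j) W ->
  (exists i, V i = W) \/ fractions_in (R 0%N) W.
Proof.
move=> hW SW nW; elim: j => [|j IH] hf; [by right|]; have [hWs _ _] := DVR_max hW.
have XS : S (X j) := N_S (X_N j).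
have [hX|nX] := pselect (W (X j)^-1).
  apply: IH => z /hf [b [c [hb hc c0 hci ->]]].
  have uW l u : is_unit (R j.+1) u -> W (X j ^+ l * u)^-1.
    move=> [hu [w [hw uw]]]; have u0 : u != 0 by apply: contra_neq (@oner_neq0 F) => e; rewrite -uw e mul0r.
    rewrite invfM -exprVn; apply: subM => //; first exact: subX.
    rewrite (_ : u^-1 = w); first by apply: SW; exists j.+1.
    by apply: (mulfI u0); rewrite divff // uw.
  have [b1 [b2 [l [u [hb1 hb2 eb b20 [eu hu]]]]]] := step_frac (hs j) hb.
  have [c1 [c2 [l' [u' [hc1 hc2 ec c20 [eu' hu']]]]]] := step_frac (hs j) hc.
  have c10 : c1 != 0 by apply: contra_neq c0 => e; rewrite ec e mul0r.
  exists (b1 * c2), (c1 * b2); split; try exact: subM; first exact: mulf_neq0.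
    rewrite (_ : (c1 * b2)^-1 = c^-1 * c2^-1 * b2^-1); last by rewrite ec; field; rewrite c10 c20 b20.
    by apply: subM => //; [apply: subM => //; rewrite eu'; exact: uW|rewrite eu; exact: uW].
  by rewrite eb ec; field; rewrite c10 c20 b20.
left; exists j; have VE : V j = localize (R j.+1) (divs (R j.+1) (X j)) := step_val (hs j).
have hp := step_prime (hs j); have hN : noetherian (R j.+1) by case: (hreg j.+1).
have hVs : is_subring (V j) by rewrite VE; apply: localize_subring => //; exact: divs_prime.
have WV : incl W (V j).
  move=> z /hf [b [c [hb hc c0 hci ->]]]; rewrite VE; exists b, c; split=> // -[_ [t [ht et]]].
  apply: nX; rewrite (_ : (X j)^-1 = t * c^-1); first by apply: subM => //; apply: SW; exists j.+1.
  have t0 : t != 0 by apply: contra_neq c0 => e; rewrite et e mulr0.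
  by rewrite et; field; rewrite X0 t0.
apply: pred_ext => //; apply: (DVR_maximal hW hVs WV); exists (X j)^-1; rewrite VE => h.
have [pR p0 p1 _] := hp; apply: p1; rewrite -[_^-1]mul1r in h.
apply: (localize_divsP (hR _) hp (sub1 (hR _)) pR p0 h); exists 1; rewrite mulr1; split=> //; exact: sub1.
Qed.

Lemma hull_intersection i : primary_gen (X i) -> set_eq (dvr_hull S) (fun z =>
  (forall P, height (R 0%N) P 1 -> incl S (localize (R 0%N) P) -> localize (R 0%N) P z) /\
  (forall i, incl S (V i) -> V i z)).
Proof.
move=> hi z; split.
  move=> hz; split=> [P hP SP|j SV]; last by apply: hz => //; [exact: step_DVR (hs j) (seq_quotient_field j)|exact: V_proper].
  by have [h1 h2] := height_one_DVR hP; apply: hz.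
move=> [h1 h2]; rewrite (hull_invert hi); apply: contrapT => nz.
have hN := T_noeth hi; have hT := invert_subring hi.
have [p [hp np]] := exclude_prime hN (T_gcd hi) (T_quotient_field hi) nz.
have hW := prime_DVR hN hp (T_quotient_field hi).
set W := localize _ _ in np hW; have [hWs _ _] := DVR_max hW.
have TW : incl (invert_elt S (X i)) W by apply: localize_sub => //; exact: divs_prime.
have SW : incl S W by move=> w /(invert_sub hi) /TW.
(* A denominator in T not divisible by p is a unit of W; writing it, and the numerator, over R i
   introduces only units of T. *)
have hf : fractions_in (R i) W.
  move=> w [a [b [ha hb nb ->]]]; move: (ha) (hb); rewrite {1 2}(T_fracs hi).
  move=> [a1 [a2 [ha1 [ha2 a20 Ta2] ea]]] [b1 [b2 [hb1 [hb2 b20 Tb2] eb]]].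
  have nb' : ~ divides (invert_elt S (X i)) p b by move=> h; apply: nb.
  have b0 : b != 0 by apply/eqP => e; apply: nb'; exists 0; rewrite e mulr0; split=> //; exact: sub0.
  have b10 : b1 != 0 by apply: contra_neq b0 => e; rewrite eb e mul0r.
  exists (a1 * b2), (a2 * b1); split; [exact: subM|exact: subM|exact: mulf_neq0| |].
    rewrite (_ : (a2 * b1)^-1 = a2^-1 * (b2^-1 * b^-1)); last by rewrite eb; field; rewrite a20 b10 b20.
    apply: subM => //; first exact: TW.
    by apply: subM => //; [exact: TW|exact: localize_divs_inv].
  by rewrite ea eb; field; rewrite a20 b10 b20.
case: (descend hW SW (ex_intro _ z np) hf) => [[j e]|h0].
  by apply: np; rewrite -e; apply: h2; rewrite e.
have R0W : incl (R 0%N) W by move=> w hw; apply: SW; exists 0%N.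
have [P [hP WP]] := DVR_center (hR 0) hQ0 hW R0W (ex_intro _ z np) h0.
by apply: np; rewrite WP; apply: h1 => //; rewrite -WP.
Qed.
End Sequence.

Theorem theorem4p1 (F : fieldType) (d : nat)
    (R m : nat -> F -> Prop)
    (hR0q : quotient_field_is (R 0%N))
    (hd : (2 <= d)%N)
    (hR0 : regular_local (R 0%N) (m 0%N) d)
    (hreg : forall i, exists di, (2 <= di)%N /\ regular_local (R i) (m i) di)
    (hqt : forall i, local_quadratic_transform (R i) (m i) (R i.+1))
    (hstrict : forall i, strict_sub (R i) (R i.+1)) :
  let S := seq_union R in
  let N := seq_union m in
  let T := dvr_hull S in
  let V := fun i => order_val_ring (R i) (m i) in
  (* (1) *)
  ((forall x, N x -> set_eq (radical S (principal S x)) N ->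
       set_eq T (invert_elt S x)) /\
   (exists i0, forall i, (i0 <= i)%N -> is_localization_of (R i) T) /\
   is_UFD T) /\
  (* (2) *)
  (set_eq T (fun z =>
      (forall P, height (R 0%N) P 1 -> sub_set S (localize (R 0%N) P) ->
                 localize (R 0%N) P z) /\
      (forall i, sub_set S (V i) -> V i z)) /\
   (forall s : seq nat, (forall i, i \in s -> sub_set S (V i)) ->
      (forall j k, (j < size s)%N -> (k < size s)%N -> j != k ->
                   ~ set_eq (V (nth 0%N s j)) (V (nth 0%N s k))) ->
      (size s <= d - 1)%N)) /\
  (* (3) *)
  (noetherian T /\ regular_ring T /\
   minimal_proper_noeth_overring S T /\
   (forall A, minimal_proper_noeth_overring S A -> set_eq A T)).
Proof.
move=> S N T V.
have [D0 hD0] := choice hreg.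
(* Level 0 keeps the given d, in terms of which the bound in (2) is stated, while [hreg] comes with
   its own dimension there. *)
pose D i := if i is 0%N then d else D0 i.
have hD i : (1 < D i)%N /\ regular_local (R i) (m i) (D i) by case: i => [|i] //; exact: hD0.
have /choice [X hs] : forall i, exists X, qt_step (R i) (m i) (D i) X (R i.+1) (m i.+1) (D i.+1).
  by move=> i; apply: qt_step_ex => //; case: (hD i); case: (hD i.+1).
have d2 i : (1 < D i)%N by case: (hD i).
have [j0 hj] := primary_ex hs d2 hR0q.
have h0 := hj j0 (leqnn _); have TE := hull_invert hs hR0q h0.
have E : T = invert_elt S (X j0) := TE.
have [Tmin Tuniq] := T_minimal hs hR0q h0.
split; [split; [|split]|split; [split|split; [|split; [|split]]]].
- move=> x Nx xN z; suff hx : primary_gen R m x by rewrite E (invert_uniq hs h0 hx).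
  have rad w : N w -> exists n, divides S x (w ^+ n) by move=> /xN [].
  split=> //; apply/eqP => x0; have [n [c [_ e]]] := rad _ (X_N hs 0).
  by move/eqP: e; rewrite x0 mul0r expf_eq0 (negPf (step_X0 (hs 0%N))) andbF.
- exists j0 => i ij; rewrite E (invert_uniq hs h0 (hj i ij)).
  exact: (T_localization hs (hj i ij)).
- by rewrite E; exact: (T_UFD hs h0).
- exact: (hull_intersection hs d2 hR0q h0).
(* [V_bound] counts distinct indices; equal indices in s would give equal valuation rings. *)
- move=> s sV sd; suff us : uniq s by rewrite subn1 -ltnS prednK ?(V_bound hs d2 hR0q sV us) // (leq_trans _ hd).
  apply/(uniqP 0%N) => j k js ks e; apply: contrapT => /eqP jk.
  by apply: (sd j k js ks jk) => z; rewrite e.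
- by rewrite E; exact: (T_noeth hs h0).
- by rewrite E; exact: (T_regular hs h0).
- by rewrite E.
- by rewrite E.
Qed.
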